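(* Let $G$ be an abelian group with a translation invariant metric $d$ such that $(G,d)$ is separable and complete, and let $\Lambda\ne\emptyset$ be an index set. Assume: (A1) for each $\lambda\in\Lambda$, $A_\lambda:D(A_\lambda)\subset\mathrm{BUC}(G)\to\mathrm{BUC}(G)$ is the generator of a Markovian convolution semigroup $(S_\lambda(t))_{t\ge0}$ of linear operators on $\mathrm{BUC}(G)$; (A2) the subspace $$D:=\Big\{f\in\bigcap_{\lambda\in\Lambda}D(A_\lambda):\ \{A_\lambda f:\lambda\in\Lambda\}\text{ is bounded and uniformly equicontinuous}\Big\}$$ is dense in $\mathrm{BUC}(G)$. Then there exist a sublinear expectation space $(\Omega,\mathcal F,\mathcal E)$ and a $G$-valued $\mathcal E$-Lévy process $(X_t)_{t\ge0}$ such that for each $f\in\mathrm{BUC}(G)$ the function $$(u(t))(x):=\mathcal E(f(x+X_t)),\qquad t\ge0,\ x\in G,$$ is a $D$-viscosity solution of the fully nonlinear PDE $$u_t(t,x)=\sup_{\lambda\in\Lambda}(A_\lambda u(t))(x),\quad (t,x)\in(0,\infty)\times G,\qquad u(0,x)=f(x),\quad x\in G.$$ Moreover, there exists a set $\mathcal P$ of probability measures on $(\Omega,\mathcal F)$ such that $\mathcal E(Y)=\sup_{\mathbb P\in\mathcal P}\mathbb E_{\mathbb P}(Y)$ for all $Y\in\mathcal L^\infty(\Omega,\mathcal F)$.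
   Context: $C_b(G)$ and $\mathrm{BUC}(G)$ denote the spaces of bounded continuous, respectively bounded uniformly continuous, functions $G\to\mathbb R$, with supremum norm $\|\cdot\|_\infty$. Inequalities, suprema and monotone limits of functions are pointwise. $\mathcal L^\infty(\Omega,\mathcal F)$ is the space of bounded measurable functions $\Omega\to\mathbb R$. A convex expectation on a convex set $M$ of real functions containing the constants is a map $\mathcal E:M\to\mathbb R$ with: $\mathcal E(X)\le\mathcal E(Y)$ whenever $X\le Y$; $\mathcal E(\alpha)=\alpha$ for all $\alpha\in\mathbb R$; $\mathcal E(\lambda X+(1-\lambda)Y)\le\lambda\mathcal E(X)+(1-\lambda)\mathcal E(Y)$ for $\lambda\in[0,1]$. It is sublinear if in addition $\mathcal E(\lambda X)=\lambda\mathcal E(X)$ for all $\lambda>0$. A convex (sublinear) expectation space $(\Omega,\mathcal F,\mathcal E)$ is a measurable space with a convex (sublinear) expectation $\mathcal E:\mathcal L^\infty(\Omega,\mathcal F)\to\mathbb R$ which is continuous from below, i.e. $\mathcal E(X_n)\nearrow\mathcal E(X)$ for every increasing sequence $(X_n)$ in $\mathcal L^\infty(\Omega,\mathcal F)$ converging pointwise to $X\in\mathcal L^\infty(\Omega,\mathcal F)$. $G$ carries its Borel $\sigma$-algebra. The distribution of a measurable $X:\Omega\to G$ under $\mathcal E$ is $\mathcal E\circ X^{-1}:C_b(G)\to\mathbb R$, $f\mapsto\mathcal E(f(X))$. For a random variable $Y:\Omega\to S$ with values in a Polish space $S$, $X$ is independent of $Y$ if $\mathcal E(f(Y,X))=\mathcal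 E\big(\mathcal E(f(y,X))|_{y=Y}\big)$ for all $f\in C_b(S\times G)$ (here $y\mapsto\mathcal E(f(y,X))$ is bounded and lower semicontinuous). Given a convex expectation space $(\Omega,\mathcal F,\mathcal E)$, a family $(X_t)_{t\ge0}$ is a ($G$-valued) $\mathcal E$-Lévy process if (i) each $X_t:\Omega\to G$ is measurable; (ii) $\mathcal E(f(X_0))=f(0)$ for all $f\in C_b(G)$; (iii) $\mathcal E\circ(X_{s+t}-X_s)^{-1}=\mathcal E\circ X_t^{-1}$ for all $s,t\ge0$; (iv) $X_{s+t}-X_s$ is independent of $(X_{t_1},\dots,X_{t_n})$ for all $s,t\ge0$, $n\in\mathbb N$, $0\le t_1<\dots<t_n\le s$; (v) $\mathcal E(f(X_t))\to f(0)$ as $t\searrow0$ for all $f\in C_b(G)$. A convex Markovian convolution is a map $\mathcal S:\mathrm{BUC}(G)\to\mathrm{BUC}(G)$ such that $f\mapsto(\mathcal Sf)(x)$ is a convex expectation on $\mathrm{BUC}(G)$ for every $x\in G$; $\mathcal Sf_n\nearrow\mathcal Sf$ for every increasing sequence $(f_n)$ in $\mathrm{BUC}(G)$ converging pointwise to $f\in\mathrm{BUC}(G)$; and $(\mathcal Sf)(x)=(\mathcal Sf_x)(0)$, where $f_x(y):=f(x+y)$. A Markovian convolution semigroup on $\mathrm{BUC}(G)$ is a family $(\mathcal S(t))_{t\ge0}$ of convex Markovian convolutions with $\mathcal S(0)f=f$, $\mathcal S(s+t)=\mathcal S(s)\mathcal S(t)$ and $\lim_{t\searrow0}\|\mathcal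 S(t)f-f\|_\infty=0$ for all $f\in\mathrm{BUC}(G)$; it is ''of linear operators'' if each $\mathcal S(t)$ is linear. Its generator in the linear case is the usual generator of a strongly continuous semigroup on $\mathrm{BUC}(G)$. For $D\subset\mathrm{BUC}(G)$ and $\mathcal A:D\to\mathrm{BUC}(G)$, a function $u:[0,\infty)\to\mathrm{BUC}(G)$ is a $D$-viscosity subsolution of $u_t=\mathcal Au$ if $u$ is continuous and for every $t>0$, $x\in G$ one has $\partial_t\psi(t,x)\le(\mathcal A\psi(t))(x)$ for every differentiable $\psi:(0,\infty)\to\mathrm{BUC}(G)$ with $(\psi(t))(x)=(u(t))(x)$, $\psi(s)\ge u(s)$ and $\psi(s)\in D$ for all $s>0$ (notation $\psi(t,x):=(\psi(t))(x)$). It is a $D$-viscosity supersolution if it is continuous and for every $t>0$, $x\in G$ one has $\partial_t\psi(t,x)\ge(\mathcal A\psi(t))(x)$ for every differentiable $\psi:(0,\infty)\to\mathrm{BUC}(G)$ with $(\psi(t))(x)=(u(t))(x)$, $\psi(s)\le u(s)$ and $\psi(s)\in D$ for all $s>0$. A $D$-viscosity solution is both a sub- and a supersolution. In the theorem, $\mathcal Af:=\sup_{\lambda\in\Lambda}A_\lambda f$ for $f\in D$, which belongs to $\mathrm{BUC}(G)$ by the definition of $D$. *)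

(* Defs.v *)
From HB Require Import structures.
From mathcomp Require Import all_boot all_order all_algebra.
From mathcomp Require Import all_classical all_reals all_analysis.

Set Implicit Arguments.
Unset Strict Implicit.
Unset Printing Implicit Defensive.

Import Order.TTheory GRing.Theory Num.Theory.
Import numFieldNormedType.Exports.

Local Open Scope classical_set_scope.
Local Open Scope ring_scope.

HB.mixin Record Zmodule_hasInvariantMetric (R : realType) G
    & GRing.Zmodule G := {
  gdist : G -> G -> R ;
  gdistxx : forall x, gdist x x = 0 ;
  gdist_positivity : forall x y, gdist x y = 0 -> x = y ;
  gdist_sym : forall x y, gdist x y = gdist y x ;
  gdist_triangle : forall y x z, gdist x z <= gdist x y + gdist y z ;
  gdistDl : forall z x y, gdist (z + x) (z + y) = gdist x y
}.

#[short(type="metricZmodType")]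
HB.structure Definition MetricZmodule (R : realType) :=
  {G of GRing.Zmodule G & Zmodule_hasInvariantMetric R G}.

(** A direct join of [Metric] and [GRing.Zmodule] is rejected by HB, because
    [PseudoMetricNormedZmod] already inherits from [PseudoMetric] and
    [GRing.Zmodule]; hence the distance is bundled with the group, and the metric
    and topological structures are derived from it. *)
#[non_forgetful_inheritance]
HB.instance Definition _ (R : realType) (G : metricZmodType R) :=
  isMetric.Build R G gdistxx gdist_positivity gdist_sym gdist_triangle.

Definition separable_space (T : topologicalType) :=
  exists2 Q : set T, countable Q & dense Q.

Definition complete_space (T : uniformType) :=
  forall F : set_system T, ProperFilter F -> cauchy F -> exists l : T, F --> l.

Section BUC.
Context {R : realType} {G : metricZmodType R}.
Implicit Types f g : G -> R.

Definition is_BUC : {pred G -> R} :=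
  mem [set f : G -> R | bounded_fun f /\ unif_continuous f].

Lemma is_BUCP f : reflect
  ((exists M, forall x, `|f x| <= M) /\
   (forall e : R, 0 < e -> exists2 d : R, 0 < d &
      forall x y, gdist x y < d -> `|f x - f y| < e))
  (f \in is_BUC).
Proof.
have PF : ProperFilter (globally [set: G]) :=
  globally_properfilter (I : setT (0 : G)).
apply: (iffP idP) => [/set_mem[bf uf]|[[M fM] uf]].
  split; first by have [M fM] := (ex_bound f).1 bf; exists M => x; exact: fM.
  move=> e e0.
  have := uf [set xy | ball xy.1 e xy.2] (entourage_ball _ (PosNum e0)).
  near_simpl; rewrite -entourage_ballE => -[d /= d0 dP]; exists d => // x y xyd.
  by have /= := dP (x, y); rewrite ballEmdist /=; exact.
apply/mem_set; split.
  by apply/(ex_bound f); exists M => x _; exact: fM.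
move=> A; rewrite -entourage_ballE => -[e /= e0 eA].
have [d d0 dP] := uf e e0; near_simpl; rewrite -entourage_ballE; exists d => //=.
by move=> [x y] /=; rewrite ballEmdist => /dP xy; apply: eA.
Qed.

Lemma is_BUC_submod : submod_closed is_BUC.
Proof.
split=> [|a f g /is_BUCP[[M fM] uf] /is_BUCP[[N gN] ug]].
  apply/is_BUCP; split; first by exists 0 => x; rewrite normr0.
  by move=> e e0; exists 1 => // x y _; rewrite subrr normr0.
apply/is_BUCP; split.
  exists (`|a| * M + N) => x; rewrite (le_trans (ler_normD _ _))// lerD//.
  by rewrite normrM ler_wpM2l.
move=> e e0; have a0 : 0 < `|a| + 1 by rewrite ltr_pwDr.
have e20 : 0 < e / 2 by rewrite divr_gt0.
have [d1 d10 fd] := uf (e / 2 / (`|a| + 1)) (divr_gt0 e20 a0).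
have [d2 d20 gd] := ug _ e20.
exists (Num.min d1 d2) => [|x y]; first by rewrite lt_min d10.
rewrite lt_min => /andP[/fd fxy /gd gxy].
rewrite /= opprD addrACA -scalerBr (splitr e).
rewrite (le_lt_trans (ler_normD _ _))// ler_ltD// normrM.
rewrite (le_trans (ler_wpM2l (normr_ge0 a) (ltW fxy)))// mulrCA ler_piMr ?ltW//.
by rewrite ltr_pdivrMr// mul1r ltrDl.
Qed.

HB.instance Definition _ := GRing.isSubmodClosed.Build R (G -> R) is_BUC
  is_BUC_submod.

End BUC.
Arguments is_BUC {R} G.

Record BUC {R : realType} (G : metricZmodType R) :=
  MkBUC { BUC_val :> G -> R; _ : BUC_val \in is_BUC G }.

Section BUC_normedModType.
Context {R : realType} {G : metricZmodType R}.

HB.instance Definition _ := [isSub for @BUC_val R G].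
HB.instance Definition _ := [Choice of BUC G by <:].
HB.instance Definition _ := [SubChoice_isSubLmodule of BUC G by <:].

Implicit Types f g : BUC G.

Lemma BUCP f : (f : G -> R) \in is_BUC G. Proof. exact: valP. Qed.

Lemma BUC_bounded f : exists M, forall x, `|f x| <= M.
Proof. by have /is_BUCP[] := BUCP f. Qed.

Lemma BUC_eqP f g : f =1 g <-> f = g.
Proof. by split=> [fg|->//]; apply/val_inj/funext. Qed.

Lemma BUC_addE f g x : (f + g) x = f x + g x. Proof. by []. Qed.
Lemma BUC_oppE f x : (- f) x = - f x. Proof. by []. Qed.
Lemma BUC_scaleE a f x : (a *: f) x = a * f x. Proof. by []. Qed.
Lemma BUC_zeroE x : (0 : BUC G) x = 0. Proof. by []. Qed.

Definition BUC_norm f : R := sup (range (fun x => `|f x|)).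

Lemma BUC_norm_ub f x : `|f x| <= BUC_norm f.
Proof.
have [M fM] := BUC_bounded f; apply: sup_upper_bound; last by exists x.
by split; [exists `|f 0|, 0|exists M => _ [y _ <-]].
Qed.

Lemma BUC_norm_le f M : (forall x, `|f x| <= M) -> BUC_norm f <= M.
Proof. by move=> fM; apply: ge_sup => [|_ [y _ <-]//]; exists `|f 0|, 0. Qed.

Let BUC_normD f g : BUC_norm (f + g) <= BUC_norm f + BUC_norm g.
Proof.
apply: BUC_norm_le => x; rewrite BUC_addE (le_trans (ler_normD _ _))//.
by rewrite lerD ?BUC_norm_ub.
Qed.

Let BUC_normZ a f : BUC_norm (a *: f) = `|a| * BUC_norm f.
Proof.
have le_normZ b g : BUC_norm (b *: g) <= `|b| * BUC_norm g.
  by apply: BUC_norm_le => x; rewrite BUC_scaleE normrM ler_wpM2l ?BUC_norm_ub.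
apply/eqP; rewrite eq_le le_normZ /=.
have [->|a0] := eqVneq a 0.
  rewrite normr0 mul0r (le_trans (normr_ge0 ((0 *: f) 0)))//.
  exact: BUC_norm_ub.
rewrite -ler_pdivlMl ?normr_gt0// -normfV.
by rewrite (le_trans _ (le_normZ _ _))// scalerA mulVf// scale1r.
Qed.

Let BUC_norm0_eq0 f : BUC_norm f = 0 -> f = 0.
Proof.
move=> f0; apply/BUC_eqP => x; apply/eqP.
by rewrite BUC_zeroE -normr_le0 -f0 BUC_norm_ub.
Qed.

HB.instance Definition _ :=
  Lmodule_isNormed.Build R (BUC G) BUC_normD BUC_normZ BUC_norm0_eq0.

Lemma BUC_normE f : `|f| = sup (range (fun x => `|f x|)). Proof. by []. Qed.

Lemma BUC_shift_subproof (x : G) f : (fun y => f (x + y)) \in is_BUC G.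
Proof.
have /is_BUCP[[M fM] uf] := BUCP f; apply/is_BUCP; split; first by exists M.
move=> e /uf[d d0 fd]; exists d => // y z yz.
by rewrite fd// gdistDl.
Qed.

Definition BUC_shift (x : G) f : BUC G := MkBUC (BUC_shift_subproof x f).

End BUC_normedModType.

Section expectations.
Context {R : realType}.

(** [ev] reads an element of [V] as a real function on [T]: it is the identity
    for functionals on functions, the coercion for functionals on [BUC G].
    [E] is only constrained on [M], and [M] is meant to be a convex set of
    functions containing the constants. *)
Section functional.
Context {T V : Type} (ev : V -> T -> R) (M : set V) (E : V -> R).

Definition convex_expectation :=
  [/\ forall X Y, M X -> M Y -> (forall w, ev X w <= ev Y w) -> E X <= E Y,
      forall (a : R) X, M X -> (forall w, ev X w = a) -> E X = a
    & forall (l : R) X Y Z, 0 <= l <= 1 -> M X -> M Y -> M Z ->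
        (forall w, ev Z w = l * ev X w + (1 - l) * ev Y w) ->
        E Z <= l * E X + (1 - l) * E Y].

Definition sublinear_expectation :=
  convex_expectation /\
  forall (l : R) X Y, 0 < l -> M X -> M Y ->
    (forall w, ev Y w = l * ev X w) -> E Y = l * E X.

Definition continuous_from_below :=
  forall (X_ : nat -> V) X, (forall n, M (X_ n)) -> M X ->
    (forall w, nondecreasing_seq (fun n => ev (X_ n) w)) ->
    (forall w, ev (X_ n) w @[n --> \oo] --> ev X w) ->
    nondecreasing_seq (fun n => E (X_ n)) /\ E (X_ n) @[n --> \oo] --> E X.

End functional.

Section expectation_space.
Context {d : measure_display} {T : measurableType d}.

Definition bounded_measurable : set (T -> R) :=
  [set Y : T -> R | measurable_fun [set: T] Y /\ bounded_fun Y].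

Definition sublinear_expectation_space (E : (T -> R) -> R) :=
  sublinear_expectation id bounded_measurable E /\
  continuous_from_below id bounded_measurable E.

Definition Cb (S : topologicalType) : set (S -> R) :=
  [set f | continuous f /\ bounded_fun f].

Definition borel_measurable (S : topologicalType) (X : T -> S) :=
  forall B, <<s @open S >> B -> measurable (X @^-1` B).

Definition distribution_under (E : (T -> R) -> R) (S : Type) (X : T -> S) :
  (S -> R) -> R := fun f => E (f \o X).

(** [X] is independent of [Y] *)
Definition independent_of (E : (T -> R) -> R) (S S' : topologicalType)
    (X : T -> S) (Y : T -> S') :=
  forall f : S' * S -> R, Cb f ->
    E (fun w => f (Y w, X w)) = E (fun w => E (fun w' => f (Y w, X w'))).

Definition levy_process (G : metricZmodType R) (E : (T -> R) -> R)
    (X : R -> T -> G) :=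
  [/\ forall t, 0 <= t -> borel_measurable (X t),
      forall f, Cb f -> E (f \o X 0) = f 0,
      forall s t, 0 <= s -> 0 <= t -> forall f, Cb f ->
        distribution_under E (X (s + t) \- X s) f =
        distribution_under E (X t) f,
      forall s t, 0 <= s -> 0 <= t -> forall n (tau : 'I_n.+1 -> R),
        (forall i, 0 <= tau i <= s) -> {homo tau : i j / (i < j)%N >-> i < j} ->
        independent_of E (X (s + t) \- X s)
          (fun w => \row_i X (tau i) w : 'rV[G]_n.+1)
    & forall f, Cb f -> E (f \o X t) @[t --> 0^'+] --> f 0].

End expectation_space.
End expectations.

Section semigroups.
Context {R : realType} {G : metricZmodType R}.

Definition markovian_convolution (S : BUC G -> BUC G) :=
  [/\ forall x, convex_expectation (@BUC_val R G) setT (fun f => S f x),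
      forall x, continuous_from_below (@BUC_val R G) setT (fun f => S f x)
    & forall f x, S f x = S (BUC_shift x f) 0].

(** Families indexed by [[0, +oo)] are functions on [R] of which only the values
    at nonnegative times are constrained. *)
Definition markovian_convolution_semigroup (S : R -> BUC G -> BUC G) :=
  [/\ forall t, 0 <= t -> markovian_convolution (S t),
      forall f, S 0 f = f,
      forall s t f, 0 <= s -> 0 <= t -> S (s + t) f = S s (S t f)
    & forall f, `|S t f - f| @[t --> 0^'+] --> (0 : R)].

(** A partial operator is a domain [DA] with a total function [A] whose values
    outside [DA] are irrelevant. *)
Definition is_generator (S : R -> BUC G -> BUC G) (DA : set (BUC G))
    (A : BUC G -> BUC G) :=
  (forall f, DA f <-> cvg (t^-1 *: (S t f - f) @[t --> 0^'+])) /\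
  (forall f, DA f -> t^-1 *: (S t f - f) @[t --> 0^'+] --> A f).

Definition uniformly_equicontinuous (I : Type) (f : I -> G -> R) :=
  forall e : R, 0 < e -> exists2 d : R, 0 < d &
    forall i x y, gdist x y < d -> `|f i x - f i y| < e.

Section supremum.
Context (Lambda : Type) (DA : Lambda -> set (BUC G))
  (A : Lambda -> BUC G -> BUC G).

Definition common_domain : set (BUC G) :=
  [set f | [/\ forall l, DA l f,
               bounded_set (range (fun l => A l f))
             & uniformly_equicontinuous (fun l => A l f : G -> R)]].

(** The pointwise supremum is in [BUC G] on [common_domain], see [sup_genE];
    elsewhere the value [0] is a placeholder. *)
Definition sup_gen (f : BUC G) : BUC G :=
  insubd 0 (fun x => sup (range (fun l => A l f x))).

Lemma sup_gen_subproof f : [set: Lambda] !=set0 -> common_domain f ->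
  (fun x => sup (range (fun l => A l f x))) \in is_BUC G.
Proof.
move=> [l0 _] [_ bA eA].
have [M AM] : exists M : R, forall l x, `|A l f x| <= M.
  have [N [_ /(_ (N + 1))]] := bA.
  rewrite ltrDl ltr01 => /(_ isT) NA; exists (N + 1) => l x.
  by rewrite (le_trans (BUC_norm_ub _ x))//; apply: NA; exists l.
have supA x : has_sup (range (fun l => A l f x)).
  split; first by exists (A l0 f x), l0.
  by exists M => _ [l _ <-]; rewrite (le_trans (ler_norm _)).
have le_sup x c : (forall l, A l f x <= c) ->
    sup (range (fun l => A l f x)) <= c.
  by move=> Ac; apply: ge_sup => [|_ [l _ <-]//]; exists (A l0 f x), l0.
have sup_ge x l : A l f x <= sup (range (fun l => A l f x)).
  by apply: sup_upper_bound => //; exists l.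
apply/is_BUCP; split.
  exists M => x; rewrite ler_norml; apply/andP; split.
    rewrite (le_trans _ (sup_ge x l0))//.
    by have := AM l0 x; rewrite ler_norml => /andP[].
  by apply: le_sup => l; rewrite (le_trans (ler_norm _)).
move=> e e0; have e20 : 0 < e / 2 by rewrite divr_gt0.
have [d d0 dA] := eA _ e20; exists d => // x y xy.
have le_e z z' : gdist z z' < d -> sup (range (fun l => A l f z)) <=
    sup (range (fun l => A l f z')) + e / 2.
  move=> /dA zz'; apply: le_sup => l; rewrite -lerBlDr.
  rewrite (le_trans _ (sup_ge z' l))// lerBlDr -lerBlDl.
  by rewrite (le_trans (ler_norm _))// ltW.
apply: (@le_lt_trans _ _ (e / 2)).
  rewrite ler_norml; apply/andP; split.
    by rewrite lerBrDl lerBlDr le_e// gdist_sym.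
  by rewrite lerBlDl le_e.
by rewrite ltr_pdivrMr// ltr_pMr// ltr1n.
Qed.

Lemma sup_genE f x : [set: Lambda] !=set0 -> common_domain f ->
  sup_gen f x = sup (range (fun l => A l f x)).
Proof.
move=> Lambda0 /(sup_gen_subproof Lambda0) h.
by rewrite /sup_gen (insubdK _ h).
Qed.

End supremum.

Section viscosity.
Context (D : set (BUC G)) (A : BUC G -> BUC G).
Implicit Types u psi : R -> BUC G.

Definition viscosity_subsolution u :=
  {within `[0, +oo[, continuous u} /\
  forall (t : R) (x : G), 0 < t -> forall psi,
    (forall s : R, 0 < s -> derivable psi s 1) ->
    psi t x = u t x ->
    (forall s : R, 0 < s -> forall y, u s y <= psi s y) ->
    (forall s : R, 0 < s -> D (psi s)) ->
    derive1 psi t x <= A (psi t) x.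

Definition viscosity_supersolution u :=
  {within `[0, +oo[, continuous u} /\
  forall (t : R) (x : G), 0 < t -> forall psi,
    (forall s : R, 0 < s -> derivable psi s 1) ->
    psi t x = u t x ->
    (forall s : R, 0 < s -> forall y, psi s y <= u s y) ->
    (forall s : R, 0 < s -> D (psi s)) ->
    A (psi t) x <= derive1 psi t x.

Definition viscosity_solution u :=
  viscosity_subsolution u /\ viscosity_supersolution u.

End viscosity.
End semigroups.

(* Main.v *)
Require Import Defs.
From HB Require Import structures.
From mathcomp Require Import all_boot all_order all_algebra.
From mathcomp Require Import all_classical all_reals all_analysis.
From mathcomp Require Import measurable_realfun ring lra.
Import Order.TTheory GRing.Theory Num.Theory.
Import numFieldNormedType.Exports.
Local Open Scope classical_set_scope.
Local Open Scope ring_scope.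

Set Implicit Arguments.
Unset Strict Implicit.
Unset Printing Implicit Defensive.

(** A sublinear expectation with the required properties is a supremum of
    linear ones, one for each way of steering a path: follow the Levy process
    of some [A_l], stop at a deterministic time [s], and choose the continuation
    after [s] from the path seen so far. Write [S l] for the semigroup of
    [A_l]. The inductive predicate [controlled] is the least family of
    functionals that contains the path law of each [S l] and is closed under
    convex combinations and under such switchings; [upper] is the supremum over
    it, and the solution is [u(t)(x) = upper (f (x + X_t))].

    Two facts about [controlled] carry the proof.

    - [dynamic_programming]: [upper F] is unchanged when [F] is first replaced
      by the function that sends a path [w] to the upper expectation of [F]
      over the continuations of [w] after time [s]. One inequality is an
      induction over [controlled]: what follows [s] under a controlled law is
      again controlled. For the other, one switches at [s] to a nearly optimal
      continuation; as [G] is separable and [F] is uniformly continuous,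
      countably many continuations are enough, and they are mixed with
      continuous weights. This gives the semigroup property of [u], and the
      stationarity and independence of the increments.

    - [controlled_supersolution]: if [S l h (U r) <= U (r + h)] for all [l],
      then no controlled law beats [U], by induction over [controlled]. For [g]
      in the common domain, density provides [b] close to [sup_l A_l g] for
      which [U r = g + r b + C r^2] has this property. Hence over a short time
      [h] the semigroup of [u] raises [g] by at most
      [h (sup_l A_l g + e) + C h^2], and at least by what a single [S l] does;
      both viscosity inequalities follow by comparing [u(t)] with a test
      function at time [t - h].

    All of this takes place on cylinder functions, which are bounded and
    uniformly continuous in finitely many coordinates of the path: this class is
    stable under integrating out the continuation, so that neither kernels nor
    product measures are used. Measures enter through the Daniell-Stone
    theorem, [daniell_stone], which represents each controlled functional by a
    probability. Its continuity hypothesis is inherited by mixtures and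
    switchings; for the path law of a linear semigroup it is a form of the
    Kolmogorov extension theorem, [cylinder_sigma_continuous], and there the
    completeness of [G] is used. A supremum of probabilities is continuous from
    below, so all identities pass from Lipschitz to continuous bounded test
    functions by inf-convolution. *)

(** * Means of bounded measurable functions *)

Section bounded_measurable_functions.
Context {R : realType} d (T : measurableType d).
Implicit Types (a : R) (f g : T -> R) (P : probability T R).

Lemma bounded_funP (U : Type) (f : U -> R) :
  bounded_fun f <-> exists M, forall x, `|f x| <= M.
Proof.
split=> [[M [_ fM]]|[M fM]].
  by exists (M + 1) => x; apply: (fM (M + 1)) => //; rewrite ltrDl.
exists M; split; first exact: num_real.
by move=> N MN x _; rewrite /= (le_trans (fM x))// ltW.
Qed.

Lemma bounded_measurable_cst a : bounded_measurable (fun _ : T => a).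
Proof. by split; [exact: measurable_cst|apply/bounded_funP; exists `|a|]. Qed.

Lemma bounded_measurable_lin a f g : bounded_measurable f -> bounded_measurable g ->
  bounded_measurable (fun x => a * f x + g x).
Proof.
move=> [mf /bounded_funP[M fM]] [mg /bounded_funP[N gN]]; split.
  by apply: measurable_funD => //; exact: measurable_funM.
apply/bounded_funP; exists (`|a| * M + N) => x.
by rewrite (le_trans (ler_normD _ _))// lerD// normrM ler_wpM2l.
Qed.

Lemma bounded_measurable_integrable P f : bounded_measurable f ->
  P.-integrable setT (EFin \o f).
Proof.
move=> [mf bf]; apply: measurable_bounded_integrable => //.
by rewrite (le_lt_trans (probability_le1 _ measurableT))// ltry.
Qed.

Definition mean P f : R := fine 'E_P[f]%E.

Lemma meanE P f : bounded_measurable f -> 'E_P[f]%E = (mean P f)%:E.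
Proof.
by move=> bf; rewrite /mean fineK// unlock; exact/integrable_fin_num/bounded_measurable_integrable.
Qed.

Lemma mean_cst P a : mean P (fun=> a) = a.
Proof. by rewrite /mean unlock integral_cst//= probability_setT mule1. Qed.

Lemma mean_lin P a f g : bounded_measurable f -> bounded_measurable g ->
  mean P (fun x => a * f x + g x) = a * mean P f + mean P g.
Proof.
move=> bf bg; apply: EFin_inj; rewrite EFinD EFinM -!meanE//; last exact: bounded_measurable_lin.
rewrite unlock (eq_integral (fun x => a%:E * (f x)%:E + (g x)%:E)%E)//.
rewrite (integralD measurableT _ (bounded_measurable_integrable P bg)).
  by rewrite (integralZl measurableT (bounded_measurable_integrable P bf)).
exact/(integrableZl measurableT)/bounded_measurable_integrable.
Qed.

Lemma mean_le P f g : bounded_measurable f -> bounded_measurable g ->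
  (forall x, f x <= g x) -> mean P f <= mean P g.
Proof.
move=> bf bg fg; rewrite -lee_fin -!meanE// unlock.
apply: le_integral => //; [exact: bounded_measurable_integrable..|move=> x _].
by rewrite lee_fin.
Qed.

Lemma bounded_measurable_indic A : measurable A -> bounded_measurable (\1_A : T -> R).
Proof.
move=> mA; split => //.
by apply/bounded_funP; exists 1 => x; rewrite indicE ger0_norm// lern1 leq_b1.
Qed.

Lemma mean_indic P A : measurable A -> (mean P \1_A)%:E = P A.
Proof.
move=> mA; rewrite -meanE ?unlock ?integral_indic ?setIT//.
exact: bounded_measurable_indic.
Qed.

Lemma bounded_measurable_sum (F : nat -> T -> R) n : (forall k, bounded_measurable (F k)) ->
  bounded_measurable (fun x => \sum_(k < n) F k x).
Proof.
move=> bF; elim: n => [|n IH].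
  by under eq_fun do rewrite big_ord0; exact: bounded_measurable_cst.
have := bounded_measurable_lin 1 IH (bF n).
by congr bounded_measurable; apply/funext => x; rewrite big_ord_recr/= mul1r.
Qed.

Lemma mean_sum P (F : nat -> T -> R) n : (forall k, bounded_measurable (F k)) ->
  mean P (fun x => \sum_(k < n) F k x) = \sum_(k < n) mean P (F k).
Proof.
move=> bF; elim: n => [|n IH].
  by under eq_fun do rewrite big_ord0; rewrite mean_cst big_ord0.
rewrite big_ord_recr/= -IH -[X in X + _]mul1r -mean_lin//; last exact: bounded_measurable_sum.
by congr mean; apply/funext => x; rewrite big_ord_recr/= mul1r.
Qed.

Lemma mean_cvg_below P (F : nat -> T -> R) f :
  (forall n, bounded_measurable (F n)) -> bounded_measurable f ->
  (forall x, nondecreasing_seq (F ^~ x)) ->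
  (forall x, F n x @[n --> \oo] --> f x) ->
  mean P (F n) @[n --> \oo] --> mean P f.
Proof.
move=> bF bf Fm Ff.
pose G n x := (F n x - F 0%N x)%:E.
have bG n : bounded_measurable (fun x => F n x - F 0%N x).
  have := bounded_measurable_lin (-1) (bF 0%N) (bF n); congr bounded_measurable.
  by apply/funext => x; rewrite mulN1r addrC.
have := @cvg_monotone_convergence _ _ _ P setT measurableT G.
have -> : (fun n => \int[P]_x G n x)%E = EFin \o (fun n => mean P (F n) - mean P (F 0%N)).
  apply/funext => n /=.
  rewrite -mulN1r addrC -mean_lin// -meanE; last exact: bounded_measurable_lin.
  by rewrite unlock; apply: eq_integral => x _; rewrite /G mulN1r addrC.
have limG x : limn (G ^~ x) = (f x - F 0%N x)%:E.
  apply/cvg_lim => //; apply: cvg_EFin; first by near=> n.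
  by apply: cvgB => //; exact: cvg_cst.
under eq_integral do rewrite limG.
have -> : (\int[P]_x (f x - F 0%N x)%:E = (mean P f - mean P (F 0%N))%:E)%E.
  rewrite -[X in X%:E]addrC -mulN1r -mean_lin// -meanE; last exact: bounded_measurable_lin.
  by rewrite unlock; apply: eq_integral => x _; rewrite mulN1r addrC.
move=> /(_ _ _ _)/fine_cvg; set a := mean P (F 0%N) => h.
have -> : mean P f = mean P f - a + a by rewrite subrK.
have -> : (fun n => mean P (F n)) = (fun n => mean P (F n) - a + a).
  by apply/funext => n; rewrite subrK.
apply: cvgD; last exact: cvg_cst.
apply: h => [n|n x _|x _ m n mn].
- by apply/measurable_EFinP; have [] := bG n.
- by rewrite lee_fin subr_ge0; exact: Fm.
- by rewrite lee_fin lerB//; exact: Fm.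
Unshelve. all: by end_near. Qed.

End bounded_measurable_functions.

(** * The Daniell-Stone theorem *)

Definition vector_lattice {R : realType} {T : Type} (L : set (T -> R)) :=
  [/\ L (fun=> 1),
      forall a f g, L f -> L g -> L (fun x => a * f x + g x),
      forall f g, L f -> L g -> L (fun x => Num.min (f x) (g x))
    & forall f, L f -> exists M, forall x, `|f x| <= M].

Definition positive_functional {R : realType} {T : Type} (L : set (T -> R))
    (I : (T -> R) -> R) :=
  [/\ I (fun=> 1) = 1,
      forall a f g, L f -> L g -> I (fun x => a * f x + g x) = a * I f + I g
    & forall f g, L f -> L g -> (forall x, f x <= g x) -> I f <= I g].

(** Pointwise decrease to zero, spelled out with inequalities so that it can be
    checked without limits. *)
Definition vanishing {R : realType} {T : Type} (F : nat -> T -> R) :=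
  [/\ forall n x, 0 <= F n x, forall n x, F n.+1 x <= F n x
    & forall x e, 0 < e -> exists n, F n x <= e].

Definition sigma_continuous {R : realType} {T : Type} (L : set (T -> R))
    (I : (T -> R) -> R) :=
  forall F, (forall n, L (F n)) -> vanishing F ->
    forall e, 0 < e -> exists n, I (F n) <= e.

Lemma le_of_eps {R : realType} (a b : R) : (forall e, 0 < e -> a <= b + e) ->
  a <= b.
Proof. by move=> h; apply/ler_addgt0Pr. Qed.

Section vector_lattices.
Context {R : realType} {T : Type} {L : set (T -> R)} (VL : vector_lattice L).
Implicit Types f g : T -> R.

Lemma lattice1 : L (fun=> 1). Proof. by case: VL. Qed.

Lemma lattice_lin a f g : L f -> L g -> L (fun x => a * f x + g x).
Proof. by case: VL => _ + _ _; apply. Qed.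

Lemma lattice_min f g : L f -> L g -> L (fun x => Num.min (f x) (g x)).
Proof. by case: VL => _ _ + _; apply. Qed.

Lemma lattice_bounded f : L f -> exists M, forall x, `|f x| <= M.
Proof. by case: VL => _ _ _; apply. Qed.

Lemma eq_mem_fun f g : L f -> (forall x, f x = g x) -> L g.
Proof. by move=> Lf /funext <-. Qed.

Lemma lattice0 : L (fun=> 0).
Proof. by apply: (eq_mem_fun (lattice_lin (-1) lattice1 lattice1)) => x; rewrite mulr1 addNr. Qed.

Lemma lattice_cst a : L (fun=> a).
Proof. by apply: (eq_mem_fun (lattice_lin a lattice1 lattice0)) => x; rewrite mulr1 addr0. Qed.

Lemma latticeD f g : L f -> L g -> L (fun x => f x + g x).
Proof.
by move=> Lf Lg; apply: (eq_mem_fun (lattice_lin 1 Lf Lg)) => x; rewrite mul1r.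
Qed.

Lemma latticeZ a f : L f -> L (fun x => a * f x).
Proof. by move=> Lf; apply: (eq_mem_fun (lattice_lin a Lf lattice0)) => x; rewrite addr0. Qed.

Lemma latticeN f : L f -> L (fun x => - f x).
Proof. by move=> Lf; apply: (eq_mem_fun (latticeZ (-1) Lf)) => x; rewrite mulN1r. Qed.

Lemma latticeB f g : L f -> L g -> L (fun x => f x - g x).
Proof. by move=> Lf Lg; exact: (latticeD Lf (latticeN Lg)). Qed.

Lemma lattice_max f g : L f -> L g -> L (fun x => Num.max (f x) (g x)).
Proof.
move=> Lf Lg; apply: (eq_mem_fun (latticeN (lattice_min (latticeN Lf) (latticeN Lg)))) => x.
by rewrite oppr_min !opprK.
Qed.

Lemma lattice_sum (F : nat -> T -> R) n : (forall k, L (F k)) ->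
  L (fun x => \sum_(k < n) F k x).
Proof.
move=> LF; elim: n => [|n IH].
  by apply: (eq_mem_fun lattice0) => x; rewrite big_ord0.
by apply: (eq_mem_fun (latticeD IH (LF n))) => x; rewrite big_ord_recr.
Qed.

Section functionals.
Context {I : (T -> R) -> R} (PI : positive_functional L I).

Lemma functional1 : I (fun=> 1) = 1. Proof. by case: PI. Qed.

Lemma functional_lin a f g : L f -> L g -> I (fun x => a * f x + g x) = a * I f + I g.
Proof. by case: PI => _ + _; apply. Qed.

Lemma functional_le f g : L f -> L g -> (forall x, f x <= g x) -> I f <= I g.
Proof. by case: PI => _ _; apply. Qed.

Lemma eq_functional f g : (forall x, f x = g x) -> I f = I g.
Proof. by move=> /funext ->. Qed.

Lemma functional0 : I (fun=> 0) = 0.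
Proof.
rewrite (@eq_functional _ (fun x => -1 * 1 + 1)) => [|x]; last first.
  by rewrite mulr1 addNr.
by rewrite (functional_lin _ lattice1 lattice1) mulN1r addNr.
Qed.

Lemma functionalD f g : L f -> L g -> I (fun x => f x + g x) = I f + I g.
Proof.
move=> Lf Lg; rewrite (@eq_functional _ (fun x => 1 * f x + g x)) => [|x].
  by rewrite (functional_lin _ Lf Lg) mul1r.
by rewrite mul1r.
Qed.

Lemma functionalZ a f : L f -> I (fun x => a * f x) = a * I f.
Proof.
move=> Lf; rewrite (@eq_functional _ (fun x => a * f x + 0)) => [|x].
  by rewrite (functional_lin _ Lf lattice0) functional0 addr0.
by rewrite addr0.
Qed.

Lemma functional_cst a : I (fun=> a) = a.
Proof.
rewrite (@eq_functional _ (fun=> a * 1)) => [|x]; last by rewrite mulr1.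
by rewrite (functionalZ _ lattice1) functional1 mulr1.
Qed.

Lemma functionalB f g : L f -> L g -> I (fun x => f x - g x) = I f - I g.
Proof.
move=> Lf Lg; rewrite (functionalD Lf (latticeN Lg)); congr (_ + _).
rewrite -mulN1r -(functionalZ _ Lg); apply: eq_functional => x.
by rewrite mulN1r.
Qed.

Lemma functional_ge0 f : L f -> (forall x, 0 <= f x) -> 0 <= I f.
Proof. by move=> Lf f0; rewrite -functional0; apply: functional_le => //; exact: lattice0. Qed.

Lemma functional_le_cst f a : L f -> (forall x, f x <= a) -> I f <= a.
Proof. by move=> Lf fa; rewrite -[leRHS]functional_cst; apply: functional_le => //; exact: lattice_cst. Qed.

Lemma functional_ge_cst f a : L f -> (forall x, a <= f x) -> a <= I f.
Proof. by move=> Lf fa; rewrite -[leLHS]functional_cst; apply: functional_le => //; exact: lattice_cst. Qed.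

Lemma functional_sum (F : nat -> T -> R) n : (forall k, L (F k)) ->
  I (fun x => \sum_(k < n) F k x) = \sum_(k < n) I (F k).
Proof.
move=> LF; elim: n => [|n IH].
  rewrite (@eq_functional _ (fun=> 0)) ?functional0 ?big_ord0// => x.
  by rewrite big_ord0.
rewrite big_ord_recr/= -IH -functionalD//; last exact: lattice_sum.
by apply: eq_functional => x; rewrite big_ord_recr.
Qed.

End functionals.
End vector_lattices.

Section daniell_stone.
Context {R : realType} {T : pointedType} {L : set (T -> R)} {I : (T -> R) -> R}.
Hypotheses (VL : vector_lattice L) (PI : positive_functional L I).
Hypothesis SI : sigma_continuous L I.

(** The increasing sequences of [L] that eventually reach 1 on [A] play the part
    of the open sets that contain [A], and the supremum of [I] along such a
    sequence that of their measure. With increasing sequences instead of series,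
    countable subadditivity needs no reindexing of double sums. *)
Definition daniell_cover (A : set T) (c : R) :=
  exists F : nat -> T -> R,
    [/\ forall n, L (F n), forall n x, 0 <= F n x,
        forall n m x, (n <= m)%N -> F n x <= F m x, forall n, I (F n) <= c
      & forall x, A x -> exists n, 1 <= F n x].

Definition daniell_outer (A : set T) : R := inf [set c | daniell_cover A c].

Lemma daniell_cover1 A : daniell_cover A 1.
Proof.
exists (fun _ _ => 1); split=> //; first by move=> _; exact: (lattice1 VL).
  by move=> _; rewrite (functional1 PI).
by move=> x _; exists 0%N.
Qed.

Lemma daniell_cover_ge0 A c : daniell_cover A c -> 0 <= c.
Proof.
move=> [F [LF F0 _ Fc _]]; apply: le_trans (Fc 0%N).
exact: (functional_ge0 VL PI).
Qed.

Lemma daniell_has_inf A : has_inf [set c | daniell_cover A c].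
Proof.
split; first by exists 1; exact: daniell_cover1.
by exists 0 => c /daniell_cover_ge0.
Qed.

Lemma daniell_outer_le A c : daniell_cover A c -> daniell_outer A <= c.
Proof. by move=> cA; apply: inf_lbound => //; exact: (daniell_has_inf A).2. Qed.

Lemma daniell_outer_ge0 A : 0 <= daniell_outer A.
Proof. by apply: lb_le_inf => [|c /daniell_cover_ge0//]; exact: (daniell_has_inf A).1. Qed.

Lemma daniell_outer_adherent A e : 0 < e ->
  daniell_cover A (daniell_outer A + e).
Proof.
move=> e0; have [c cA ce] := inf_adherent e0 (daniell_has_inf A).
case: cA => F [LF F0 Fm Fc FA]; exists F; split=> // n.
by rewrite (le_trans (Fc n))// ltW.
Qed.

Lemma daniell_outer_set0 : daniell_outer set0 = 0.
Proof.
apply/eqP; rewrite eq_le daniell_outer_ge0 andbT; apply: daniell_outer_le.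
exists (fun _ _ => 0); split=> // _; first exact: (lattice0 VL).
by rewrite (functional0 VL PI).
Qed.

Lemma daniell_outer_le_set A B : A `<=` B -> daniell_outer A <= daniell_outer B.
Proof.
move=> AB; apply: le_of_eps => e e0; apply: daniell_outer_le.
have [F [LF F0 Fm Fc FB]] := daniell_outer_adherent B e0.
by exists F; split=> // x /AB /FB.
Qed.

Lemma sum_half_le n : \sum_(k < n) 2^-1 ^+ k.+1 <= 1 :> R.
Proof.
suff -> : \sum_(k < n) 2^-1 ^+ k.+1 = 1 - 2^-1 ^+ n :> R.
  by rewrite gerBl exprn_ge0.
elim: n => [|n IH]; first by rewrite big_ord0 expr0 subrr.
by rewrite big_ord_recr/= IH exprS; lra.
Qed.

Lemma daniell_outer_sigma_subadditive :
  sigma_subadditive (fun A => (daniell_outer A)%:E).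
Proof.
move=> A; set s := (\sum_(_ <= _ <oo) _)%E.
have s_ge n : ((\sum_(k < n) daniell_outer (A k))%:E <= s)%E.
  rewrite -sumEFin -(big_mkord xpredT (fun k => (daniell_outer (A k))%:E)).
  apply: nneseries_lim_ge => k _ _; rewrite lee_fin.
  exact: daniell_outer_ge0.
case: s s_ge => [s| |] s_ge; [|by rewrite leey|]; last first.
  by have := s_ge 0%N; rewrite leeNy_eq.
rewrite lee_fin; apply: le_of_eps => e e0; apply: daniell_outer_le.
have /choice[F HF] n : exists F : nat -> T -> R,
    [/\ forall n, L (F n), forall n x, 0 <= F n x,
        forall n m x, (n <= m)%N -> F n x <= F m x,
        forall m, I (F m) <= daniell_outer (A n) + e * 2^-1 ^+ n.+1
      & forall x, A n x -> exists n, 1 <= F n x].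
  by apply: daniell_outer_adherent; rewrite mulr_gt0// exprn_gt0.
exists (fun m x => \sum_(n < m) F n m x); split.
- by move=> m; apply: (lattice_sum VL (F := fun k => F k m)) => k; have [] := HF k.
- by move=> m x; apply: sumr_ge0 => k _; have [] := HF k.
- move=> n m x nm; rewrite -!(big_mkord xpredT (fun k => F k _ x)).
  rewrite [leRHS](big_cat_nat (leq0n n) nm)//= -[leLHS]addr0; apply: lerD.
    by apply: ler_sum => k _; have [_ _ + _ _] := HF k; apply.
  by apply: sumr_ge0 => k _; have [] := HF k.
- move=> m; rewrite (functional_sum VL PI (F := fun k => F k m)); last first.
    by move=> k; have [] := HF k.
  apply: (@le_trans _ _ (\sum_(k < m) (daniell_outer (A k) + e * 2^-1 ^+ k.+1))).
    by apply: ler_sum => k _; have [] := HF k.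
  rewrite big_split/= lerD//; first by have := s_ge m; rewrite lee_fin.
  by rewrite -mulr_sumr ler_piMr ?(ltW e0)// sum_half_le.
- move=> x [n _ Anx]; have [_ F0 Fm _ /(_ x Anx)[m m1]] := HF n.
  exists (maxn m n.+1); apply: le_trans m1 _.
  apply: le_trans (Fm m (maxn m n.+1) x (leq_maxl _ _)) _.
  have nn : (n < maxn m n.+1)%N by rewrite leq_max ltnSn orbT.
  rewrite (bigD1 (Ordinal nn))//= lerDl; apply: sumr_ge0 => k _.
  by have [] := HF k.
Qed.

Definition daniell_outer_measure (A : set T) : \bar R := (daniell_outer A)%:E.

Let mu : {outer_measure set T -> \bar R} :=
  HB.pack (daniell_outer_measure) (isOuterMeasure.Build R T
    daniell_outer_measure (congr1 EFin daniell_outer_set0) daniell_outer_ge0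
    daniell_outer_le_set daniell_outer_sigma_subadditive).

(** For [h_j] increasing to the indicator of [H > 0] and [F] a cover of [A], the
    functions [min F_m h_m] cover the part of [A] inside, and [F_m - min F_m h_j],
    for a fixed large [j], the part outside; the values of [I] add up. *)
Lemma daniell_caratheodory H : L H -> mu.-caratheodory [set x | 0 < H x].
Proof.
move=> LH; apply: le_caratheodory_measurable => A.
change (((daniell_outer (A `&` [set x | 0 < H x]))%:E
  + (daniell_outer (A `&` ~` [set x | 0 < H x]))%:E <= (daniell_outer A)%:E)%E).
rewrite -EFinD lee_fin; apply: le_of_eps => e e0.
have e20 : 0 < e / 2 by rewrite divr_gt0.
have [F [LF F0 Fm Fc FA]] := daniell_outer_adherent A e20.
pose h (j : nat) x := Num.min 1 (j%:R * Num.max 0 (H x)).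
have Lh j : L (h j).
  by apply: (lattice_min VL); [exact: lattice1|apply/(latticeZ VL)/(lattice_max VL) => //; exact: lattice0].
have hm i j x : (i <= j)%N -> h i x <= h j x.
  move=> ij; rewrite /h le_min ge_min lexx/= ge_min; apply/orP; right.
  by rewrite ler_wpM2r ?ler_nat// le_max lexx.
have h0 j x : 0 <= h j x by rewrite le_min ler01 mulr_ge0// le_max lexx.
have Lmin m j : L (fun x => Num.min (F m x) (h j x)) by exact: (lattice_min VL).
pose a m := I (fun x => Num.min (F m x) (h m x)).
have am m : a m <= daniell_outer A + e / 2.
  by apply: le_trans (Fc m); apply: (functional_le PI) => // x; rewrite ge_min lexx.
have supa : has_sup (range a).
  by split; [exists (a 0%N), 0%N|exists (daniell_outer A + e / 2) => _ [m _ <-]].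
have [_ [j _ <-] aj] := sup_adherent e20 supa.
have leI : daniell_outer (A `&` [set x | 0 < H x]) <= sup (range a).
  apply: daniell_outer_le; exists (fun m x => Num.min (F m x) (h m x)); split=> //.
  - by move=> m x; rewrite le_min F0 h0.
  - move=> m n x mn; have := hm _ _ x mn; have := Fm _ _ x mn; move: (h m x) (h n x) => u v.
    by move=> + uv; rewrite le_min !ge_min uv orbT => ->.
  - by move=> m; apply: sup_upper_bound => //; exists m.
  - move=> x [/FA[n Fn] /= Hx].
    have [k kH] : exists k : nat, 1 <= k%:R * H x.
      exists (Num.truncn (H x)^-1).+1; rewrite -ler_pdivrMr// mul1r.
      exact/ltW/truncnS_gt.
    exists (maxn n k); rewrite le_min (le_trans Fn) ?Fm ?leq_maxl//=.
    rewrite le_min lexx /= (max_idPr (ltW Hx)) (le_trans kH)//.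
    by rewrite ler_wpM2r ?(ltW Hx)// ler_nat leq_maxr.
(* the cover starts at the index [j] at which [a j] is almost the supremum *)
have leD : daniell_outer (A `&` ~` [set x | 0 < H x]) <=
    daniell_outer A + e / 2 - a j.
  apply: daniell_outer_le.
  exists (fun m x => F (m + j)%N x - Num.min (F (m + j)%N x) (h j x)); split.
  - by move=> m; apply: (latticeB VL).
  - by move=> m x; rewrite subr_ge0 ge_min lexx.
  - move=> m n x mn; have := Fm _ _ x (leq_add mn (leqnn j)).
    move: (h j x) (F (m + j)%N x) (F (n + j)%N x) => u v w vw.
    by rewrite /Num.min; case: ltP => ?; case: ltP => ?; lra.
  - move=> m; rewrite (functionalB VL PI)// lerB//.
    apply: (functional_le PI) => // x; have := Fm _ _ x (leq_addl m j).
    by move: (h j x) => u uv; rewrite le_min !ge_min uv lexx orbT.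
  - move=> x [/FA[n Fn] /= /negP]; rewrite -leNgt => Hx.
    exists n; rewrite /h (max_idPl Hx) mulr0 (min_idPr ler01) min_r ?subr0//.
    by rewrite (le_trans Fn)// Fm// leq_addr.
by apply: le_trans (lerD leI leD) _; move: aj; rewrite /a; lra.
Qed.

Definition positivity_sets : set (set T) :=
  [set B | exists2 H, L H & B = [set x | 0 < H x]].

Lemma daniell_measurable_sub (B : set (g_sigma_algebraType positivity_sets)) :
  measurable B -> mu.-caratheodory B.
Proof.
have : sigma_algebra [set: T] mu.-caratheodory.
  split; first exact: caratheodory_measurable_set0.
  - by move=> A mA; rewrite setTD; exact: caratheodory_measurable_setC.
  - by move=> A mA; exact: caratheodory_measurable_bigcup.
move=> /smallest_sub; apply=> _ [H LH ->].
exact: daniell_caratheodory.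
Qed.

(** If [F_m] covers [B], then the positive part of [h - F_m] decreases to zero, so
    the values of [I] along the cover cannot stay below [I h]. *)
Lemma daniell_le_outer h B : L h -> (forall x, h x <= 1) ->
  (forall x, ~ B x -> h x <= 0) -> I h <= daniell_outer B.
Proof.
move=> Lh h1 hB; apply: le_of_eps => e e0.
have e20 : 0 < e / 2 by rewrite divr_gt0.
have [F [LF F0 Fm Fc FB]] := daniell_outer_adherent B e20.
have LG n : L (fun x => Num.max 0 (h x - F n x)).
  by apply: (lattice_max VL); [exact: lattice0|exact: latticeB].
have [|n In] := SI LG _ e20.
  split.
  - by move=> n x; rewrite le_max lexx.
  - move=> n x; rewrite ge_max !le_max lexx/= lerB ?orbT//.
    by rewrite Fm.
  - move=> x d d0; have [/FB[n Fn]|nB] := pselect (B x).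
      by exists n; rewrite ge_max (ltW d0) (le_trans _ (ltW d0))// subr_le0 (le_trans (h1 x)).
    exists 0%N; rewrite ge_max (ltW d0) (le_trans _ (ltW d0))// subr_le0.
    by rewrite (le_trans (hB x nB)).
have : I h <= I (fun x => Num.max 0 (h x - F n x) + F n x).
  apply: (functional_le PI) => //; first exact: (latticeD VL).
  by move=> x; rewrite -lerBlDr le_max lexx orbT.
by rewrite (functionalD PI)//; have := Fc n; lra.
Qed.

Lemma daniell_outer_setT : daniell_outer [set: T] = 1.
Proof.
apply/eqP; rewrite eq_le (daniell_outer_le (daniell_cover1 _))/=.
rewrite -(functional1 PI); apply: daniell_le_outer => [|//|x /(_ Logic.I)//]; exact: (lattice1 VL).
Qed.

Let Omega := g_sigma_algebraType positivity_sets.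

Definition daniell_measure (B : set Omega) : \bar R := (daniell_outer B)%:E.

Lemma daniell_measure_sigma_additive : semi_sigma_additive daniell_measure.
Proof.
move=> F mF tF mUF.
exact: (caratheodory_measure_sigma_additive (mu := mu)
  (fun i => daniell_measurable_sub (mF i)) tF (daniell_measurable_sub mUF)).
Qed.

HB.instance Definition _ := isMeasure.Build _ Omega R daniell_measure
  (congr1 EFin daniell_outer_set0) daniell_outer_ge0
  daniell_measure_sigma_additive.

HB.instance Definition _ := Measure_isProbability.Build _ Omega R
  daniell_measure (congr1 EFin daniell_outer_setT).

Let P : probability Omega R := daniell_measure.

Lemma measurable_positivity H : L H ->
  measurable ([set x | 0 < H x] : set Omega).
Proof. by move=> LH; apply: sub_sigma_algebra; exists H. Qed.

Lemma bounded_measurable_lattice f : L f -> bounded_measurable (f : Omega -> R).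
Proof.
move=> Lf; split; last exact/bounded_funP/(lattice_bounded VL).
apply: (measurability _ (RGenOInfty.measurableE R)) => _ [_ [a ->] <-].
rewrite setTI; have := measurable_positivity (latticeB VL Lf (lattice_cst VL a)).
congr measurable; apply/seteqP.
by split=> x /=; rewrite in_itv/= andbT subr_gt0.
Qed.

(** Slicing [y] into layers of height 1; applied to [n f] it writes [f] as an
    average of functions of [L] that lie between indicators. *)
Lemma sum_clip (y : R) n : 0 <= y ->
  \sum_(i < n) Num.min 1 (Num.max 0 (y - i%:R)) = Num.min y n%:R.
Proof.
move=> y0; elim: n => [|n IH]; first by rewrite big_ord0; case: ltgtP y0.
rewrite big_ord_recr/= IH -natr1 /Num.min /Num.max.
case: (ltP y n%:R) => ?; case: (ltP 0 (y - n%:R)) => ?;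
  by do ![case: ltP => ?]; lra.
Qed.

Lemma sum_below (y : R) n : 0 <= y ->
  \sum_(i < n) (i%:R < y)%R%:R <= Num.min n%:R (y + 1).
Proof.
move=> y0; elim: n => [|n IH].
  by rewrite big_ord0 le_min lexx/= addr_ge0.
move: IH; rewrite big_ord_recr/= -natr1 !le_min => /andP[h1 h2].
by case: ltP => /= ?; apply/andP; split; lra.
Qed.

(** Each layer of [n f] is dominated by an indicator, whose mean is bounded below
    by [daniell_le_outer]; the indicators add up to at most [n f + 1]. *)
Lemma daniell_le_mean01 f : L f -> (forall x, 0 <= f x <= 1) -> I f <= mean P f.
Proof.
move=> Lf f01; apply: le_of_eps => e e0.
pose n := (Num.truncn e^-1).+1.
have n0 : (0 : R) < n%:R by rewrite ltr0n.
have ne : 1 <= n%:R * e.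
  by rewrite -ler_pdivrMr// mul1r; exact/ltW/truncnS_gt.
pose phi i x := Num.min 1 (Num.max 0 (n%:R * f x - i%:R)).
have Lphi i : L (phi i).
  apply: (lattice_min VL); first exact: (lattice1 VL).
  apply: (lattice_max VL); first exact: (lattice0 VL).
  by apply: (latticeB VL); [exact: latticeZ|exact: lattice_cst].
pose B i : set Omega := [set x | 0 < n%:R * f x - i%:R].
have mB i : measurable (B i).
  by apply: measurable_positivity; apply: (latticeB VL); [exact: latticeZ|exact: lattice_cst].
have phiB i : I (phi i) <= mean P \1_(B i).
  rewrite -lee_fin mean_indic// lee_fin; apply: daniell_le_outer => //.
    by move=> x; rewrite /phi ge_min lexx.
  by move=> x /negP; rewrite -leNgt /phi => h; rewrite ge_min (max_idPl h) lexx orbT.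
have In : n%:R * I f = \sum_(i < n) I (phi i).
  rewrite -(functionalZ VL PI _ Lf) -(functional_sum VL PI (F := phi))//.
  apply: eq_functional => x; rewrite /phi sum_clip.
    by have /andP[_ fx] := f01 x; rewrite min_l// ler_piMr.
  by have /andP[fx _] := f01 x; rewrite mulr_ge0.
have bf := bounded_measurable_lattice Lf.
have : n%:R * I f <= n%:R * mean P f + 1.
  rewrite In -[X in _ + X](mean_cst P 1) -mean_lin//; last exact: bounded_measurable_cst.
  apply: (@le_trans _ _ (\sum_(i < n) mean P \1_(B i))).
    by apply: ler_sum => i _; exact: phiB.
  rewrite -(mean_sum P (F := fun i => \1_(B i))); last by move=> k; exact: bounded_measurable_indic.
  apply: mean_le; [by apply: (bounded_measurable_sum (F := fun i => \1_(B i))) => k; exact: bounded_measurable_indic|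
    by apply: bounded_measurable_lin => //; exact: bounded_measurable_cst|move=> x].
  have : 0 <= n%:R * f x by have /andP[fx _] := f01 x; rewrite mulr_ge0.
  move=> /(sum_below n); rewrite le_min => /andP[_]; apply: le_trans.
  apply: ler_sum => i _; rewrite indicE le_eqVlt; apply/orP; left; apply/eqP.
  by congr (_%:R); congr nat_of_bool; apply/idP/idP; rewrite inE /B/= subr_gt0.
by move=> h; rewrite -(ler_pM2l n0) mulrDr; lra.
Qed.

(** An affine change of [f] reduces to values in the unit interval. Applied to [f]
    and to [- f], this one inequality gives equality. *)
Lemma daniell_le_mean f : L f -> I f <= mean P f.
Proof.
move=> Lf; have [M fM] := lattice_bounded VL Lf.
pose c := `|M| + 1.
have c0 : 0 < c by rewrite ltr_wpDl.
pose g x := (2 * c)^-1 * f x + 2^-1.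
have Lg : L g by apply: (lattice_lin VL) => //; exact: lattice_cst.
have fc x : `|f x| <= c.
  by rewrite (le_trans (fM x))// (le_trans (ler_norm _))// lerDl.
have := daniell_le_mean01 Lg.
rewrite /g (functional_lin PI)//; last exact: lattice_cst.
rewrite (functional_cst VL PI) mean_lin//; [|exact: bounded_measurable_lattice|exact: bounded_measurable_cst].
rewrite mean_cst lerD2r ler_pM2l ?invr_gt0 ?mulr_gt0//; apply=> x.
have := fc x; rewrite ler_norml => /andP[h1 h2].
have -> : (2 * c)^-1 * f x + 2^-1 = (f x + c) / (2 * c) by field; rewrite gt_eqF.
rewrite divr_ge0/= ?ler_pdivrMr ?mulr_gt0//; lra.
Qed.

Theorem daniell_stone : exists P : probability Omega R,
  forall f, L f -> mean P f = I f.
Proof.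
exists P => f Lf; apply/eqP; rewrite eq_le daniell_le_mean// andbT.
have := daniell_le_mean (latticeN VL Lf).
have -> : (fun x => - f x) = (fun x => -1 * f x + 0).
  by apply/funext => x; rewrite mulN1r addr0.
rewrite mean_lin//; [|exact: bounded_measurable_lattice|exact: bounded_measurable_cst].
rewrite (functional_lin PI)//; last exact: (lattice0 VL).
by rewrite mean_cst (functional0 VL PI); lra.
Qed.

End daniell_stone.

(** * Cylinder functions and concatenation of paths *)

Section invariant_metric.
Context {R : realType} {G : metricZmodType R}.
Implicit Types x y z : G.

Lemma gdistDr z x y : gdist (x + z) (y + z) = gdist x y.
Proof. by rewrite !(addrC _ z) gdistDl. Qed.

Lemma gdistN x y : gdist (- x) (- y) = gdist x y.
Proof. by rewrite -(gdistDl (x + y)) addrK addrAC subrr add0r gdist_sym. Qed.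

Lemma gdistD x y x' y' : gdist (x + y) (x' + y') <= gdist x x' + gdist y y'.
Proof.
rewrite (le_trans (gdist_triangle (x' + y) _ _))// gdistDr.
by rewrite gdistDl.
Qed.

Lemma gdistB x y x' y' : gdist (x - y) (x' - y') <= gdist x x' + gdist y y'.
Proof. by rewrite (le_trans (gdistD _ _ _ _))// gdistN. Qed.

Lemma gdist_ge0 x y : 0 <= gdist x y.
Proof.
have := gdist_triangle y x x; rewrite gdistxx (gdist_sym y x); lra.
Qed.

Lemma gdist_lip x y z : `|gdist x z - gdist y z| <= gdist x y.
Proof.
have := gdist_triangle x y z; have := gdist_triangle y x z.
by rewrite (gdist_sym y x) ler_norml => ? ?; apply/andP; split; lra.
Qed.

End invariant_metric.

Section cylinder_functions.
Context {R : realType} {G : metricZmodType R}.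
Local Notation path := (R -> G).
Implicit Types (tau : seq R) (w v : path) (F : path -> R).

Definition near_on tau (d : R) w v :=
  forall t, t \in tau -> gdist (w t) (v t) < d.

(** Closeness is required at each of finitely many times separately, so that
    enlarging the set of times or replacing one coordinate leaves the modulus
    unchanged. *)
Definition uc_on tau F := forall e, 0 < e ->
  exists2 d, 0 < d & forall w v, near_on tau d w v -> `|F w - F v| <= e.

Definition cylinder : set (path -> R) := [set F |
  (exists M, forall w, `|F w| <= M) /\ exists tau, uc_on tau F].

Lemma near_on_sub tau tau' d d' w v : {subset tau <= tau'} -> d' <= d ->
  near_on tau' d' w v -> near_on tau d w v.
Proof. by move=> tt' dd' h t /tt' /h /lt_le_trans; apply. Qed.

Lemma near_onxx tau d w : 0 < d -> near_on tau d w w.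
Proof. by move=> d0 t _; rewrite gdistxx. Qed.

Lemma uc_on2 tau tau' F F' e : uc_on tau F -> uc_on tau' F' -> 0 < e ->
  exists2 d, 0 < d & forall w v, near_on (tau ++ tau') d w v ->
    `|F w - F v| <= e /\ `|F' w - F' v| <= e.
Proof.
move=> uF uF' e0; have [d d0 h] := uF e e0; have [d' d'0 h'] := uF' e e0.
exists (Num.min d d') => [|w v wv]; first by rewrite lt_min d0.
split; [apply: h|apply: h']; apply: near_on_sub wv.
- by move=> t tt; rewrite mem_cat tt.
- by rewrite ge_min lexx.
- by move=> t tt; rewrite mem_cat tt orbT.
- by rewrite ge_min lexx orbT.
Qed.

(** Operations that are 1-Lipschitz for the maximum norm preserve a common
    modulus. *)
Lemma cylinder_op (op : R -> R -> R) F F' :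
  (forall a b a' b' e, 0 < e -> `|a - a'| <= e -> `|b - b'| <= e ->
    `|op a b - op a' b'| <= e) ->
  (forall M N, exists B, forall a b, `|a| <= M -> `|b| <= N ->
    `|op a b| <= B) ->
  cylinder F -> cylinder F' -> cylinder (fun w => op (F w) (F' w)).
Proof.
move=> oplip opb [[M FM] [tau uF]] [[N FN] [tau' uF']]; split.
  by have [B h] := opb M N; exists B => w; exact: h.
exists (tau ++ tau') => e e0; have [d d0 h] := uc_on2 uF uF' e0.
by exists d => // w v /h[h1 h2]; exact: oplip.
Qed.

Lemma cylinder_cst a : cylinder (fun=> a).
Proof.
split; first by exists `|a|.
by exists [::] => e e0; exists 1 => // w v _; rewrite subrr normr0 ltW.
Qed.

Lemma cylinderM F F' : cylinder F -> cylinder F' -> cylinder (fun w => F w * F' w).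
Proof.
move=> [[M FM] [tau uF]] [[N FN] [tau' uF']]; split.
  by exists (M * N) => w; rewrite normrM ler_pM.
exists (tau ++ tau') => e e0.
have M0 : 0 <= M by apply: le_trans (FM (fun=> 0)).
have N0 : 0 <= N by apply: le_trans (FN (fun=> 0)).
have MN0 : 0 < M + N + 1 by lra.
have [d d0 h] := uc_on2 uF uF' (divr_gt0 e0 MN0).
exists d => // w v /h[h1 h2].
have -> : F w * F' w - F v * F' v = F w * (F' w - F' v) + (F w - F v) * F' v by ring.
rewrite (le_trans (ler_normD _ _))// !normrM.
apply: (@le_trans _ _ (M * (e / (M + N + 1)) + (e / (M + N + 1)) * N)).
  by apply: lerD; apply: ler_pM.
have -> : e = (e / (M + N + 1)) * (M + N + 1) by rewrite divfK// gt_eqF.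
rewrite mulfK ?gt_eqF//.
have : 0 <= e / (M + N + 1) by rewrite ltW// divr_gt0.
nra.
Qed.

Lemma cylinder_lattice : vector_lattice cylinder.
Proof.
split.
- exact: cylinder_cst.
- move=> a F F' cF cF'.
  have -> : (fun w => a * F w + F' w) = (fun w => 2 * ((a * F w + F' w) / 2)).
    by apply/funext => w; field.
  apply: cylinderM; first exact: cylinder_cst.
  apply: (cylinder_op (op := fun x y => (x + y) / 2)) cF' => //; last first.
  + by apply: cylinderM cF; exact: cylinder_cst.
  + move=> M N; exists (M + N) => x y.
    rewrite !ler_norml => /andP[? ?] /andP[? ?].
    by apply/andP; split; lra.
  + move=> x y x' y' e e0; rewrite !ler_norml => /andP[? ?] /andP[? ?].
    by apply/andP; split; lra.
- move=> F F'; apply: cylinder_op.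
  + move=> x y x' y' e e0; rewrite !ler_norml /Num.min => /andP[? ?] /andP[? ?].
    by case: ltP => ?; case: ltP => ?; apply/andP; split; lra.
  + move=> M N; exists (Num.max M N) => x y xM yN.
    by rewrite /Num.min; case: ltP => _; rewrite le_max ?xM ?yN ?orbT.
- by move=> F [].
Qed.

Definition upd w t (x : G) : path := fun u => if u == t then x else w u.

(** The path [w] until time [s], followed by the increments of [v]. Only the
    increments of [v] since its time 0 matter, which makes concatenation
    associative without any condition on [v 0]. *)
Definition concat (s : R) w v : path :=
  fun t => if t < s then w t else w s + (v (t - s) - v 0).

Lemma concat_le s w v t : t <= s -> concat s w v t = w t.
Proof.
rewrite /concat le_eqVlt => /predU1P[->|->//].
by rewrite ltxx subrr subrr addr0.
Qed.

Lemma concat_ge s w v t : s <= t -> concat s w v t = w s + (v (t - s) - v 0).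
Proof. by move=> st; rewrite /concat ltNge st. Qed.

Lemma concatA r s w1 w2 w3 : r <= s ->
  concat r w1 (concat (s - r) w2 w3) = concat s (concat r w1 w2) w3.
Proof.
move=> rs; apply/funext => t; have [tr|rt] := ltP t r.
  by rewrite concat_le ?ltW// concat_le ?concat_le ?ltW// (lt_le_trans tr).
rewrite concat_ge// (@concat_le _ _ _ 0) ?subr_ge0//.
have [ts|st] := leP t s.
  by rewrite concat_le ?lerB// concat_le// concat_ge.
rewrite concat_ge ?lerB ?(ltW st)// [RHS]concat_ge ?(ltW st)//.
rewrite (concat_ge _ _ rs) (_ : t - r - (s - r) = t - s); last by ring.
by rewrite -[RHS]addrA; congr (_ + _); rewrite addrAC.
Qed.

Lemma concat_stop s r w1 w2 w3 : s <= r ->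
  concat s (concat r w1 w2) w3 = concat s w1 w3.
Proof.
move=> sr; apply/funext => t; have [ts|st] := ltP t s.
  by rewrite !concat_le ?ltW// (lt_le_trans ts).
by rewrite !(concat_ge _ _ st) (concat_le _ _ sr).
Qed.

(** The times at which [concat s w v] still depends on [w] when it is observed at
    the times [tau]. *)
Definition past tau s := s :: [seq t <- tau | t < s].

Lemma near_concat_past tau s d w v v' : near_on (past tau s) d w v ->
  near_on tau d (concat s w v') (concat s v v').
Proof.
move=> wv t tt; rewrite /concat; case: (ltP t s) => ts.
  by apply: (wv t); rewrite inE mem_filter tt ts orbT.
by rewrite gdistDr; apply: (wv s); rewrite inE eqxx.
Qed.

Lemma near_concat_future tau s d w v v' :
  near_on (0 :: [seq t - s | t <- tau]) (d / 2) v v' -> 0 < d ->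
  near_on tau d (concat s w v) (concat s w v').
Proof.
move=> vv' d0 t tt; rewrite /concat; case: (ltP t s) => _; first by rewrite gdistxx.
rewrite gdistDl (le_lt_trans (gdistB _ _ _ _))// [ltRHS]splitr ltrD//.
  by apply: (vv' (t - s)); rewrite inE (map_f (fun t => t - s)) ?orbT.
by apply: (vv' 0); rewrite inE eqxx.
Qed.

Lemma uc_on_future F s w (sigma : seq R) : uc_on sigma F ->
  uc_on (0 :: [seq t - s | t <- sigma]) (fun v => F (concat s w v)).
Proof.
move=> uF e /uF[d d0 h]; exists (d / 2); first by rewrite divr_gt0.
by move=> v v' vv'; apply: h; exact: near_concat_future.
Qed.

Lemma cylinder_future F s w : cylinder F -> cylinder (fun v => F (concat s w v)).
Proof.
move=> [[M FM] [tau uF]]; split; first by exists M.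
by exists (0 :: [seq t - s | t <- tau]); exact: uc_on_future.
Qed.

(** Whatever is done with the continuation after [s], a linear mean or a supremum
    of such means, the outcome is uniformly continuous in the past, as soon as it
    is 1-Lipschitz for the supremum norm. *)
Lemma uc_on_past (J : (path -> R) -> R) tau s F :
  (forall f g e, cylinder f -> cylinder g -> 0 < e ->
     (forall w, `|f w - g w| <= e) -> `|J f - J g| <= e) ->
  cylinder F -> uc_on tau F ->
  uc_on (past tau s) (fun w => J (fun v => F (concat s w v))).
Proof.
move=> HJ cF uF e e0; have [d d0 h] := uF e e0; exists d => // w v wv.
apply: HJ => //; [exact: cylinder_future..|move=> v'].
by apply: h; exact: near_concat_past.
Qed.

Lemma functional_dist (J : (path -> R) -> R) f g e :
  positive_functional cylinder J -> cylinder f -> cylinder g ->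
  (forall w, `|f w - g w| <= e) -> `|J f - J g| <= e.
Proof.
have VL := cylinder_lattice.
move=> PJ cf cg fg; rewrite -(functionalB VL PJ)// ler_norml.
have cfg := latticeB VL cf cg.
apply/andP; split; [apply: (functional_ge_cst VL PJ cfg)|apply: (functional_le_cst VL PJ cfg)];
by move=> w; have := fg w; rewrite ler_norml => /andP[].
Qed.

Lemma functional_bound (J : (path -> R) -> R) f M :
  positive_functional cylinder J -> cylinder f ->
  (forall w, `|f w| <= M) -> `|J f| <= M.
Proof.
have VL := cylinder_lattice.
move=> PJ cf fM; rewrite ler_norml.
apply/andP; split; [apply: (functional_ge_cst VL PJ cf)|apply: (functional_le_cst VL PJ cf)];
by move=> w; have := fM w; rewrite ler_norml => /andP[].
Qed.

Lemma cylinder_average (J : (path -> R) -> R) s F :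
  positive_functional cylinder J -> cylinder F ->
  cylinder (fun w => J (fun v => F (concat s w v))).
Proof.
move=> PJ cF; have [[M FM] [tau uF]] := cF; split.
  by exists M => w; apply: functional_bound => //; exact: cylinder_future.
exists (past tau s); apply: (uc_on_past (J := J)) => // f g e cf cg e0.
exact: functional_dist.
Qed.

End cylinder_functions.

(** * Linear convolution semigroups on functions *)

Section BUC_functions.
Context {R : realType} {G : metricZmodType R}.
Implicit Types f g : G -> R.

Definition BUC_fun : set (G -> R) := [set f | f \in is_BUC G].

Definition to_BUC f : BUC G := insubd (0 : BUC G) f.

Lemma to_BUCE f : BUC_fun f -> to_BUC f = f :> (G -> R).
Proof. by move=> bf; exact: (insubdK _ bf). Qed.

Lemma to_BUC_val (f : BUC G) : to_BUC f = f.
Proof. by apply/BUC_eqP => x; rewrite to_BUCE//; exact: BUCP. Qed.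

Lemma BUC_fun_intro f : (exists M, forall x, `|f x| <= M) ->
  (forall e, 0 < e -> exists2 d, 0 < d &
    forall x y, gdist x y < d -> `|f x - f y| <= e) -> BUC_fun f.
Proof.
move=> bf uf; apply/is_BUCP; split=> // e e0.
have [|d d0 h] := uf (e / 2); first by rewrite divr_gt0.
by exists d => // x y /h /le_lt_trans; apply; lra.
Qed.

Lemma BUC_lattice : vector_lattice BUC_fun.
Proof.
split.
- apply: BUC_fun_intro => [|e e0]; first by exists 1 => x; rewrite normr1.
  by exists 1 => // x y _; rewrite subrr normr0 ltW.
- move=> a f g bf bg.
  apply: (eq_mem_fun (L := BUC_fun) (BUCP (a *: to_BUC f + to_BUC g))) => x.
  by rewrite BUC_addE BUC_scaleE !to_BUCE.
- move=> f g /is_BUCP[[M fM] uf] /is_BUCP[[N gN] ug].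
  apply: BUC_fun_intro => [|e e0].
    exists (Num.max M N) => x; have := fM x; have := gN x.
    by rewrite /Num.min; case: ifP => _ h1 h2; rewrite le_max ?h1 ?h2 ?orbT.
  have [d1 d10 fd] := uf e e0; have [d2 d20 gd] := ug e e0.
  exists (Num.min d1 d2) => [|x y]; first by rewrite lt_min d10.
  rewrite lt_min => /andP[/fd + /gd]; rewrite !ltr_norml ler_norml.
  move=> /andP[? ?] /andP[? ?]; rewrite /Num.min.
  by case: (ltP (f x) (g x)) => ?; case: (ltP (f y) (g y)) => ?; apply/andP; split; lra.
- by move=> f /is_BUCP[].
Qed.

Lemma BUC_fun_shift f x : BUC_fun f -> BUC_fun (fun y => f (x + y)).
Proof.
move=> bf; apply: (eq_mem_fun (L := BUC_fun) (BUCP (BUC_shift x (to_BUC f)))).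
by move=> y /=; rewrite to_BUCE.
Qed.

Lemma BUC_norm_leP (f : BUC G) M : `|f| <= M <-> (forall x, `|f x| <= M).
Proof.
split=> [fM x|]; last exact: BUC_norm_le.
by rewrite (le_trans (BUC_norm_ub f x)).
Qed.

End BUC_functions.

Section linear_semigroup.
Context {R : realType} {G : metricZmodType R} {S : R -> BUC G -> BUC G}.
Hypotheses (HS : markovian_convolution_semigroup S)
  (linS : forall t, 0 <= t -> linear (S t)).
Implicit Types (f g : G -> R) (t s e : R).

(** Read on all functions, through an arbitrary value outside [BUC G], so that it
    can be iterated without carrying proofs of uniform continuity. *)
Definition fun_semigroup t f : G -> R := S t (to_BUC f).
Local Notation T := fun_semigroup.

Lemma fun_semigroup_functional t x : 0 <= t ->
  positive_functional BUC_fun (fun f => T t f x).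
Proof.
move=> t0; have [/(_ t t0)[/(_ x)[mono cstS _] _ _] _ _ _] := HS; split.
- by apply: cstS => // y; rewrite to_BUCE//; exact: (lattice1 BUC_lattice).
- move=> a f g bf bg; rewrite /T -BUC_scaleE -BUC_addE -linS//.
  congr (S t _ x); apply/BUC_eqP => y.
  by rewrite BUC_addE BUC_scaleE !to_BUCE//; exact: (lattice_lin BUC_lattice).
- by move=> f g bf bg fg; apply: mono => // y; rewrite !to_BUCE.
Qed.

Lemma fun_semigroup_shift t f x y : 0 <= t -> BUC_fun f ->
  T t f (x + y) = T t (fun z => f (x + z)) y.
Proof.
move=> t0 bf; have [/(_ t t0)[_ _ sh] _ _ _] := HS.
rewrite /T sh [RHS]sh; congr (S t _ 0); apply/BUC_eqP => z /=.
by rewrite !to_BUCE ?addrA//; exact: BUC_fun_shift.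
Qed.

Lemma fun_semigroup_dist t f g e x : 0 <= t -> BUC_fun f -> BUC_fun g ->
  (forall y, `|f y - g y| <= e) -> `|T t f x - T t g x| <= e.
Proof.
move=> t0 bf bg fg; have VL := @BUC_lattice R G.
have PT := fun_semigroup_functional x t0.
rewrite -(functionalB VL PT)// ler_norml; have bfg := latticeB VL bf bg.
apply/andP; split; [apply: (functional_ge_cst VL PT bfg)|apply: (functional_le_cst VL PT bfg)];
by move=> y; have := fg y; rewrite ler_norml => /andP[].
Qed.

(** Translation invariance turns a modulus of continuity of [f] into the same
    modulus for its image. *)
Lemma fun_semigroup_modulus t f d e x y : 0 <= t -> BUC_fun f ->
  (forall x y, gdist x y < d -> `|f x - f y| <= e) -> gdist x y < d ->
  `|T t f x - T t f y| <= e.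
Proof.
move=> t0 bf fde xy; rewrite -(addr0 x) -(addr0 y).
rewrite !(fun_semigroup_shift _ _ t0 bf).
apply: fun_semigroup_dist => //; [exact: BUC_fun_shift..|move=> z].
by apply: fde; rewrite gdistDr.
Qed.

Lemma fun_semigroup_cst t a x : 0 <= t -> T t (fun=> a) x = a.
Proof.
by move=> t0; exact: (functional_cst BUC_lattice (fun_semigroup_functional x t0)).
Qed.

Lemma fun_semigroupD s t f : 0 <= s -> 0 <= t -> T (s + t) f = T s (T t f).
Proof.
by move=> s0 t0; rewrite /T to_BUC_val; have [_ _ SD _] := HS; rewrite SD.
Qed.

Lemma BUC_fun_semigroup t f : BUC_fun (T t f).
Proof. exact: BUCP. Qed.

Lemma fun_semigroup0 f : BUC_fun f -> T 0 f = f.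
Proof. by move=> bf; rewrite /T; have [_ -> _ _] := HS; exact: to_BUCE. Qed.

(** By linearity, continuity from below of the semigroup at [- F n] is continuity
    from above at [F n]. *)
Lemma fun_semigroup_sigma_continuous t x : 0 <= t ->
  sigma_continuous BUC_fun (fun f => T t f x).
Proof.
move=> t0 F bF [F0 Fd Fe] e e0; have VL := @BUC_lattice R G.
have [/(_ t t0)[_ /(_ x) cb _] _ _ _] := HS.
have bN n : BUC_fun (fun x => - F n x) by exact: latticeN.
have := cb (fun n => to_BUC (fun x => - F n x)) (to_BUC (fun=> 0)).
case=> // [y|y|_].
- apply/nondecreasing_seqP => n /=.
  by rewrite !to_BUCE// lerN2.
- rewrite to_BUCE; last exact: lattice0.
  under eq_fun do rewrite to_BUCE//.
  suff : F n y @[n --> \oo] --> (0 : R) by move/cvgN; rewrite oppr0.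
  apply/cvgrPdist_le => d d0.
  have [n Fn] := Fe y d d0; exists n => // m /= nm.
  rewrite sub0r normrN ger0_norm//; apply: le_trans Fn.
  have /nonincreasing_seqP := (fun n => Fd n y); exact.
- have -> : S t (to_BUC (fun=> 0)) x = 0 by exact: fun_semigroup_cst.
  move=> /cvgrPdist_le/(_ e e0)[n _ /(_ n (leqnn n))].
  have -> : S t (to_BUC (fun x => - F n x)) x = - T t (F n) x.
    have := functionalZ VL (fun_semigroup_functional x t0) (-1) (bF n).
    rewrite mulN1r => <-; apply: (eq_functional (I := fun f => T t f x)) => y.
    by rewrite mulN1r.
  by rewrite opprK add0r => /(le_trans (ler_norm _)) ?; exists n.
Qed.

End linear_semigroup.

Arguments fun_semigroup {R G} S t f x.

(** * The path law of a linear convolution semigroup *)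

Section path_functional.
Context {R : realType} {G : metricZmodType R} {S : R -> BUC G -> BUC G}.
Hypotheses (HS : markovian_convolution_semigroup S)
  (linS : forall t, 0 <= t -> linear (S t)).
Local Notation T := (fun_semigroup S).
Local Notation W := (R -> G).
Implicit Types (s t u : R) (tau sigma : seq R) (F : W -> R) (w v : W).

(** The mean of [F] when the path is at [w s] at time [s] and is observed next at
    the times [tau]: the coordinates at those times are integrated out one after
    the other, from the last to the first, the others being read off [w]. *)
Fixpoint grid_mean s tau F w : R :=
  if tau is t :: tau' then
    T (t - s) (fun x => grid_mean t tau' F (upd w t x)) (w s)
  else F w.

Lemma uc_on_agree sigma F w v : uc_on sigma F ->
  (forall u, u \in sigma -> w u = v u) -> F w = F v.
Proof.
move=> uF wv; apply/eqP; rewrite -subr_eq0 -normr_le0; apply: le_of_eps => e e0.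
rewrite add0r; have [d d0 h] := uF e e0; apply: h => u us.
by rewrite wv// gdistxx.
Qed.

Lemma near_on_upd sigma d t w v x y : near_on sigma d w v -> gdist x y < d ->
  near_on (t :: sigma) d (upd w t x) (upd v t y).
Proof.
move=> wv xy u; rewrite inE /upd; case: eqVneq => //= _ /wv; exact.
Qed.

Lemma BUC_fun_section F t w : cylinder F -> BUC_fun (fun x => F (upd w t x)).
Proof.
move=> [[M FM] [sigma uF]]; apply: BUC_fun_intro => [|e /uF[d d0 h]].
  by exists M.
exists d => // x y xy; apply: h; apply: (@near_on_sub _ _ _ (t :: sigma) _ d) => //.
  by move=> u us; rewrite inE us orbT.
by apply: near_on_upd => //; exact: near_onxx.
Qed.

Lemma cylinder_grid_mean tau s F : path <%R s tau -> cylinder F ->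
  cylinder (grid_mean s tau F).
Proof.
elim: tau s => //= t tau IH s /andP[st /IH{}IH] /IH cF.
have t0 : 0 <= t - s by rewrite subr_ge0 ltW.
have VL := @BUC_lattice R G.
have bs w := BUC_fun_section t w cF.
have [[M FM] [sigma uF]] := cF; split.
  exists M => w; have PT := fun_semigroup_functional HS linS (w s) t0.
  rewrite ler_norml; apply/andP; split.
    apply: (functional_ge_cst VL PT (bs w)) => x.
    by have := FM (upd w t x); rewrite ler_norml => /andP[].
  apply: (functional_le_cst VL PT (bs w)) => x.
  by have := FM (upd w t x); rewrite ler_norml => /andP[].
exists (s :: sigma) => e e0.
have [d d0 h] := uF _ (divr_gt0 e0 (ltr0Sn _ 1)).
exists d => // w v wv.
have wv' : near_on sigma d w v.
  by apply: near_on_sub wv => // u us; rewrite inE us orbT.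
have near_upd x y : gdist x y < d -> near_on sigma d (upd w t x) (upd v t y).
  move=> xy; apply: (near_on_sub _ _ (near_on_upd (t:=t) wv' xy)) => // u us.
  by rewrite inE us orbT.
have near_upd' x y : gdist x y < d -> near_on sigma d (upd v t x) (upd v t y).
  move=> xy; apply: (near_on_sub _ _ (near_on_upd (t:=t) (@near_onxx _ _ sigma d v d0) xy)) => // u us.
  by rewrite inE us orbT.
rewrite (splitr e) (le_trans (ler_distD (T (t - s) (fun x => grid_mean t tau F (upd v t x)) (w s)) _ _))//.
apply: lerD.
  apply: (fun_semigroup_dist HS linS) => // x; apply: h.
  by apply: near_upd; rewrite gdistxx.
apply: (fun_semigroup_modulus HS linS (d := d)) => //.
  by move=> x y xy; apply: h; exact: near_upd'.
by apply: (wv s); rewrite inE eqxx.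
Qed.

Lemma grid_mean_functional tau s w : path <%R s tau ->
  positive_functional cylinder (fun F => grid_mean s tau F w).
Proof.
have VL := @BUC_lattice R G.
elim: tau s w => [|t tau IH] s w /=; first by split.
move=> /andP[st pt]; have t0 : 0 <= t - s by rewrite subr_ge0 ltW.
have PT x := fun_semigroup_functional HS linS x t0.
have bs F (cF : cylinder F) := BUC_fun_section t w (cylinder_grid_mean pt cF).
split.
- under eq_fun do rewrite (functional1 (IH _ _ pt)).
  exact: (fun_semigroup_cst HS linS).
- move=> a F F' cF cF'; rewrite -(functional_lin (PT _))//; [|exact: bs..].
  congr (T _ _ _); apply/funext => x.
  by rewrite (functional_lin (IH _ _ pt)).
- move=> F F' cF cF' FF'; apply: (functional_le (PT _)); [exact: bs..|move=> x].
  exact: (functional_le (IH _ _ pt)).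
Qed.

Lemma grid_mean_agree sigma F tau s w v : uc_on sigma F ->
  (forall u, u \in sigma -> u \notin tau -> w u = v u) -> w s = v s ->
  grid_mean s tau F w = grid_mean s tau F v.
Proof.
move=> uF; elim: tau s w v => [|t tau IH] s w v wv ws /=.
  by apply: (uc_on_agree uF) => u us; exact: wv.
rewrite ws; congr (T _ _ _); apply/funext => x; apply: IH => [u us ut|].
  rewrite /upd; case: eqVneq => // neq.
  by apply: wv => //; rewrite inE negb_or neq.
by rewrite /upd eqxx.
Qed.

(** Chapman-Kolmogorov: an intermediate time that is not observed can be dropped. *)
Lemma grid_mean_skip sigma F tau s t w : cylinder F -> uc_on sigma F ->
  t \notin sigma -> 0 <= s -> s < t -> path <%R t tau ->
  grid_mean s (t :: tau) F w = grid_mean s tau F w.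
Proof.
move=> cF uF ts s0 st; have t0 : 0 <= t - s by rewrite subr_ge0 ltW.
case: tau => [_|r tau /= /andP[tr pr]].
  rewrite /= (_ : (fun x => F (upd w t x)) = (fun=> F w)).
    exact: (fun_semigroup_cst HS linS).
  apply/funext => x; apply: (uc_on_agree uF) => u us; rewrite /upd.
  by case: eqVneq us ts => // -> ->.
pose f y := grid_mean r tau F (upd w r y).
have -> : (fun x => T (r - t) (fun y => grid_mean r tau F (upd (upd w t x) r y))
     (upd w t x t)) = T (r - t) f.
  apply/funext => x; rewrite (_ : upd w t x t = x); last by rewrite /upd eqxx.
  congr (T _ _ _); apply/funext => y.
  apply: (grid_mean_agree uF); last by rewrite /upd eqxx.
  move=> u us _; rewrite /upd; case: eqVneq => // _.
  by case: eqVneq us ts => // -> ->.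
have r0 : 0 <= r - t by rewrite subr_ge0 ltW.
rewrite -(fun_semigroupD HS _ t0 r0).
by rewrite (_ : t - s + (r - t) = r - s)//; ring.
Qed.

(** Consistency of the finite-dimensional laws, by dropping the unobserved times
    one at a time with [grid_mean_skip]. *)
Lemma grid_mean_subseq sigma F tau' tau s w : cylinder F -> uc_on sigma F ->
  0 <= s -> path <%R s tau' -> subseq tau tau' ->
  (forall u, u \in tau' -> u \notin tau -> u \notin sigma) ->
  grid_mean s tau' F w = grid_mean s tau F w.
Proof.
move=> cF uF; elim: tau' s tau w => [|t tau' IH] s tau w s0.
  by case: tau.
move=> /= /andP[st pt]; have t0 : 0 <= t by rewrite (le_trans s0)// ltW.
have ltt' u : u \in tau' -> t < u.
  by move: pt; rewrite lt_path_sortedE => /andP[/allP h _]; exact: h.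
case: tau => [_|r tau /=].
  move=> h; have tsig : t \notin sigma by apply: h => //; rewrite inE eqxx.
  rewrite (_ : (fun x => grid_mean t tau' F (upd w t x)) =
               fun x => grid_mean t [::] F (upd w t x)); last first.
    apply/funext => x; apply: IH => //; first exact: sub0seq.
    by move=> u ut _; apply: h => //; rewrite inE ut orbT.
  exact: (grid_mean_skip (tau := [::]) w cF uF tsig s0 st).
case: eqVneq => [-> {r} sub h|rt sub h].
  congr (T _ _ _); apply/funext => x; apply: IH => // u ut uta.
  apply: h; rewrite inE ?ut ?orbT// negb_or uta andbT.
  by rewrite gt_eqF// ltt'.
have prt : path <%R t (r :: tau) by apply: subseq_path sub pt; exact: lt_trans.
have tta : t \notin r :: tau.
  by apply/negP => /(mem_subseq sub)/ltt'; rewrite ltxx.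
have tsig : t \notin sigma by apply: h => //; rewrite inE eqxx.
rewrite -[RHS](grid_mean_skip w cF uF tsig s0 st prt).
congr (T _ _ _); apply/funext => x; apply: (IH t (r :: tau)) => // u ut uta.
by apply: h => //; rewrite inE ut orbT.
Qed.

Definition grid sigma : seq R := sort <=%R (undup [seq t <- sigma | 0 < t]).

Lemma mem_grid sigma t : (t \in grid sigma) = (0 < t) && (t \in sigma).
Proof. by rewrite mem_sort mem_undup mem_filter. Qed.

Lemma grid_path sigma : path <%R 0 (grid sigma).
Proof.
rewrite lt_path_sortedE; apply/andP; split.
  by apply/allP => t; rewrite mem_grid => /andP[].
by rewrite sort_lt_sorted undup_uniq.
Qed.

(** Some set of times is chosen for [F]; by [path_meanE] every other choice gives
    the same value. Coordinates at negative times are frozen at 0. *)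
Definition path_mean F : R :=
  grid_mean 0 (grid (xget [::] [set sigma | uc_on sigma F])) F (fun=> 0).

Lemma lt_path_subseq s tau tau' : path <%R s tau -> path <%R s tau' ->
  {subset tau <= tau'} -> subseq tau tau'.
Proof.
move=> /path_sorted pt /path_sorted pt' sub.
have -> : tau = [seq t <- tau' | t \in tau].
  apply: lt_sorted_eq => // [|t]; first exact: lt_sorted_filter.
  by rewrite mem_filter; case: (boolP (t \in tau)) => //= /sub ->.
exact: filter_subseq.
Qed.

Lemma path_meanE sigma tau F : cylinder F -> uc_on sigma F ->
  path <%R 0 tau -> (forall t, t \in sigma -> 0 < t -> t \in tau) ->
  path_mean F = grid_mean 0 tau F (fun=> 0).
Proof.
move=> cF uF pt st; rewrite /path_mean.
have [sigma' ->] : exists2 sigma', xget [::] [set sigma | uc_on sigma F] = sigma'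
  & uc_on sigma' F.
  eexists; first by [].
  by have [_ ex] := cF; case: xgetP => [? -> //|/(_ sigma)].
move=> uF'; pose big := grid (tau ++ sigma').
have tau_pos u : u \in tau -> 0 < u.
  by move: pt; rewrite lt_path_sortedE => /andP[/allP h _]; exact: h.
have pbig := grid_path (tau ++ sigma').
rewrite -(@grid_mean_subseq sigma' _ big) ?grid_path//; last 2 first.
- apply: lt_path_subseq (grid_path _) pbig _ => u.
  by rewrite !mem_grid mem_cat => /andP[-> ->]; rewrite orbT.
- move=> u; rewrite !mem_grid => /andP[u0 _]; rewrite u0/=.
  exact.
rewrite (@grid_mean_subseq sigma _ big tau)//.
- apply: lt_path_subseq pt pbig _ => u ut.
  by rewrite mem_grid mem_cat ut tau_pos.
- move=> u; rewrite mem_grid => /andP[u0 _]; apply: contraNN => us.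
  exact: st.
Qed.

Lemma path_mean_grid F sigma : cylinder F -> exists2 sigma' : seq R, {subset sigma <= sigma'} &
  forall tau, path <%R 0 tau -> (forall t, t \in sigma' -> 0 < t -> t \in tau) ->
    path_mean F = grid_mean 0 tau F (fun=> 0).
Proof.
move=> cF; have [_ [sigma' uF]] := cF; exists (sigma ++ sigma').
  by move=> t ts; rewrite mem_cat ts.
move=> tau pt h; apply: (path_meanE cF uF pt) => t ts; apply: h.
by rewrite mem_cat ts orbT.
Qed.

Lemma path_mean_functional : positive_functional cylinder path_mean.
Proof.
have VL := @cylinder_lattice R G.
split.
- have [s1 _ h1] := path_mean_grid [::] (lattice1 VL).
  rewrite (h1 (grid s1)) ?grid_path// => [|t ts t0]; last by rewrite mem_grid t0.
  exact: (functional1 (grid_mean_functional _ (grid_path _))).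
- move=> a F F' cF cF'.
  have [s1 _ h1] := path_mean_grid [::] cF.
  have [s2 s12 h2] := path_mean_grid s1 cF'.
  have [s3 s23 h3] := path_mean_grid s2 (lattice_lin VL a cF cF').
  rewrite (h1 (grid s3)) ?grid_path// => [|t ts t0]; last by rewrite mem_grid t0 s23// s12.
  rewrite (h2 (grid s3)) ?grid_path// => [|t ts t0]; last by rewrite mem_grid t0 s23.
  rewrite (h3 (grid s3)) ?grid_path// => [|t ts t0]; last by rewrite mem_grid t0.
  by rewrite (functional_lin (grid_mean_functional _ (grid_path _))).
- move=> F F' cF cF' FF'.
  have [s1 _ h1] := path_mean_grid [::] cF.
  have [s2 s12 h2] := path_mean_grid s1 cF'.
  rewrite (h1 (grid s2)) ?grid_path// => [|t ts t0]; last by rewrite mem_grid t0 s12.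
  rewrite (h2 (grid s2)) ?grid_path// => [|t ts t0]; last by rewrite mem_grid t0.
  exact: (functional_le (grid_mean_functional _ (grid_path _))).
Qed.

End path_functional.

(** * Markov property and increments of the path law *)

Section path_law.
Context {R : realType} {G : metricZmodType R} {S : R -> BUC G -> BUC G}.
Hypotheses (HS : markovian_convolution_semigroup S)
  (linS : forall t, 0 <= t -> linear (S t)).
Local Notation T := (fun_semigroup S).
Local Notation W := (R -> G).
Local Notation J := (grid_mean (S := S)).
Local Notation I := (path_mean (S := S)).
Implicit Types (s t u : R) (tau sigma : seq R) (F : W -> R) (w v : W).

Lemma grid_mean_cat tau1 tau2 s F w :
  J s (tau1 ++ tau2) F w = J s tau1 (J (last s tau1) tau2 F) w.
Proof.
elim: tau1 s w => //= t tau1 IH s w; congr (T _ _ _).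
by apply/funext => x; rewrite IH.
Qed.

(** Translation invariance in time and in space: the mean over the continuation
    after [s] is a mean over paths that start afresh at time 0. *)
Lemma grid_mean_concat s F w v a tau : cylinder F -> 0 <= s -> 0 <= a ->
  path <%R a tau ->
  J (a + s) [seq t + s | t <- tau] F (concat s w v) =
  J a tau (fun v => F (concat s w v)) v.
Proof.
move=> cF s0; elim: tau v a => // t tau IH v a a0 /= /andP[at_ pt].
have ta0 : 0 <= t - a by rewrite subr_ge0 ltW.
have t0 : 0 < t by rewrite (le_lt_trans a0).
rewrite concat_ge ?lerDr// addrK (_ : t + s - (a + s) = t - a); last by ring.
have updE x : upd (concat s w v) (t + s) x =
    concat s w (upd v t (v 0 - w s + x)).
  apply/funext => u; rewrite /concat /upd (lt_eqF t0) subr_eq.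
  case: (eqVneq u (t + s)) => [->|//].
  rewrite ltNge lerDr (ltW t0)/=.
  by rewrite addrAC (addrAC (v 0)) subrr sub0r addrA subrr add0r.
have -> : (fun x => J (t + s) [seq t + s | t <- tau] F (upd (concat s w v) (t + s) x))
   = fun x => J t tau (fun v => F (concat s w v)) (upd v t (v 0 - w s + x)).
  by apply/funext => x; rewrite updE IH// ltW.
have bg : BUC_fun (fun x => J t tau (fun v => F (concat s w v)) (upd v t x)).
  apply: BUC_fun_section; apply: (cylinder_grid_mean HS linS) => //.
  exact: cylinder_future.
have bf := BUC_fun_shift (v 0 - w s) bg.
have -> : w s + (v a - v 0) = w s - v 0 + v a by rewrite addrCA addrC.
rewrite (fun_semigroup_shift HS _ _ ta0 bf); congr (T _ _ _).
apply/funext => x; congr (J _ _ _ (upd _ _ _)).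
by rewrite addrA addrACA (addrC (- w s)) addrACA subrr subrr addr0 add0r.
Qed.

Lemma split_grid s sigma : 0 <= s -> exists tau1 tau2,
  [/\ path <%R 0 tau1, last 0 tau1 = s, path <%R s tau2,
      forall t, t \in sigma -> 0 < t -> t <= s -> t \in tau1
    & forall t, t \in sigma -> s < t -> t \in tau2] /\ (0 < s -> s \in tau1).
Proof.
rewrite le_eqVlt => /predU1P[<-|s0].
  exists [::], (grid sigma); split; last by rewrite ltxx.
  split=> //; first exact: grid_path.
    by move=> t _ t0; rewrite leNgt t0.
  by move=> t ts t0; rewrite mem_grid t0.
have gp := grid_path sigma.
have sg : sorted <%R (grid sigma) := path_sorted gp.
exists (rcons [seq t <- grid sigma | t < s] s), [seq t <- grid sigma | s < t].
split; last by rewrite mem_rcons inE eqxx.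
split.
- rewrite rcons_path; apply/andP; split.
    rewrite lt_path_sortedE lt_sorted_filter// andbT.
    by apply/allP => t; rewrite mem_filter mem_grid => /and3P[].
  have : all (< s) (0 :: [seq t <- grid sigma | t < s]).
    by rewrite /= s0/=; exact: filter_all.
  by move=> /allP/(_ _ (mem_last _ _)).
- by rewrite last_rcons.
- rewrite lt_path_sortedE lt_sorted_filter// andbT.
  exact: filter_all.
- move=> t ts t0; rewrite mem_rcons inE mem_filter mem_grid t0 ts !andbT.
  by rewrite le_eqVlt.
- by move=> t ts st; rewrite mem_filter st mem_grid ts (le_lt_trans _ st)// ltW.
Qed.

(** Independence and stationarity of the increments in a single formula: the path
    after [s] is [w s] plus an independent copy of the increments. *)
Lemma path_mean_markov s F : 0 <= s -> cylinder F ->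
  I F = I (fun w => I (fun v => F (concat s w v))).
Proof.
move=> s0 cF; have [_ [sigma uF]] := cF.
have [tau1 [tau2 [[p1 l1 p2 h1 h2] h3]]] := split_grid sigma s0.
have tau2s u : u \in tau2 -> s < u.
  by move: p2; rewrite lt_path_sortedE => /andP[/allP h _]; exact: h.
have PI := path_mean_functional HS linS.
(* the inner mean only integrates the grid points after [s] *)
have inner w : I (fun v => F (concat s w v)) = J s tau2 F w.
  have cc := cylinder_future s w cF.
  rewrite (path_meanE HS linS (tau := [seq t - s | t <- tau2]) cc (uc_on_future s w uF)).
  - rewrite -(grid_mean_concat w (fun=> 0) cF s0 (lexx 0)).
      rewrite add0r -map_comp (_ : map _ tau2 = tau2); last first.
        by rewrite -[RHS]map_id; apply: eq_map => t /=; rewrite subrK.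
      apply: (grid_mean_agree uF); last by rewrite concat_le.
      move=> u us ut; rewrite concat_le//; rewrite leNgt; apply: contra ut.
      exact: h2.
    have := p2; rewrite !lt_path_sortedE => /andP[/allP a2 s2]; apply/andP; split.
      by apply/allP => _ /mapP[t /a2 /= st ->]; rewrite /= subr_gt0.
    by rewrite sorted_map; apply: sub_sorted s2 => x y /=; rewrite ltrD2r.
  - have := p2; rewrite !lt_path_sortedE => /andP[/allP a2 s2]; apply/andP; split.
      by apply/allP => _ /mapP[t /a2 /= st ->]; rewrite /= subr_gt0.
    by rewrite sorted_map; apply: sub_sorted s2 => x y /=; rewrite ltrD2r.
  - move=> t; rewrite inE => /predU1P[->|]; first by rewrite ltxx.
    move=> /mapP[u us ->]; rewrite subr_gt0 => su.
    by apply/mapP; exists u => //; exact: h2.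
have cav : cylinder (fun w => I (fun v => F (concat s w v))).
  exact: cylinder_average.
have uav : uc_on (past sigma s) (fun w => I (fun v => F (concat s w v))).
  apply: (uc_on_past (J := I)) => // f g e cf cg e0.
  exact: functional_dist.
rewrite (path_meanE HS linS (tau := tau1) cav uav p1); last first.
  move=> t; rewrite inE => /predU1P[->//|]; rewrite mem_filter => /andP[ts tsig] t0.
  by apply: h1 => //; exact: ltW.
rewrite (path_meanE HS linS (tau := tau1 ++ tau2) cF uF).
- by rewrite grid_mean_cat l1; congr J; apply/funext => w; rewrite inner.
- by rewrite cat_path p1 l1.
- move=> t ts t0; rewrite mem_cat; have [tls|st] := leP t s; first by rewrite h1.
  by rewrite h2 ?orbT.
Qed.

Lemma uc_on_increment f t x : BUC_fun f ->
  uc_on [:: t; 0] (fun w : W => f (x + (w t - w 0))).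
Proof.
move=> /is_BUCP[[M fM] uf] e /uf[d d0 h].
exists (d / 2) => [|w v wv]; first by rewrite divr_gt0.
apply/ltW/h; rewrite gdistDl (le_lt_trans (gdistB _ _ _ _))// [ltRHS]splitr ltrD//.
  by apply: (wv t); rewrite inE eqxx.
by apply: (wv 0); rewrite !inE eqxx orbT.
Qed.

Lemma cylinder_increment f t x : BUC_fun f ->
  cylinder (fun w : W => f (x + (w t - w 0))).
Proof.
move=> bf; have /is_BUCP[[M fM] _] := bf; split; first by exists M.
by exists [:: t; 0]; exact: uc_on_increment.
Qed.

Lemma path_mean_increment f t x : 0 <= t -> BUC_fun f ->
  I (fun w => f (x + (w t - w 0))) = T t f x.
Proof.
move=> t0 bf; have cf := cylinder_increment t x bf.
rewrite (path_meanE HS linS (tau := if 0 < t then [:: t] else [::]) cf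
  (uc_on_increment t x bf)).
- case: ltP => [t_gt0|t_le0] /=.
    rewrite subr0 -[x in RHS]addr0 (fun_semigroup_shift HS _ _ t0 bf).
    congr (T _ _ _); apply/funext => y.
    by rewrite /upd eqxx (lt_eqF t_gt0) subr0.
  by rewrite (le_anti (introT andP (conj t_le0 t0))) (fun_semigroup0 HS)// subrr addr0.
- by case: ltP => //= ->.
- move=> u; rewrite !inE => /orP[/eqP ->|/eqP ->]; last by rewrite ltxx.
  by move=> t_gt0; rewrite t_gt0 inE.
Qed.

Lemma uc_on_coordinate f t : BUC_fun f ->
  uc_on [:: t] (fun w : W => f (w t)).
Proof.
move=> /is_BUCP[_ uf] e /uf[d d0 h]; exists d => // w v wv.
by apply/ltW/h; apply: (wv t); rewrite inE eqxx.
Qed.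

Lemma cylinder_coordinate f t : BUC_fun f -> cylinder (fun w : W => f (w t)).
Proof.
move=> bf; have /is_BUCP[[M fM] _] := bf; split; first by exists M.
by exists [:: t]; exact: uc_on_coordinate.
Qed.

Lemma path_mean_coordinate f t : BUC_fun f ->
  I (fun w => f (w t)) = T (Num.max 0 t) f 0.
Proof.
move=> bf; have cf := cylinder_coordinate t bf.
rewrite (path_meanE HS linS (tau := if 0 < t then [:: t] else [::]) cf
  (uc_on_coordinate t bf)).
- case: ltP => [t_gt0|t_le0] /=.
    rewrite subr0; congr (T _ _ _); apply/funext => y.
    by rewrite /upd eqxx.
  by rewrite (fun_semigroup0 HS).
- by case: ltP => //= ->.
- move=> u; rewrite !inE => /eqP ->.
  by move=> t_gt0; rewrite t_gt0 inE.
Qed.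

End path_law.

(** * Continuity of functionals on cylinder functions *)

Section separability.
Context {R : realType} {G : metricZmodType R}.

Lemma nbhs_gdistP (x : G) (A : set G) :
  nbhs x A <-> exists2 e : R, 0 < e & forall y, gdist x y < e -> A y.
Proof.
by rewrite -nbhs_ballE; split=> -[e /= e0 h]; exists e.
Qed.

Lemma dense_sequence : separable_space G ->
  exists q : nat -> G, forall (x : G) (d : R), 0 < d ->
    exists i, gdist x (q i) < d.
Proof.
move=> [Q /countable_injP[f finj] dQ].
exists (fun i => xget 0 [set x | Q x /\ f x = i]) => x d d0.
have [||y [By Qy]] := dQ (ball x d)^°.
- by exists x; apply/nbhs_gdistP; exists d.
- exact: open_interior.
- have /interior_subset := By; rewrite ballEmdist /= => xy.
  exists (f y); case: xgetP => [z _ [Qz fz]|/(_ y)[]//].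
  have -> // : z = y by apply: finj; rewrite ?inE.
Qed.

End separability.

Lemma ultra_exists_lt (U : set_system nat) (P : nat -> set nat) m :
  UltraFilter U -> U [set k | exists2 l, (l < m)%N & P l k] ->
  exists2 l, (l < m)%N & U (P l).
Proof.
move=> UU; elim: m => [|m IH] h.
  have : U set0 by apply: filterS h => k [l].
  by move=> U0; case: (filter_not_empty U U0).
have [UP|UP] := in_ultra_setVsetC (P m) UU; first by exists m.
have [|l lm ?] := IH; last by exists l => //; rewrite ltnS ltnW.
apply: filterS2 UP h => k nP [l]; rewrite ltnS leq_eqVlt => /predU1P[->//|lm ?].
by exists l.
Qed.

Lemma filter_all_seq (T : Type) (U : set_system T) {FU : Filter U}
    (K : eqType) (s : seq K) (P : K -> set T) :
  (forall t, t \in s -> U (P t)) -> U [set k | forall t, t \in s -> P t k].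
Proof.
elim: s => [|t s IH] h; first by apply: filterS filterT => k _ t.
have h1 : U (P t) by apply: h; rewrite inE eqxx.
have h2 : U [set k | forall t, t \in s -> P t k].
  by apply: IH => u us; apply: h; rewrite inE us orbT.
apply: filterS2 h1 h2 => k Pt Ps u; rewrite inE => /predU1P[->//|]; exact: Ps.
Qed.

Section sigma_continuity.
Context {R : realType} {G : metricZmodType R}.
Hypotheses (sepG : separable_space G) (complG : complete_space G).
Local Notation W := (R -> G).

(** A truncated multiple of the distance to the first [m] points of a dense
    sequence. It decreases to zero in [m], and where it is less than 1 the point
    lies in one of [m] balls of radius [1/(n+1)]: a functional that makes it small
    is tight. *)
Fixpoint net_distance (q : nat -> G) (n m : nat) (x : G) : R :=
  if m is m'.+1 then
    Num.min (net_distance q n m' x) (Num.min 1 (n.+1%:R * gdist x (q m')))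
  else 1.

Lemma BUC_fun_gdist (q : G) c : 0 <= c ->
  BUC_fun (fun x => Num.min 1 (c * gdist x q)).
Proof.
move=> c0; apply: BUC_fun_intro => [|e e0].
  exists 1 => x; rewrite ger0_norm ?ge_min ?lexx//.
  by rewrite le_min ler01 mulr_ge0// gdist_ge0.
have c1 : 0 < c + 1 by lra.
exists (e / (c + 1)) => [|x y xy]; first by rewrite divr_gt0.
have h : `|c * gdist x q - c * gdist y q| <= e.
  rewrite -mulrBr normrM (ger0_norm c0).
  apply: (@le_trans _ _ (c * (e / (c + 1)))).
    by rewrite ler_wpM2l// (le_trans (gdist_lip _ _ _))// ltW.
  by rewrite mulrA ler_pdivrMr// mulrC ler_pM2l//; lra.
move: h; rewrite !ler_norml /Num.min => /andP[? ?].
case: (ltP 1 (c * gdist x q)) => ?; case: (ltP 1 (c * gdist y q)) => ?;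
  by apply/andP; split; lra.
Qed.

Lemma BUC_fun_net_distance q n m : BUC_fun (net_distance q n m).
Proof.
elim: m => [|m IH]; first exact: (lattice1 BUC_lattice).
exact: (lattice_min BUC_lattice IH (BUC_fun_gdist _ (ler0n _ _))).
Qed.

Lemma net_distance_ge0 q n m x : 0 <= net_distance q n m x.
Proof.
elim: m => [|m IH] /=; first exact: ler01.
by rewrite !le_min IH ler01/= mulr_ge0// gdist_ge0.
Qed.

Lemma net_distance_lt1 q n m x : net_distance q n m x < 1 ->
  exists2 l, (l < m)%N & gdist x (q l) < n.+1%:R^-1.
Proof.
elim: m => [|m IH] /=; first by rewrite ltxx.
rewrite !gt_min ltxx/= => /orP[/IH[l lm ?]|h].
  by exists l => //; rewrite ltnS ltnW.
by exists m => //; rewrite -[ltRHS]mul1r ltr_pdivlMr// mulrC.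
Qed.

Lemma vanishing_net_distance q n :
  (forall (x : G) (d : R), 0 < d -> exists i, gdist x (q i) < d) ->
  vanishing (net_distance q n).
Proof.
move=> qd; split=> [m x|m x|x e e0]; first exact: net_distance_ge0.
  by rewrite /= ge_min lexx.
have [i xi] := qd x (e / n.+1%:R) (divr_gt0 e0 (ltr0Sn _ _)).
exists i.+1; rewrite /= !ge_min; apply/orP; right; apply/orP; right.
by rewrite mulrC -ler_pdivlMr// ltW.
Qed.

Lemma le_vanishing (T : Type) (F : nat -> T -> R) n m x : vanishing F ->
  (n <= m)%N -> F m x <= F n x.
Proof.
by move=> [_ Fd _]; have /nonincreasing_seqP := (fun n => Fd n x); apply.
Qed.

(** The compactness argument behind the Kolmogorov extension theorem. If paths
    [w k] violated the bound for every [k], then each coordinate [k |-> w k (a j)]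
    would eventually lie in finitely many balls of any given radius; along an
    ultrafilter it would be Cauchy, hence convergent, and at the limit path [F k]
    would not tend to zero. *)
Lemma vanishing_cylinders_bound (F : nat -> W -> R) (e M : R)
    (q : nat -> G) (a : nat -> R) (p : nat -> nat * nat) (m : nat -> nat) :
  (forall k, cylinder (F k)) -> vanishing F -> 0 < e -> 0 < M ->
  (forall w, F 0%N w <= M) ->
  (forall k, exists2 sigma, uc_on sigma (F k) &
     forall t, t \in sigma -> exists j, a j = t) ->
  (forall jn, exists i, p i = jn) ->
  exists k, forall w, F k w <=
    e + M * \sum_(i < k) net_distance q (p i).2 (m i) (w (a (p i).1)).
Proof.
move=> cF vF e0 M0 FM sF psurj; apply: contrapT => noex.
have /choice[w wP] k : exists w : W, ~~ (F k w <=
    e + M * \sum_(i < k) net_distance q (p i).2 (m i) (w (a (p i).1))).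
  by apply: contrapT => h; apply: noex; exists k => w; apply: contrapT => /negP h'; apply: h; exists w.
have wlt1 i k : (i < k)%N -> net_distance q (p i).2 (m i) (w k (a (p i).1)) < 1.
  move=> ik; have := wP k; rewrite -ltNge => h.
  have h1 := le_trans (le_vanishing (w k) vF (leq0n k)) (FM (w k)).
  have : \sum_(i < k) net_distance q (p i).2 (m i) (w k (a (p i).1)) < 1.
    rewrite -(ltr_pM2l M0) mulr1; lra.
  apply: le_lt_trans; rewrite (bigD1 (Ordinal ik))//= lerDl.
  by apply: sumr_ge0 => l _; exact: net_distance_ge0.
have [U [UU subU]] := ultraFilterLemma eventually_filter.
have Ugt i : U [set k | (i < k)%N] by apply: subU; exact: nbhs_infty_gt.
have lim_ex j : exists l : G, (fun k => w k (a j)) @ U --> l.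
  apply: complG; apply: cauchy_exP => d d0.
  pose n := Num.truncn d^-1.
  have nd : n.+1%:R^-1 < d.
    by rewrite -[ltRHS]invrK ltf_pV2 ?posrE ?invr_gt0// truncnS_gt.
  have [i pi] := psurj (j, n).
  have [|l lm Ul] := @ultra_exists_lt U
      (fun l => [set k | gdist (w k (a j)) (q l) < n.+1%:R^-1]) (m i) UU.
    apply: filterS (Ugt i) => k /= ik; have /net_distance_lt1 := wlt1 i k ik.
    by rewrite pi.
  exists (q l).
  suff : U [set k | ball (q l) d (w k (a j))] by [].
  apply: filterS Ul => k /= h; rewrite ballEmdist; change (gdist (q l) (w k (a j)) < d).
  by rewrite gdist_sym (lt_trans h).
pose w0 t := xget 0 [set l : G | (fun k => w k t) @ U --> l].
have w0P j : (fun k => w k (a j)) @ U --> w0 (a j).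
  have [l hl] := lim_ex j; rewrite /w0.
  by case: xgetP => [l' -> //|/(_ l)/(_ hl)].
have [F0 Fd /(_ w0 (e / 2))[|k Fk]] := vF; first by rewrite divr_gt0.
have [sigma uF sa] := sF k.
have e40 : 0 < e / 4 by rewrite divr_gt0.
have [d d0 hd] := uF _ e40.
have Unear : U [set l | near_on sigma d w0 (w l)].
  apply: filter_all_seq => t /sa[j <-].
  have : nbhs (w0 (a j)) [set y | gdist (w0 (a j)) y < d].
    by apply/nbhs_gdistP; exists d.
  by move=> /(w0P j).
have [l [/= kl wl]] := filter_ex (filterI (Ugt k) Unear).
have := hd _ _ wl; rewrite ler_norml => /andP[h1 h2].
have h3 := le_vanishing (w l) vF (ltnW kl).
have := wP l; rewrite -ltNge.
have : 0 <= M * \sum_(i < l) net_distance q (p i).2 (m i) (w l (a (p i).1)).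
  apply: mulr_ge0; first exact: ltW.
  by apply: sumr_ge0 => i _; exact: net_distance_ge0.
lra.
Qed.

(** Positive functionals on cylinder functions inherit their continuity from
    their one-dimensional marginals: the error terms of
    [vanishing_cylinders_bound] depend on one coordinate each and can be made
    summably small. *)
Theorem cylinder_sigma_continuous (I : (W -> R) -> R) :
  positive_functional cylinder I ->
  (forall t, sigma_continuous BUC_fun (fun f => I (fun w => f (w t)))) ->
  sigma_continuous cylinder I.
Proof.
move=> PI marg F cF vF e e0; have VL := @cylinder_lattice R G.
have [q qd] := dense_sequence sepG.
have [[M0 FM0] _] := cF 0%N.
pose M := `|M0| + 1; have M_gt0 : 0 < M by rewrite ltr_wpDl.
have FM w : F 0%N w <= M.
  by rewrite (le_trans (ler_norm _))// (le_trans (FM0 w))// (le_trans (ler_norm _))// lerDl.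
have /choice[sigma sP] k : exists sigma, uc_on sigma (F k) by have [] := cF k.
(* [p] enumerates the pairs (coordinate, precision), [a] all observed times *)
pose p i : nat * nat := odflt (0, 0)%N (unpickle i).
have pP jn : exists i, p i = jn by exists (pickle jn); rewrite /p pickleK.
pose a j := nth 0 (sigma (p j).1) (p j).2.
have aP k t : t \in sigma k -> exists j, a j = t.
  move=> ts; have [j pj] := pP (k, index t (sigma k)).
  by exists j; rewrite /a pj/= nth_index.
pose r := e / 2 / M.
have r0 : 0 < r by rewrite !divr_gt0.
have /choice[m mP] i : exists m,
    I (fun w => net_distance q (p i).2 m (w (a (p i).1))) <= r * 2^-1 ^+ i.+1.
  apply: (marg (a (p i).1) (net_distance q (p i).2)).
  - by move=> n; exact: BUC_fun_net_distance.
  - exact: vanishing_net_distance.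
  - by rewrite mulr_gt0// exprn_gt0.
have [||k Fk] := @vanishing_cylinders_bound F (e / 2) M q a p m cF vF _ M_gt0 FM _ pP.
- by rewrite divr_gt0.
- by move=> k; exists (sigma k) => // t; exact: aP.
exists k; pose b i (w : W) := net_distance q (p i).2 (m i) (w (a (p i).1)).
have cb i : cylinder (b i) by apply: cylinder_coordinate; exact: BUC_fun_net_distance.
have csum := lattice_sum VL (F := b) k cb.
apply: (@le_trans _ _ (I (fun w => M * \sum_(i < k) b i w + e / 2))).
  apply: (functional_le PI) => //; first by apply: (lattice_lin VL) => //; exact: cylinder_cst.
  by move=> w; rewrite addrC; exact: Fk.
rewrite (functional_lin PI)//; last exact: cylinder_cst.
rewrite (functional_cst VL PI) (functional_sum VL PI (F := b))//.
have : \sum_(i < k) I (b i) <= r.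
  apply: (@le_trans _ _ (\sum_(i < k) r * 2^-1 ^+ i.+1)).
    by apply: ler_sum => i _; exact: mP.
  by rewrite -mulr_sumr ler_piMr ?(ltW r0)// sum_half_le.
have Mr : M * r = e / 2 by rewrite /r mulrC divfK// gt_eqF.
by rewrite -(ler_pM2l M_gt0) Mr; lra.
Qed.

End sigma_continuity.

(** * Controlled laws and dynamic programming *)

Section path_nets.
Context {R : realType} {G : metricZmodType R}.
Local Notation W := (R -> G).

Lemma dense_paths (sigma : seq R) : separable_space G ->
  exists q : nat -> W, forall w d, 0 < d -> exists k, near_on sigma d w (q k).
Proof.
move=> /dense_sequence[x xd].
exists (fun k t => x (nth 0%N (odflt [::] (unpickle k)) (index t sigma))).
move=> w d d0; have /choice[n nP] t := xd (w t) d d0.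
exists (pickle [seq n t | t <- sigma]) => t ts; rewrite pickleK /=.
by rewrite (nth_map 0) ?index_mem// nth_index.
Qed.

(** A continuous cut-off, equal to 1 when [w] is within [d / 2] of [v] at the times
    [sigma] and to 0 when it is not within [d]. *)
Fixpoint bump (sigma : seq R) (d : R) (v w : W) : R :=
  if sigma is t :: sigma' then
    Num.min (bump sigma' d v w)
      (Num.min 1 (- 2 * Num.min 1 (d^-1 * gdist (w t) (v t)) + 2))
  else 1.

Lemma cylinder_bump sigma d v : 0 < d -> cylinder (bump sigma d v).
Proof.
move=> d0; have VL := @cylinder_lattice R G; have VB := @BUC_lattice R G.
elim: sigma => [|t sigma IH]; first exact: cylinder_cst.
apply: (lattice_min VL IH).
apply: (cylinder_coordinate (f := fun x => Num.min 1
  (- 2 * Num.min 1 (d^-1 * gdist x (v t)) + 2)) t).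
apply: (lattice_min VB); first exact: (lattice1 VB).
apply: (lattice_lin VB); last exact: (lattice_cst VB).
by apply: BUC_fun_gdist; rewrite invr_ge0 ltW.
Qed.

Lemma bump_ge0 sigma d v w : 0 <= bump sigma d v w.
Proof.
elim: sigma => [|t sigma IH] /=; first exact: ler01.
rewrite !le_min IH ler01/=.
have : Num.min 1 (d^-1 * gdist (w t) (v t)) <= 1 by rewrite ge_min lexx.
by lra.
Qed.

Lemma bump_le1 sigma d v w : bump sigma d v w <= 1.
Proof. by elim: sigma => [|t sigma IH] //=; rewrite ge_min IH. Qed.

Lemma bump_near sigma d v w : 0 < d -> 0 < bump sigma d v w ->
  near_on sigma d w v.
Proof.
move=> d0; elim: sigma => [_ t|t sigma IH] //=.
rewrite !lt_min ltr01/= => /andP[/IH{}IH h] u.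
rewrite inE => /predU1P[-> {u}|]; last exact: IH.
rewrite ltNge; apply/negP => dwv; move: h.
rewrite min_l ?mulr1; first by lra.
by rewrite ler_pdivlMl// mulr1.
Qed.

Lemma near_bump sigma d v w : 0 < d -> near_on sigma (d / 2) w v ->
  bump sigma d v w = 1.
Proof.
move=> d0; elim: sigma => [_|t sigma IH wv] //=.
rewrite IH; last by apply: near_on_sub wv => // u us; rewrite inE us orbT.
have : d^-1 * gdist (w t) (v t) <= 2^-1.
  by rewrite ler_pdivrMl// ltW// (wv t) ?inE ?eqxx.
move: (d^-1 * _) => y hy; rewrite (_ : Num.min 1 y = y); last first.
  by rewrite min_r//; lra.
by rewrite (_ : Num.min 1 (-2 * y + 2) = 1) ?minxx// min_l//; lra.
Qed.

End path_nets.

Section controlled_laws.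
Context {R : realType} {G : metricZmodType R} {Lambda : Type}
  {S : Lambda -> R -> BUC G -> BUC G}.
Hypotheses (sepG : separable_space G) (complG : complete_space G).
Hypotheses (HS : forall l, markovian_convolution_semigroup (S l))
  (linS : forall l t, 0 <= t -> linear (S l t)).
Variable l0 : Lambda.
Local Notation W := (R -> G).
Let VL := @cylinder_lattice R G.

(** The mean functionals of the admissible strategies. In [controlled_paste] the
    strategy [K w] that takes over at time [s] may depend on the path [w]; the
    last premise is the regularity that keeps the result defined on cylinder
    functions. *)
Inductive controlled : ((W -> R) -> R) -> Prop :=
| controlled_base l : controlled (path_mean (S := S l))
| controlled_mix p Q1 Q2 : 0 <= p <= 1 -> controlled Q1 -> controlled Q2 ->
    controlled (fun F => p * Q1 F + (1 - p) * Q2 F)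
| controlled_paste s Q (K : W -> (W -> R) -> R) : 0 <= s -> controlled Q ->
    (forall w, controlled (K w)) ->
    (forall F, cylinder F ->
       cylinder (fun w => K w (fun v => F (concat s w v)))) ->
    controlled (fun F => Q (fun w => K w (fun v => F (concat s w v)))).

Lemma path_mean_sigma_continuous l :
  sigma_continuous cylinder (path_mean (S := S l)).
Proof.
apply: cylinder_sigma_continuous => //; first exact: (path_mean_functional (HS l) (@linS l)).
move=> t F bF vF e e0.
have t0 : 0 <= Num.max 0 t by rewrite le_max lexx.
have [n Fn] := fun_semigroup_sigma_continuous (HS l) (@linS l) 0 t0 bF vF e0.
by exists n; rewrite (path_mean_coordinate (HS l) (@linS l)).
Qed.

Lemma vanishing_concat s w (F : nat -> W -> R) : vanishing F ->
  vanishing (fun n v => F n (concat s w v)).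
Proof. by move=> [F0 Fd Fe]; split=> // v e /Fe. Qed.

(** The continuity passes to a switching because vanishing sequences of cylinder
    functions remain vanishing once the continuation has been integrated out. *)
Lemma controlled_functional Q : controlled Q ->
  positive_functional cylinder Q /\ sigma_continuous cylinder Q.
Proof.
elim=> {Q} [l|p Q1 Q2 p01 _ [P1 s1] _ [P2 s2]|s Q K s0 _ [PQ sQ] _ HK cK].
- split; first exact: (path_mean_functional (HS l) (@linS l)).
  exact: path_mean_sigma_continuous.
- have /andP[p0 p1] := p01; have q0 : 0 <= 1 - p by lra.
  split; first split.
  + by rewrite (functional1 P1) (functional1 P2); lra.
  + move=> a f g cf cg; rewrite (functional_lin P1)// (functional_lin P2)//; ring.
  + by move=> f g cf cg fg; rewrite lerD// ler_wpM2l// (functional_le P1, functional_le P2).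
  + move=> F cF vF e e0; have [n1 h1] := s1 F cF vF e e0.
    have [n2 h2] := s2 F cF vF e e0; exists (maxn n1 n2).
    have {}h1 : Q1 (F (maxn n1 n2)) <= e.
      by apply: le_trans h1; apply: (functional_le P1) => // w; rewrite le_vanishing// leq_maxl.
    have {}h2 : Q2 (F (maxn n1 n2)) <= e.
      by apply: le_trans h2; apply: (functional_le P2) => // w; rewrite le_vanishing// leq_maxr.
    by have := ler_wpM2l p0 h1; have := ler_wpM2l q0 h2; lra.
- split; first split.
  + under eq_fun do rewrite (functional1 (HK _).1).
    exact: (functional1 PQ).
  + move=> a f g cf cg; rewrite -(functional_lin PQ) => [||]; [|exact: cK..].
    by congr Q; apply/funext => w; rewrite (functional_lin (HK w).1)//; exact: cylinder_future.
  + move=> f g cf cg fg; apply: (functional_le PQ); [exact: cK..|move=> w].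
    by apply: (functional_le (HK w).1) => //; exact: cylinder_future.
  + move=> F cF vF; apply: sQ => [n|]; first exact: cK.
    split=> [n w|n w|w e e0].
    * apply: (functional_ge0 VL (HK w).1); first exact: cylinder_future.
      by have [F0 _ _] := vF; move=> v.
    * apply: (functional_le (HK w).1); [exact: cylinder_future..|move=> v].
      by have [_ Fd _] := vF.
    * apply: (HK w).2 => //; last exact: vanishing_concat.
      by move=> n; exact: cylinder_future.
Qed.

Definition upper (F : W -> R) : R :=
  sup [set r | exists2 Q, controlled Q & r = Q F].

Lemma has_sup_upper F : cylinder F ->
  has_sup [set r | exists2 Q, controlled Q & r = Q F].
Proof.
move=> cF; split.
  by exists (path_mean (S := S l0) F), (path_mean (S := S l0)) => //; exact: controlled_base.
have [[M FM] _] := cF; exists M => _ [Q cQ ->].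
by rewrite (functional_le_cst VL (controlled_functional cQ).1)// => w; rewrite (le_trans (ler_norm _)).
Qed.

Lemma upper_ge Q F : controlled Q -> cylinder F -> Q F <= upper F.
Proof. by move=> cQ cF; apply: sup_upper_bound; [exact: has_sup_upper|exists Q]. Qed.

Lemma upper_le F a : (forall Q, controlled Q -> Q F <= a) -> upper F <= a.
Proof.
move=> h; apply: ge_sup => [|_ [Q cQ ->]]; last exact: h.
by exists (path_mean (S := S l0) F), (path_mean (S := S l0)) => //; exact: controlled_base.
Qed.

Lemma upper_adherent F e : cylinder F -> 0 < e ->
  exists2 Q, controlled Q & upper F - e < Q F.
Proof.
move=> cF e0; have [_ [Q cQ ->] h] := sup_adherent e0 (has_sup_upper cF).
by exists Q.
Qed.

Lemma upper_mono F F' : cylinder F -> cylinder F' -> (forall w, F w <= F' w) ->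
  upper F <= upper F'.
Proof.
move=> cF cF' FF'; apply: upper_le => Q cQ; apply: le_trans (upper_ge cQ cF').
exact: (functional_le (controlled_functional cQ).1).
Qed.

Lemma upper_cst a : upper (fun=> a) = a.
Proof.
apply/eqP; rewrite eq_le; apply/andP; split.
  by apply: upper_le => Q cQ; rewrite (functional_cst VL (controlled_functional cQ).1).
have := upper_ge (controlled_base l0) (cylinder_cst a).
by rewrite (functional_cst VL (controlled_functional (controlled_base l0)).1).
Qed.

Lemma upperD F F' : cylinder F -> cylinder F' ->
  upper (fun w => F w + F' w) <= upper F + upper F'.
Proof.
move=> cF cF'; apply: upper_le => Q cQ.
by rewrite (functionalD (controlled_functional cQ).1)// lerD// upper_ge.
Qed.

Lemma upperZ a F : 0 <= a -> cylinder F -> upper (fun w => a * F w) = a * upper F.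
Proof.
have le b H : 0 <= b -> cylinder H -> upper (fun w => b * H w) <= b * upper H.
  move=> b0 cH; apply: upper_le => Q cQ.
  by rewrite (functionalZ VL (controlled_functional cQ).1)// ler_wpM2l// upper_ge.
rewrite le_eqVlt => /predU1P[<- cF|a0 cF].
  by rewrite mul0r; under eq_fun do rewrite mul0r; rewrite upper_cst.
apply/eqP; rewrite eq_le le ?(ltW a0)//=.
have := le a^-1 (fun w => a * F w) _ (latticeZ VL a cF).
rewrite invr_ge0 => /(_ (ltW a0)); rewrite ler_pdivlMl//.
by under eq_fun do rewrite mulKf ?gt_eqF//.
Qed.

Lemma upper_dist F F' e : cylinder F -> cylinder F' ->
  (forall w, `|F w - F' w| <= e) -> `|upper F - upper F'| <= e.
Proof.
have le H H' : cylinder H -> cylinder H' -> (forall w, `|H w - H' w| <= e) ->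
    upper H - upper H' <= e.
  move=> cH cH' HH'; rewrite lerBlDr; apply: upper_le => Q cQ.
  rewrite -lerBlDr (le_trans _ (functional_dist (controlled_functional cQ).1 cH cH' HH'))//.
  by rewrite (le_trans _ (ler_norm _))// lerB// upper_ge.
move=> cF cF' FF'; have h1 := le _ _ cF cF' FF'.
have h2 : upper F' - upper F <= e by apply: le => // w; rewrite distrC.
by rewrite ler_norml; apply/andP; split; lra.
Qed.

Lemma upper_bound F M : cylinder F -> (forall w, `|F w| <= M) -> `|upper F| <= M.
Proof.
move=> cF FM; have := @upper_dist F (fun=> 0) M cF (cylinder_cst 0).
by rewrite upper_cst subr0; apply=> w; rewrite subr0.
Qed.

Lemma uc_on_upper_past sigma s F : cylinder F -> uc_on sigma F ->
  uc_on (past sigma s) (fun w => upper (fun v => F (concat s w v))).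
Proof.
move=> cF uF; apply: (uc_on_past (J := upper)) => // f g e cf cg _.
exact: upper_dist.
Qed.

Lemma cylinder_upper s F : cylinder F ->
  cylinder (fun w => upper (fun v => F (concat s w v))).
Proof.
move=> cF; have [[M FM] [sigma uF]] := cF; split.
  by exists M => w; apply: upper_bound => //; exact: cylinder_future.
by exists (past sigma s); exact: uc_on_upper_past.
Qed.

(** A randomised feedback law built one candidate at a time: at the path [w], the
    candidate [Qs m] is used with probability [psi m w], and otherwise the law
    built from the earlier candidates. Recursion replaces a partition of unity. *)
Fixpoint feedback (psi : nat -> W -> R) (Qs : nat -> (W -> R) -> R) m w F : R :=
  if m is m'.+1 then
    psi m' w * Qs m' F + (1 - psi m' w) * feedback psi Qs m' w F
  else path_mean (S := S l0) F.

Lemma controlled_feedback psi Qs m w : (forall k w, 0 <= psi k w <= 1) ->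
  (forall k, controlled (Qs k)) -> controlled (feedback psi Qs m w).
Proof.
move=> psi01 cQ; elim: m => [|m IH] /=; first exact: (controlled_base l0).
exact: controlled_mix.
Qed.

Lemma cylinder_feedback psi Qs m s F : (forall k, cylinder (psi k)) ->
  (forall k, controlled (Qs k)) -> cylinder F ->
  cylinder (fun w => feedback psi Qs m w (fun v => F (concat s w v))).
Proof.
move=> cpsi cQ cF; elim: m => [|m IH] /=.
  apply: (cylinder_average (J := path_mean (S := S l0))) => //.
  exact: (controlled_functional (controlled_base l0)).1.
apply: (latticeD VL); apply: cylinderM => //.
  by apply: (cylinder_average (J := Qs m)) => //; exact: (controlled_functional (cQ m)).1.
by apply: (latticeB VL) => //; exact: cylinder_cst.
Qed.

(** Near-optimal continuations can be chosen depending on the past. The paths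
    [q k] are dense at the observed times and [Qs k] is nearly optimal after
    [q k], hence also after every path near [q k], on which alone [psi k] is
    nonzero. The probability [rest m] that none of the first [m] candidates is
    used decreases to zero, so that its contribution under [Q] is negligible. *)
Lemma upper_paste s F : 0 <= s -> cylinder F ->
  upper (fun w => upper (fun v => F (concat s w v))) <= upper F.
Proof.
move=> s0 cF; have [[M0 FM0] [sigma uF]] := cF.
have [M M_gt0 FM] : exists2 M, 0 < M & forall w, `|F w| <= M.
  exists (`|M0| + 1) => [|w]; first by rewrite ltr_wpDl.
  by rewrite (le_trans (FM0 w))// (le_trans (ler_norm _))// lerDl.
apply: upper_le => Q cQ; have [PQ sQ] := controlled_functional cQ.
apply: le_of_eps => e e0.
pose g w := upper (fun v => F (concat s w v)).
have cg : cylinder g := cylinder_upper s cF.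
have cfut w : cylinder (fun v => F (concat s w v)) := cylinder_future s w cF.
have e60 : 0 < e / 6 by lra.
have [d d0 hd] := uF _ e60.
have [q qd] := dense_paths (past sigma s) sepG.
have /choice[Qs QsP] k : exists Qk, controlled Qk /\
    g (q k) - e / 6 < Qk (fun v => F (concat s (q k) v)).
  by have [Qk cQk h] := upper_adherent (cfut (q k)) e60; exists Qk.
pose psi k w := bump (past sigma s) d (q k) w.
have psi01 k w : 0 <= psi k w <= 1 by rewrite bump_ge0 bump_le1.
have cpsi k : cylinder (psi k) by exact: cylinder_bump.
have cQs k : controlled (Qs k) by have [] := QsP k.
pose rest := fix rest m w : R :=
  if m is m'.+1 then (1 - psi m' w) * rest m' w else 1.
have crest m : cylinder (rest m).
  elim: m => [|m IH]; first exact: cylinder_cst.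
  by apply: cylinderM => //; apply: (latticeB VL) => //; exact: cylinder_cst.
have rest0 m w : 0 <= rest m w.
  elim: m => [|m IH] //=; rewrite mulr_ge0// subr_ge0.
  by have /andP[] := psi01 m w.
have restS m w : rest m.+1 w <= rest m w.
  by rewrite /= ler_piMl// gerBl; have /andP[] := psi01 m w.
have vrest : vanishing rest.
  split=> // w e' e'0; have [|k wk] := qd w (d / 2); first by rewrite divr_gt0.
  by exists k.+1; rewrite /= /psi near_bump// subrr mul0r ltW.
have good m w : 0 < psi m w ->
    g w - e / 2 <= Qs m (fun v => F (concat s w v)).
  move=> /(bump_near d0) wq; have [_ h] := QsP m.
  have FF v : `|F (concat s w v) - F (concat s (q m) v)| <= e / 6.
    by apply: hd; exact: near_concat_past.
  have := upper_dist (cfut w) (cfut (q m)) FF.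
  have := functional_dist (controlled_functional (cQs m)).1 (cfut w) (cfut (q m)) FF.
  rewrite !ler_norml -/(g w) -/(g (q m)) => /andP[? ?] /andP[? ?]; lra.
(* [2 * M] bounds the loss when none of the candidates is used *)
have key m w : g w - e / 2 - 2 * M * rest m w <=
    feedback psi Qs m w (fun v => F (concat s w v)).
  elim: m => [|m IH] /=.
    have := upper_bound (cfut w) (fun v => FM _).
    have := functional_bound (controlled_functional (controlled_base l0)).1
      (cfut w) (fun v => FM _).
    rewrite !ler_norml -/(g w) => /andP[? ?] /andP[? ?]; lra.
  have /andP[p0 p1] := psi01 m w; have q0 : 0 <= 1 - psi m w by lra.
  have h1 := ler_wpM2l q0 IH.
  have h2 : psi m w * (g w - e / 2) <= psi m w * Qs m (fun v => F (concat s w v)).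
    move: p0; rewrite le_eqVlt => /predU1P[<-|p0]; first by rewrite !mul0r.
    by rewrite ler_pM2l//; exact: good.
  have -> : g w - e / 2 - 2 * M * ((1 - psi m w) * rest m w) =
    psi m w * (g w - e / 2) + (1 - psi m w) * (g w - e / 2 - 2 * M * rest m w) by ring.
  exact: lerD.
have [|m restm] := sQ rest crest vrest (e / 2 / (2 * M)).
  by rewrite !divr_gt0// mulr_gt0.
have cfb : cylinder (fun w => feedback psi Qs m w (fun v => F (concat s w v))).
  exact: cylinder_feedback.
have cnew : controlled (fun F => Q (fun w => feedback psi Qs m w (fun v => F (concat s w v)))).
  apply: controlled_paste => // [w|F' cF']; first exact: controlled_feedback.
  exact: cylinder_feedback.
have h1 := upper_ge cnew cF.
have h2 : Q g - e / 2 - 2 * M * Q (rest m) <=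
   Q (fun w => feedback psi Qs m w (fun v => F (concat s w v))).
  have cgh : cylinder (fun w => g w - e / 2) by apply: (latticeB VL) => //; exact: cylinder_cst.
  have cr : cylinder (fun w => 2 * M * rest m w) by exact: latticeZ.
  rewrite -(functionalZ VL PQ)// -[X in Q g - X](functional_cst VL PQ) -(functionalB VL PQ)//; last exact: cylinder_cst.
  rewrite -(functionalB VL PQ)//; apply: (functional_le PQ) => [||w]; last exact: key.
    exact: (latticeB VL cgh cr).
  exact: cfb.
have h3 : 2 * M * Q (rest m) <= e / 2.
  have M2 : 0 < 2 * M by rewrite mulr_gt0.
  have -> : e / 2 = 2 * M * (e / 2 / (2 * M)) by rewrite [RHS]mulrC divfK// gt_eqF.
  by rewrite (ler_pM2l M2).
change (Q g <= upper F + e); lra.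
Qed.

(** What follows time [s] under a controlled law is itself controlled. For a
    switching at [r <= s] the continuation after [s] belongs to the law [K w]; for
    [s < r] the continuation contains the switching, and [upper_paste] absorbs it. *)
Lemma controlled_conditioning Q s F : controlled Q -> 0 <= s -> cylinder F ->
  Q F <= Q (fun w => upper (fun v => F (concat s w v))).
Proof.
move=> cQ; elim: cQ s F => {Q} [l|p Q1 Q2 p01 c1 IH1 c2 IH2|r Q K r0 cQ IHQ cK IHK KK] s F s0 cF.
- have cb := controlled_base l.
  rewrite {1}(path_mean_markov (HS l) (@linS l) s0 cF).
  apply: (functional_le (controlled_functional cb).1) => [||w].
  + by apply: (cylinder_average (J := path_mean (S := S l))) => //; exact: (controlled_functional cb).1.
  + exact: cylinder_upper.
  + by apply: upper_ge => //; exact: cylinder_future.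
- have /andP[p0 p1] := p01; apply: lerD; apply: ler_wpM2l => //.
  + exact: IH1.
  + by rewrite subr_ge0.
  + exact: IH2.
have [PQ _] := controlled_functional cQ.
have [rs|sr] := leP r s.
  apply: (functional_le PQ) => [||w].
  - exact: (KK F).
  - by apply: (KK (fun w => upper (fun v => F (concat s w v)))); exact: (cylinder_upper s cF).
  - apply: le_trans (IHK w (s - r) _ _ (cylinder_future r w cF)) _.
      by rewrite subr_ge0.
    rewrite le_eqVlt; apply/orP; left; apply/eqP; congr (K w).
    apply/funext => v; congr upper; apply/funext => v'.
    by rewrite concatA.
apply: (@le_trans _ _ (Q (fun w => upper (fun v => F (concat r w v))))).
  apply: (functional_le PQ) => [||w]; [exact: (KK F)|exact: (cylinder_upper r cF)|].
  by apply: upper_ge => //; exact: cylinder_future.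
have cu := cylinder_upper r cF.
apply: le_trans (IHQ s _ s0 cu) _.
apply: (functional_le PQ) => [||w]; first exact: (cylinder_upper s cu).
  by apply: (KK (fun w => upper (fun v => F (concat s w v)))); exact: (cylinder_upper s cF).
have -> : (fun v => upper (fun v' => F (concat s (concat r w v) v'))) =
   (fun=> upper (fun v' => F (concat s w v'))).
  apply/funext => v; congr upper; apply/funext => v'.
  by rewrite concat_stop// ltW.
rewrite (functional_cst VL (controlled_functional (cK w)).1).
have rs0 : 0 <= r - s by rewrite subr_ge0 ltW.
apply: le_trans (upper_paste rs0 (cylinder_future s w cF)).
rewrite le_eqVlt; apply/orP; left; apply/eqP; congr upper.
apply/funext => v; congr upper; apply/funext => v'.
by rewrite concatA// ltW.
Qed.

Theorem dynamic_programming s F : 0 <= s -> cylinder F ->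
  upper F = upper (fun w => upper (fun v => F (concat s w v))).
Proof.
move=> s0 cF; apply/eqP; rewrite eq_le upper_paste// andbT.
apply: upper_le => Q cQ; apply: le_trans (controlled_conditioning cQ s0 cF) _.
by apply: upper_ge => //; exact: cylinder_upper.
Qed.

(** The minimality of the Nisio semigroup: the increments before and after a
    switching are bounded one after the other. *)
Lemma controlled_supersolution (U : R -> G -> R) :
  (forall r, 0 <= r -> BUC_fun (U r)) ->
  (forall l h r x, 0 <= h -> 0 <= r -> fun_semigroup (S l) h (U r) x <= U (r + h) x) ->
  forall Q, controlled Q -> forall h r x, 0 <= h -> 0 <= r ->
    Q (fun w => U r (x + (w h - w 0))) <= U (r + h) x.
Proof.
move=> bU SU Q; elim=> {Q} [l|p Q1 Q2 p01 c1 IH1 c2 IH2|s Q K s0 cQ IHQ cK IHK KK] h r x h0 r0.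
- by rewrite (path_mean_increment (HS l) (@linS l))//; [exact: SU|exact: bU].
- have /andP[p0 p1] := p01; have q0 : 0 <= 1 - p by lra.
  have h1 := ler_wpM2l p0 (IH1 h r x h0 r0).
  have h2 := ler_wpM2l q0 (IH2 h r x h0 r0).
  lra.
- have [hs|sh] := leP h s.
    apply: le_trans (IHQ h r x h0 r0); rewrite le_eqVlt; apply/orP; left; apply/eqP.
    congr Q; apply/funext => w.
    under eq_fun do rewrite !concat_le//.
    exact: (functional_cst VL (controlled_functional (cK w)).1).
  have hs0 : 0 <= h - s by rewrite subr_ge0 ltW.
  have -> : r + h = (r + (h - s)) + s by ring.
  have rhs0 : 0 <= r + (h - s) by rewrite addr_ge0.
  apply: le_trans (IHQ s (r + (h - s)) x s0 rhs0).
  apply: (functional_le (controlled_functional cQ).1) => [||w].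
  + by apply: (KK (fun w => U r (x + (w h - w 0)))); apply: cylinder_increment; exact: bU.
  + by apply: cylinder_increment; exact: bU.
  + apply: le_trans (IHK w (h - s) r (x + (w s - w 0)) hs0 r0).
    rewrite le_eqVlt; apply/orP; left; apply/eqP; congr (K w).
    apply/funext => v; congr (U r _).
    rewrite (concat_ge _ _ (ltW sh)) concat_le// -[RHS]addrA; congr (x + _).
    by rewrite addrAC.
Qed.

End controlled_laws.

(** * Short-time estimates for linear semigroups *)

Lemma cvg_right_eps {R : realType} {V : normedModType R} (F : R -> V) (l : V) e :
  F t @[t --> 0^'+] --> l -> 0 < e ->
  exists2 d, 0 < d & forall t, 0 < t -> t < d -> `|l - F t| <= e.
Proof.
move=> /cvgrPdist_le Fl e0; have [d /= d0 h] := Fl e e0.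
exists d => // t t0 td; apply: h => //.
by rewrite /= sub0r normrN ger0_norm// ltW.
Qed.

Lemma derivable_eps {R : realType} {V : normedModType R} (F : R -> V) (t e : R) :
  derivable F t 1 -> 0 < e ->
  exists2 d, 0 < d & forall h, 0 < h -> h < d ->
    `|F (t - h) - F t + h *: derive1 F t| <= h * e.
Proof.
move=> dF e0; have /cvgrPdist_le/(_ e e0)[d /= d0 hd] :
    h^-1 *: (F (h + t) - F t) @[h --> 0^'] --> derive1 F t.
  rewrite derive1E.
  have -> : (fun h => h^-1 *: (F (h + t) - F t)) =
      (fun h => h^-1 *: ((F \o shift t) (h *: (1 : R)) - F t)).
    by apply/funext => h /=; rewrite (_ : h *: (1 : R) = h)//; exact: mulr1.
  exact: dF.
exists d => // h h0 hd'.
have := hd (- h); rewrite /= sub0r opprK gtr0_norm// => /(_ hd').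
rewrite oppr_eq0 gt_eqF// => /(_ isT); rewrite (addrC (- h)) => le_e.
have -> : F (t - h) - F t + h *: derive1 F t =
   h *: (derive1 F t - (- h)^-1 *: (F (t - h) - F t)).
  rewrite scalerBr scalerA invrN mulrN divff ?gt_eqF// scaleN1r opprK.
  by rewrite addrC.
by rewrite normrZ gtr0_norm// ler_pM2l.
Qed.

Section linear_estimates.
Context {R : realType} {G : metricZmodType R} {S : R -> BUC G -> BUC G}.
Hypotheses (HS : markovian_convolution_semigroup S)
  (linS : forall t, 0 <= t -> linear (S t)).
Local Notation T := (fun_semigroup S).
Let VB := @BUC_lattice R G.

(** Iterate the short-time bound over [n] steps of length [h / n]. The drift [b]
    grows by at most [C t] up to time [t], which adds up to at most [C h^2]. *)
Lemma semigroup_growth (g b : G -> R) (C : R) : 0 <= C -> BUC_fun g -> BUC_fun b ->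
  (forall e, 0 < e -> exists2 d, 0 < d & forall t x, 0 < t -> t < d ->
    T t g x <= g x + t * (b x + e)) ->
  (forall t x, 0 <= t -> T t b x <= b x + C * t) ->
  forall h x, 0 <= h -> T h g x <= g x + h * b x + C * h ^+ 2.
Proof.
move=> C0 bg bb short Tb h x; rewrite le_eqVlt => /predU1P[<-|h0].
  by rewrite (fun_semigroup0 HS)// mul0r expr0n/= mulr0 !addr0.
apply: le_of_eps => e e0; have [d d0 hd] := short (e / h) (divr_gt0 e0 h0).
pose n := (Num.truncn (h / d)).+1.
have n0 : (0 : R) < n%:R by rewrite ltr0n.
pose t := h / n%:R; have t0 : 0 < t by rewrite divr_gt0.
have td : t < d by rewrite ltr_pdivrMr// mulrC -ltr_pdivrMr// truncnS_gt.
have key k y : T (k%:R * t) g y <=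
    g y + k%:R * t * (b y + e / h) + C * (k%:R * t) ^+ 2.
  elim: k y => [|k IH] y.
    by rewrite !mul0r (fun_semigroup0 HS)// expr0n/= mulr0 !addr0.
  have kt0 : 0 <= k%:R * t by rewrite mulr_ge0// ltW.
  rewrite -natr1 mulrDl mul1r (fun_semigroupD HS)//; last exact: ltW.
  have PT := fun_semigroup_functional HS linS y kt0.
  have bgt : BUC_fun (fun x => t * (b x + e / h) + g x).
    by apply: (lattice_lin VB) => //; apply: (latticeD VB) => //; exact: (lattice_cst VB).
  have : T (k%:R * t) (T t g) y <= T (k%:R * t) (fun x => t * (b x + e / h) + g x) y.
    by apply: (functional_le PT) => // [|z]; [exact: BUC_fun_semigroup|rewrite addrC; exact: hd].
  rewrite (functional_lin PT)//; last by apply: (latticeD VB) => //; exact: (lattice_cst VB).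
  rewrite (functionalD PT)//; last exact: (lattice_cst VB).
  rewrite (functional_cst VB PT).
  have := Tb (k%:R * t) y kt0; rewrite -(ler_pM2l t0).
  have := IH y.
  have : 0 <= C * (k%:R * t) * t by rewrite !mulr_ge0// ltW.
  have : 0 <= C * t ^+ 2 by rewrite mulr_ge0// sqr_ge0.
  move: (k%:R * t) kt0 => s s0; rewrite !expr2; nra.
have nt : n%:R * t = h by rewrite /t mulrC divfK// gt_eqF.
have := key n x; rewrite nt mulrDr [h * (e / h)]mulrC divfK ?gt_eqF//; lra.
Qed.

Lemma generator_short (DA : set (BUC G)) (A : BUC G -> BUC G) (g : BUC G) e :
  is_generator S DA A -> DA g -> 0 < e ->
  exists2 d, 0 < d & forall t x, 0 < t -> t < d ->
    `|T t g x - g x - t * A g x| <= t * e.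
Proof.
move=> [_ /(_ g)gen] /gen{}gen e0; have [d d0 hd] := cvg_right_eps gen e0.
exists d => // t x t0 td; have /BUC_norm_leP/(_ x) := hd t t0 td.
rewrite -(ler_pM2l t0) -[X in X * `|_|](gtr0_norm t0) -normrM distrC.
congr (`|_| <= _).
rewrite /T to_BUC_val !(BUC_addE, BUC_oppE, BUC_scaleE) mulrDr mulrN mulrA divff ?gt_eqF//.
by rewrite mul1r; ring.
Qed.

Lemma fun_semigroup_strong f e : BUC_fun f -> 0 < e ->
  exists2 d, 0 < d & forall t x, 0 < t -> t < d -> `|T t f x - f x| <= e.
Proof.
move=> bf e0; have [_ _ _ /(_ (to_BUC f))/cvg_right_eps/(_ e0)[d d0 hd]] := HS.
exists d => // t x t0 td; have := hd t t0 td.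
rewrite sub0r normrN normr_id => /BUC_norm_leP/(_ x).
by rewrite BUC_addE BUC_oppE to_BUCE.
Qed.

Lemma fun_semigroupN t f x : 0 <= t -> BUC_fun f ->
  T t (fun y => - f y) x = - T t f x.
Proof.
move=> t0 bf; have PT := fun_semigroup_functional HS linS x t0.
rewrite -mulN1r -(functionalZ VB PT)//; apply: (eq_functional (I := fun f => T t f x)) => y.
by rewrite mulN1r.
Qed.

Lemma semigroup_lipschitz (DA : set (BUC G)) (A : BUC G -> BUC G) (g : BUC G) C :
  is_generator S DA A -> DA g -> (forall x, `|A g x| <= C) ->
  forall h x, 0 <= h -> `|T h g x - g x| <= C * h.
Proof.
move=> gen Dg AC h x h0.
have bg : BUC_fun (g : G -> R) := BUCP g.
have up : T h g x <= g x + h * C + 0 * h ^+ 2.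
  apply: (semigroup_growth (b := fun=> C)) => //; first exact: (lattice_cst VB).
    move=> e /(generator_short gen Dg)[d d0 hd]; exists d => // t y t0 td.
    have := hd t y t0 td; rewrite ler_norml => /andP[_].
    have := AC y; rewrite ler_norml => /andP[_]; rewrite -(ler_pM2l t0); lra.
  by move=> t y t0; rewrite (fun_semigroup_cst HS linS)// mul0r addr0.
have lo : T h (fun y => - g y) x <= - g x + h * C + 0 * h ^+ 2.
  apply: (semigroup_growth (b := fun=> C)) => //; [exact: (latticeN VB)|exact: (lattice_cst VB)| |].
    move=> e /(generator_short gen Dg)[d d0 hd]; exists d => // t y t0 td.
    have := hd t y t0 td; rewrite ler_norml => /andP[+ _].
    have := AC y; rewrite ler_norml => /andP[+ _]; rewrite -(ler_pM2l t0).
    rewrite fun_semigroupN ?(ltW t0)//; lra.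
  by move=> t y t0; rewrite (fun_semigroup_cst HS linS)// mul0r addr0.
move: lo; rewrite fun_semigroupN// ler_norml => lo.
by apply/andP; split; lra.
Qed.

End linear_estimates.

(** * The nonlinear semigroup and its viscosity solutions *)

Section nonlinear_semigroup.
Context {R : realType} {G : metricZmodType R} {Lambda : Type}
  {S : Lambda -> R -> BUC G -> BUC G}.
Hypotheses (sepG : separable_space G) (complG : complete_space G).
Hypotheses (HS : forall l, markovian_convolution_semigroup (S l))
  (linS : forall l t, 0 <= t -> linear (S l t)).
Variable l0 : Lambda.
Local Notation W := (R -> G).
Let VL := @cylinder_lattice R G.
Let VB := @BUC_lattice R G.
Local Notation T l := (fun_semigroup (S l)).
Local Notation up := (@upper R G Lambda S).

Definition upper_semigroup t (f : G -> R) (x : G) : R :=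
  up (fun w => f (x + (w t - w 0))).
Local Notation U := upper_semigroup.
Let cyl t f x : BUC_fun f -> cylinder (fun w : W => f (x + (w t - w 0))) :=
  @cylinder_increment _ _ f t x.

Lemma upper_semigroup_le t f g x : BUC_fun f -> BUC_fun g ->
  (forall y, f y <= g y) -> U t f x <= U t g x.
Proof.
by move=> bf bg fg; apply: (upper_mono sepG complG HS linS l0); [exact: cyl..|].
Qed.

Lemma upper_semigroup_dist t f g e x : BUC_fun f -> BUC_fun g ->
  (forall y, `|f y - g y| <= e) -> `|U t f x - U t g x| <= e.
Proof.
by move=> bf bg fg; apply: (upper_dist sepG complG HS linS l0); [exact: cyl..|].
Qed.

Lemma upper_semigroupD t f g x : BUC_fun f -> BUC_fun g ->
  U t (fun y => f y + g y) x <= U t f x + U t g x.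
Proof. by move=> bf bg; apply: (upperD sepG complG HS linS l0); exact: cyl. Qed.

Lemma upper_semigroupZ t a f x : 0 <= a -> BUC_fun f ->
  U t (fun y => a * f y) x = a * U t f x.
Proof. by move=> a0 bf; apply: (upperZ sepG complG HS linS l0) => //; exact: cyl. Qed.

Lemma upper_semigroup_cst t a x : U t (fun=> a) x = a.
Proof. exact: (upper_cst sepG complG HS linS l0). Qed.

Lemma BUC_fun_upper_semigroup t f : BUC_fun f -> BUC_fun (U t f).
Proof.
move=> bf; have [[M fM] uf] := is_BUCP _ bf; apply: BUC_fun_intro => [|e /uf[d d0 hd]].
  by exists M => x; apply: (upper_bound sepG complG HS linS l0); [exact: cyl|].
exists d => // x y xy; apply: (upper_dist sepG complG HS linS l0); [exact: cyl..|].
by move=> w; apply/ltW/hd; rewrite gdistDr.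
Qed.

Lemma upper_semigroup0 f x : U 0 f x = f x.
Proof.
rewrite /U (_ : (fun w : W => _) = fun=> f x).
  exact: (upper_cst sepG complG HS linS l0).
by apply/funext => w; rewrite subrr addr0.
Qed.

Lemma upper_semigroup_add s t f x : 0 <= s -> 0 <= t -> BUC_fun f ->
  U (s + t) f x = U s (U t f) x.
Proof.
move=> s0 t0 bf.
rewrite /U (dynamic_programming sepG complG HS linS l0 s0 (cyl (s + t) x bf)).
congr up; apply/funext => w; congr up; apply/funext => v.
rewrite concat_ge ?lerDl// concat_le// (_ : s + t - s = t); last by ring.
congr f.
by rewrite -[RHS]addrA; congr (x + _); rewrite addrAC.
Qed.

Lemma upper_semigroup_ge l t f x : 0 <= t -> BUC_fun f -> T l t f x <= U t f x.
Proof.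
move=> t0 bf; rewrite -(path_mean_increment (HS l) (@linS l))//.
by apply: (upper_ge sepG complG HS linS l0); [exact: controlled_base|exact: cyl].
Qed.

(** The nonlinear semigroup lies below every common supersolution of the linear
    ones. *)
Lemma upper_semigroup_supersolution (V : R -> G -> R) :
  (forall r, 0 <= r -> BUC_fun (V r)) ->
  (forall l h r x, 0 <= h -> 0 <= r -> T l h (V r) x <= V (r + h) x) ->
  forall h x, 0 <= h -> U h (V 0) x <= V h x.
Proof.
move=> bV SV h x h0; apply: (upper_le l0) => Q cQ.
have := controlled_supersolution sepG complG HS linS bV SV cQ x h0 (lexx 0).
by rewrite add0r.
Qed.

Section generators.
Context {DA : Lambda -> set (BUC G)} {A : Lambda -> BUC G -> BUC G}.
Hypotheses (genA : forall l, is_generator (S l) (DA l) (A l))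
  (dD : dense (common_domain DA A)).
Let Lambda0 : [set: Lambda] !=set0. Proof. by exists l0. Qed.
Local Notation D := (common_domain DA A).

Lemma common_domain_bound g : D g -> exists2 C, 0 <= C & forall l x, `|A l g x| <= C.
Proof.
move=> [_ [N [_ NA]] _].
have {}NA := NA (`|N| + 1) (le_lt_trans (ler_norm N) (ltr_pwDr ltr01 (lexx _))).
exists (`|N| + 1); first by rewrite addr_ge0.
move=> l x; rewrite (le_trans (BUC_norm_ub _ x))//.
by apply: NA; exists l.
Qed.

Lemma le_sup_gen l g x : D g -> A l g x <= sup_gen A g x.
Proof.
move=> Dg; rewrite (sup_genE _ Lambda0 Dg); apply: sup_upper_bound; last by exists l.
have [C _ AC] := common_domain_bound Dg.
split; first by exists (A l g x), l.
by exists C => _ [k _ <-]; rewrite (le_trans (ler_norm _)).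
Qed.

Lemma sup_gen_le g x a : D g -> (forall l, A l g x <= a) -> sup_gen A g x <= a.
Proof.
move=> Dg Aa; rewrite (sup_genE _ Lambda0 Dg); apply: ge_sup => [|_ [l _ <-]//].
by exists (A l0 g x), l0.
Qed.

(** The bounds for the linear semigroups are uniform in [l] because the [A_l g]
    are uniformly bounded; they make [g + C r] a common supersolution. *)
Lemma upper_semigroup_lipschitz g : D g -> exists2 C, 0 <= C &
  forall h x, 0 <= h -> (forall l, `|T l h g x - g x| <= C * h) /\
    `|U h g x - g x| <= C * h.
Proof.
move=> Dg; have [C C0 AC] := common_domain_bound Dg; exists C => // h x h0.
have lip l h' y : 0 <= h' -> `|T l h' g y - g y| <= C * h'.
  by have [/(_ l) Dl _ _] := Dg; exact: (semigroup_lipschitz (HS l) (@linS l) (genA l)).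
split=> [l|]; first exact: lip.
have bg : BUC_fun (g : G -> R) := BUCP g.
have bV r : BUC_fun (fun y => g y + C * r) by apply: (latticeD VB) => //; exact: (lattice_cst VB).
have : U h (fun y => g y + C * 0) x <= g x + C * h.
  apply: (@upper_semigroup_supersolution (fun r y => g y + C * r)) => // l k r y k0 r0.
  have PT := fun_semigroup_functional (HS l) (@linS l) y k0.
  rewrite (functionalD PT)//; last exact: (lattice_cst VB).
  rewrite (functional_cst VB PT).
  by have := lip l k y k0; rewrite ler_norml => /andP[_]; lra.
under eq_fun do rewrite mulr0 addr0.
have := lip l0 h x h0; have := upper_semigroup_ge l0 x h0 bg.
by rewrite !ler_norml => ? /andP[? ?] ?; apply/andP; split; lra.
Qed.

Lemma dense_common_domain (f : BUC G) e : 0 < e ->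
  exists2 g, D g & forall x, `|f x - g x| <= e.
Proof.
move=> e0; have [||g [Bg Dg]] := dD (O := (ball f e)^°).
- by exists f; exact: nbhsx_ballx.
- exact: open_interior.
exists g => // x; have /interior_subset := Bg; rewrite -ball_normE /= => /ltW.
by move=> /BUC_norm_leP/(_ x).
Qed.

Lemma upper_semigroup_strong f e : BUC_fun f -> 0 < e ->
  exists2 d, 0 < d & forall h x, 0 <= h -> h < d -> `|U h f x - f x| <= e.
Proof.
move=> bf e0; have e30 : 0 < e / 3 by lra.
have [g Dg fg] := dense_common_domain (to_BUC f) e30.
have [C C0 hC] := upper_semigroup_lipschitz Dg.
have C1 : 0 < C + 1 by lra.
exists (e / 3 / (C + 1)) => [|h x h0 hd]; first by rewrite divr_gt0.
have bg : BUC_fun (g : G -> R) := BUCP g.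
have fg' y : `|f y - g y| <= e / 3 by have := fg y; rewrite to_BUCE.
have := upper_semigroup_dist h x bf bg fg'.
have := fg' x; have [_] := hC h x h0.
have : C * h <= e / 3.
  by move: hd; rewrite ltr_pdivlMr// => hd; nra.
by rewrite !ler_norml => ? /andP[? ?] /andP[? ?] /andP[? ?]; apply/andP; split; lra.
Qed.

(** The function [sup_gen A g] need not be in the domain [D], but density gives [a]
    in [D] at distance at most [e / 2]; then [b = a + e / 2] dominates every
    [A_l g] and grows at most linearly in time under every [S l]. *)
Lemma upper_semigroup_growth g e : D g -> 0 < e -> exists2 C, 0 <= C &
  forall h x, 0 <= h -> U h g x <= g x + h * (sup_gen A g x + e) + C * h ^+ 2.
Proof.
move=> Dg e0; have e20 : 0 < e / 2 by lra.
have [a Da aP] := dense_common_domain (sup_gen A g) e20.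
have [C C0 hC] := upper_semigroup_lipschitz Da; exists C => // h x h0.
have bg : BUC_fun (g : G -> R) := BUCP g.
have ba : BUC_fun (a : G -> R) := BUCP a.
(* [A_l g <= b <= sup_gen A g + e] for every [l] *)
pose b y := a y + e / 2.
have bb : BUC_fun b by apply: (latticeD VB) => //; exact: (lattice_cst VB).
have bV r : BUC_fun (fun y => g y + r * b y + C * r ^+ 2).
  by apply: (latticeD VB); [apply: (latticeD VB) => //; exact: (latticeZ VB)|exact: (lattice_cst VB)].
have Tb l t y : 0 <= t -> T l t b y <= b y + C * t.
  move=> t0; have PT := fun_semigroup_functional (HS l) (@linS l) y t0.
  rewrite (functionalD PT)//; last exact: (lattice_cst VB).
  rewrite (functional_cst VB PT) /b; have [/(_ l) + _] := hC t y t0.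
  by rewrite ler_norml => /andP[_]; lra.
have Tg l t y : 0 <= t -> T l t g y <= g y + t * b y + C * t ^+ 2.
  have [/(_ l) Dl _ _] := Dg.
  apply: (semigroup_growth (HS l) (@linS l)) => // [d d0|t' y' t'0]; last exact: Tb.
  have [k k0 hk] := generator_short (genA l) Dl d0; exists k => // t' z t'0 t'k.
  have Ab : A l g z <= b z.
    have := aP z; rewrite ler_norml => /andP[_].
    by have := le_sup_gen l z Dg; rewrite /b; lra.
  have := hk t' z t'0 t'k; rewrite ler_norml => /andP[_].
  by have := ler_wpM2l (ltW t'0) Ab; move: (b z) => c; lra.
have : U h (fun y => g y + 0 * b y + C * 0 ^+ 2) x <= g x + h * b x + C * h ^+ 2.
  apply: (@upper_semigroup_supersolution (fun r y => g y + r * b y + C * r ^+ 2)) => // l k r y k0 r0.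
  have PT := fun_semigroup_functional (HS l) (@linS l) y k0.
  rewrite (functionalD PT); [|by apply: (latticeD VB) => //; exact: (latticeZ VB)|exact: (lattice_cst VB)].
  rewrite (functional_cst VB PT) (functionalD PT)//; last exact: (latticeZ VB).
  rewrite (functionalZ VB PT)//.
  have := Tg l k y k0; have := ler_wpM2l r0 (Tb l k y k0).
  have : 0 <= C * k * r by rewrite !mulr_ge0.
  by rewrite !expr2; nra.
under eq_fun do rewrite mul0r expr0n/= mulr0 !addr0.
move=> /le_trans; apply; rewrite lerD2r lerD2l ler_wpM2l// /b.
by have := aP x; rewrite ler_norml => /andP[+ _]; lra.
Qed.

Variable f : BUC G.

(** Constant for negative times, which makes it continuous on the whole line. *)
Definition value_function (t : R) : BUC G := to_BUC (U (Num.max 0 t) f).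

Let bf : BUC_fun (f : G -> R). Proof. exact: BUCP. Qed.

Lemma value_functionE t x : 0 <= t -> value_function t x = U t f x.
Proof.
move=> t0; rewrite /value_function to_BUCE; last exact: BUC_fun_upper_semigroup.
by rewrite max_r.
Qed.

Lemma value_function_step h t x : 0 <= h -> h <= t ->
  value_function t x = U h (value_function (t - h)) x.
Proof.
move=> h0 ht; have th0 : 0 <= t - h by rewrite subr_ge0.
rewrite value_functionE ?(le_trans h0)//.
rewrite (_ : (value_function (t - h) : G -> R) = U (t - h) f); last first.
  by apply/funext => y; rewrite value_functionE.
by rewrite -upper_semigroup_add// subrKC.
Qed.

Lemma continuous_value_function : continuous value_function.
Proof.
move=> t; apply/cvgrPdist_le => e e0.
have [d d0 hd] := upper_semigroup_strong bf e0.
have close s r x : 0 <= s -> s <= r -> r - s < d -> `|U r f x - U s f x| <= e.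
  move=> s0 sr rsd; have rs0 : 0 <= r - s by rewrite subr_ge0.
  rewrite -(subrKC s r) upper_semigroup_add//.
  apply: upper_semigroup_dist => //; first exact: BUC_fun_upper_semigroup.
  by move=> y; apply: hd.
exists d => //= s; rewrite /ball /= => ts.
apply/BUC_norm_leP => x; rewrite BUC_addE BUC_oppE /value_function.
rewrite !to_BUCE; try exact: BUC_fun_upper_semigroup.
have m0 (r : R) : 0 <= Num.max 0 r by rewrite le_max lexx.
have : `|Num.max 0 t - Num.max 0 s| < d.
  move: ts; rewrite !ltr_norml /Num.max => /andP[? ?].
  by case: (ltP 0 t) => ?; case: (ltP 0 s) => ?; apply/andP; split; lra.
have [le_st|lt_ts] := leP (Num.max 0 s) (Num.max 0 t).
  by rewrite ger0_norm ?subr_ge0// => h; exact: close.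
by rewrite distrC gtr0_norm ?subr_gt0// distrC => h; apply: close => //; exact: ltW.
Qed.

(** On a short interval, [u(t) = U h (u(t - h)) <= U h (psi(t - h))], and
    [psi(t - h)] is [psi(t) - h psi'(t)] up to a small multiple of [h]. By
    sublinearity it remains to bound the growth of [psi(t)] itself, which is
    [upper_semigroup_growth]. *)
Lemma value_function_subsolution :
  viscosity_subsolution D (sup_gen A) value_function.
Proof.
split; first exact/continuous_subspaceT/continuous_value_function.
move=> t x t0 psi dpsi psitx upsi Dpsi; apply: le_of_eps => e e0.
have e50 : 0 < e / 5 by lra.
have [d1 d10 h1] := derivable_eps (dpsi t t0) e50.
have bpsi s : BUC_fun (psi s : G -> R) := BUCP (psi s).
have bN : BUC_fun (fun y => - derive1 psi t y) by apply: (latticeN VB); exact: BUCP.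
have [d2 d20 h2] := upper_semigroup_strong bN e50.
have [C C0 h3] := upper_semigroup_growth (Dpsi t t0) e50.
have C1 : 0 < C + 1 by lra.
(* five error terms of size [h e / 5], the last one from [C h^2] *)
pose h := Num.min (Num.min (d1 / 2) (d2 / 2)) (Num.min t (e / 5 / (C + 1)) / 2).
have h0 : 0 < h.
  have m0 : 0 < Num.min t (e / 5 / (C + 1)) by rewrite lt_min t0 !divr_gt0.
  by rewrite /h !lt_min !divr_gt0.
have hd1 : h < d1.
  by rewrite /h !gt_min; apply/orP; left; apply/orP; left; lra.
have hd2 : h < d2.
  by rewrite /h !gt_min; apply/orP; left; apply/orP; right; lra.
have h_lt : h < Num.min t (e / 5 / (C + 1)).
  rewrite /h gt_min; apply/orP; right.
  have : 0 < Num.min t (e / 5 / (C + 1)) by rewrite lt_min t0 divr_gt0.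
  lra.
move: h_lt; rewrite lt_min => /andP[ht hC].
have Ch : C * h <= e / 5 by move: hC; rewrite ltr_pdivlMr//; nra.
have th0 : 0 < t - h by rewrite subr_gt0.
have bm : BUC_fun (fun y => psi t y + (h * (- derive1 psi t y) + h * (e / 5))).
  apply: (latticeD VB) => //; apply: (latticeD VB); last exact: (lattice_cst VB).
  exact: (latticeZ VB).
have psi_th y : psi (t - h) y <= psi t y + (h * (- derive1 psi t y) + h * (e / 5)).
  have /BUC_norm_leP/(_ y) := h1 h h0 hd1.
  by rewrite !(BUC_addE, BUC_oppE, BUC_scaleE) ler_norml => /andP[_]; lra.
pose m1 y := h * (- derive1 psi t y).
pose m2 y := m1 y + h * (e / 5).
pose m y := psi t y + m2 y.
have bm1 : BUC_fun m1 by exact: (latticeZ VB).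
have bm2 : BUC_fun m2 by apply: (latticeD VB) => //; exact: (lattice_cst VB).
have i5 : psi t x <= U h m x.
  rewrite psitx (value_function_step x (ltW h0) (ltW ht)).
  apply: upper_semigroup_le => //; first exact: BUCP.
  by move=> y; rewrite (le_trans (upsi _ th0 y)).
have i4 : U h m x <= U h (psi t) x + U h m2 x by exact: upper_semigroupD.
have i3 : U h m2 x <= h * U h (fun y => - derive1 psi t y) x + h * (e / 5).
  rewrite -upper_semigroupZ ?(ltW h0)// -[X in _ <= _ + X](upper_semigroup_cst h _ x).
  by apply: upper_semigroupD => //; exact: (lattice_cst VB).
have := h2 h x (ltW h0) hd2; rewrite ler_norml => /andP[_ i2].
have i1 := h3 h x (ltW h0).
move: i1 i2 i3 i4 i5; set a := sup_gen A _ _; set p := derive1 psi t x.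
move: (U h m x) (U h m2 x) (U h _ x) (U h _ x) (psi t x) => u4 u3 u2 u1 v i1 i2 i3 i4 i5.
have i2' : h * u2 <= h * (e / 5 - p) by rewrite ler_pM2l//; lra.
have Ch2 : C * h ^+ 2 <= h * (e / 5) by rewrite expr2 mulrA mulrC ler_pM2l.
have he : 0 < h * e by rewrite mulr_gt0.
have : h * p <= h * (a + e) by lra.
by rewrite ler_pM2l.
Qed.

(** As for the subsolution, but from below a single linear semigroup suffices:
    [u(t) >= T l h (psi(t - h))] for each [l]. *)
Lemma value_function_supersolution :
  viscosity_supersolution D (sup_gen A) value_function.
Proof.
split; first exact/continuous_subspaceT/continuous_value_function.
move=> t x t0 psi dpsi psitx upsi Dpsi; apply: sup_gen_le => [|l]; first exact: Dpsi.
apply: le_of_eps => e e0; have e50 : 0 < e / 5 by lra.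
have [d1 d10 h1] := derivable_eps (dpsi t t0) e50.
have bpsi s : BUC_fun (psi s : G -> R) := BUCP (psi s).
have bN : BUC_fun (fun y => - derive1 psi t y) by apply: (latticeN VB); exact: BUCP.
have [d2 d20 h2] := fun_semigroup_strong (HS l) bN e50.
have Dl : DA l (psi t) by have [] := Dpsi t t0.
have [d3 d30 h3] := generator_short (genA l) Dl e50.
pose h := Num.min (Num.min (d1 / 2) (d2 / 2)) (Num.min (t / 2) (d3 / 2)).
have h0 : 0 < h by rewrite /h !lt_min !divr_gt0.
have hd1 : h < d1.
  by rewrite /h !gt_min; apply/orP; left; apply/orP; left; lra.
have hd2 : h < d2.
  by rewrite /h !gt_min; apply/orP; left; apply/orP; right; lra.
have ht : h < t.
  by rewrite /h !gt_min; apply/orP; right; apply/orP; left; lra.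
have hd3 : h < d3.
  by rewrite /h !gt_min; apply/orP; right; apply/orP; right; lra.
have th0 : 0 < t - h by rewrite subr_gt0.
pose m y := psi t y + (h * (- derive1 psi t y) + - (h * (e / 5))).
have bN' : BUC_fun (fun y => h * (- derive1 psi t y)) by exact: (latticeZ VB).
have bm' : BUC_fun (fun y => h * (- derive1 psi t y) + - (h * (e / 5))).
  by apply: (latticeD VB) => //; exact: (lattice_cst VB).
have bm : BUC_fun m by exact: (latticeD VB).
have psi_th y : m y <= psi (t - h) y.
  have /BUC_norm_leP/(_ y) := h1 h h0 hd1.
  by rewrite /m !(BUC_addE, BUC_oppE, BUC_scaleE) ler_norml => /andP[+ _]; lra.
have : T l h m x <= psi t x.
  rewrite psitx (value_function_step x (ltW h0) (ltW ht)).
  apply: (@le_trans _ _ (U h m x)); first by apply: upper_semigroup_ge => //; exact: ltW.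
  apply: upper_semigroup_le => //; first exact: BUCP.
  by move=> y; rewrite (le_trans (psi_th y))// upsi.
have PT := fun_semigroup_functional (HS l) (@linS l) x (ltW h0).
rewrite (functionalD PT)// (functionalD PT)//; last exact: (lattice_cst VB).
rewrite (functional_cst VB PT) (functionalZ VB PT)//.
have := h2 h x h0 hd2; have := h3 h x h0 hd3.
rewrite !ler_norml => /andP[i1 _] /andP[i2 _].
move: i1 i2; set a := A _ _ _; set p := derive1 psi t x.
move: (T l h (fun y => - _) x) (T l h _ x) (psi t x) => u2 u1 v i1 i2 i3.
have i2' : h * (- p - e / 5) <= h * u2 by rewrite ler_pM2l//; lra.
have he : 0 < h * e by rewrite mulr_gt0.
have : h * a <= h * (p + e) by lra.
by rewrite ler_pM2l.
Qed.

End generators.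
End nonlinear_semigroup.

(** * Upper expectations and inf-convolutions *)

Section upper_expectations.
Context {R : realType} d {T : measurableType d} (PP : set (probability T R)).
Hypothesis PP0 : PP !=set0.
Implicit Types X Y : T -> R.

Definition sup_mean Y : R := sup [set mean P Y | P in PP].

Lemma has_sup_mean Y : bounded_measurable Y -> has_sup [set mean P Y | P in PP].
Proof.
move=> bY; split; first by have [P PPP] := PP0; exists (mean P Y), P.
have [M YM] := (bounded_funP Y).1 bY.2; exists M => _ [P _ <-].
rewrite -(mean_cst P M); apply: mean_le => // [|x]; first exact: bounded_measurable_cst.
by rewrite (le_trans (ler_norm _)).
Qed.

Lemma sup_mean_ge P Y : PP P -> bounded_measurable Y -> mean P Y <= sup_mean Y.
Proof. by move=> PPP bY; apply: sup_upper_bound; [exact: has_sup_mean|exists P]. Qed.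

Lemma sup_mean_le Y a : (forall P, PP P -> mean P Y <= a) -> sup_mean Y <= a.
Proof.
move=> h; apply: ge_sup => [|_ [P PPP <-]]; last exact: h.
by have [P PPP] := PP0; exists (mean P Y), P.
Qed.

Lemma sup_mean_mono X Y : bounded_measurable X -> bounded_measurable Y ->
  (forall x, X x <= Y x) -> sup_mean X <= sup_mean Y.
Proof.
move=> bX bY XY; apply: sup_mean_le => P PPP.
exact: le_trans (mean_le P bX bY XY) (sup_mean_ge PPP bY).
Qed.

Lemma sup_mean_cst a : sup_mean (fun=> a) = a.
Proof.
rewrite /sup_mean (_ : [set mean P (fun=> a) | P in PP] = [set a]) ?sup1//.
apply/seteqP; split=> [_ [P _ <-]|_ ->]; first by rewrite mean_cst.
by have [P PPP] := PP0; exists P => //; rewrite mean_cst.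
Qed.

Lemma sup_meanE Y : bounded_measurable Y ->
  (sup_mean Y)%:E = ereal_sup [set 'E_P[Y]%E | P in PP].
Proof.
move=> bY; have [S0 S1] := has_sup_mean bY.
rewrite -ereal_sup_EFin//; congr ereal_sup.
apply/seteqP; split=> [_ [_ [P PPP <-] <-]|_ [P PPP <-]].
  by exists P; rewrite ?meanE.
by exists (mean P Y); rewrite ?meanE//; exists P.
Qed.

Lemma sup_mean_cvg_below (F : nat -> T -> R) Y :
  (forall n, bounded_measurable (F n)) -> bounded_measurable Y ->
  (forall x, nondecreasing_seq (F ^~ x)) ->
  (forall x, F n x @[n --> \oo] --> Y x) ->
  sup_mean (F n) @[n --> \oo] --> sup_mean Y.
Proof.
move=> bF bY Fm FY; apply/cvgrPdist_le => e e0.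
have e20 : 0 < e / 2 by lra.
have [_ [P PPP <-] hP] := sup_adherent e20 (has_sup_mean bY).
have /cvgrPdist_le/(_ _ e20)[n _ hn] := mean_cvg_below (P := P) bF bY Fm FY.
have FleY k x : F k x <= Y x.
  by have := nondecreasing_cvgn_le (Fm x) (cvgP _ (FY x)) k; rewrite (cvg_lim _ (FY x)).
exists n => // k /= nk; have := hn k nk; rewrite !ler_norml => /andP[_].
have := sup_mean_ge PPP (bF k); have := sup_mean_mono (bF k) bY (FleY k).
by move: hP; rewrite -/(sup_mean Y) => ? ? ? ?; apply/andP; split; lra.
Qed.

Lemma sublinear_sup_mean : sublinear_expectation_space sup_mean.
Proof.
split; first split; first split.
- exact: sup_mean_mono.
- by move=> a X bX Xa; rewrite -(sup_mean_cst a); congr sup_mean; apply/funext.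
- move=> l X Y Z /andP[l0 l1] bX bY bZ ZE; apply: sup_mean_le => P PPP.
  have q0 : 0 <= 1 - l by lra.
  have -> : Z = fun x => l * X x + ((1 - l) * Y x + 0).
    by apply/funext => x; rewrite ZE addr0.
  have b0 := bounded_measurable_cst T (0 : R).
  rewrite mean_lin//; last exact: bounded_measurable_lin.
  rewrite mean_lin// mean_cst addr0.
  by apply: lerD; rewrite ler_wpM2l// sup_mean_ge.
- move=> l X Y l0 bX bY YE.
  have E0 P : mean P Y = l * mean P X.
    have -> : Y = fun x => l * X x + 0 by apply/funext => x; rewrite YE addr0.
    rewrite mean_lin//; last exact: bounded_measurable_cst.
    by rewrite mean_cst addr0.
  apply/eqP; rewrite eq_le; apply/andP; split.
    by apply: sup_mean_le => P PPP; rewrite E0 ler_pM2l// sup_mean_ge.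
  rewrite -ler_pdivlMl//; apply: sup_mean_le => P PPP.
  by rewrite ler_pdivlMl// -E0 sup_mean_ge.
- move=> F Y bF bY Fm FY; split; last exact: sup_mean_cvg_below.
  by move=> n m nm; apply: sup_mean_mono => // x; exact: Fm.
Qed.

End upper_expectations.

Section inf_convolution.
Context {R : realType} {T : Type} (D : T -> T -> R).
Hypotheses (Dxx : forall x, D x x = 0) (D0 : forall x y, 0 <= D x y)
  (Dsym : forall x y, D x y = D y x)
  (Dtri : forall x y z, D x z <= D x y + D y z).
Variables (f : T -> R) (M : R).
Hypothesis fM : forall x, `|f x| <= M.

(** The largest minorant of [f] that is [n]-Lipschitz for [D]. *)
Definition inf_conv (n : nat) (x : T) : R := inf [set f y + n%:R * D x y | y in setT].

Lemma inf_conv_has n x : has_inf [set f y + n%:R * D x y | y in setT].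
Proof.
split; first by exists (f x + n%:R * D x x), x.
exists (- M) => _ [y _ <-]; have := fM y; rewrite ler_norml => /andP[h _].
by rewrite (le_trans h)// lerDl mulr_ge0.
Qed.

Lemma inf_conv_lb n x y : inf_conv n x <= f y + n%:R * D x y.
Proof. by apply: ge_inf; [exact: (inf_conv_has n x).2|exists y]. Qed.

Lemma inf_conv_ge n x a : (forall y, a <= f y + n%:R * D x y) -> a <= inf_conv n x.
Proof.
move=> h; apply: lb_le_inf; first exact: (inf_conv_has n x).1.
by move=> _ [y _ <-].
Qed.

Lemma inf_conv_le n x : inf_conv n x <= f x.
Proof. by have := inf_conv_lb n x x; rewrite Dxx mulr0 addr0. Qed.

Lemma inf_conv_bound n x : `|inf_conv n x| <= M.
Proof.
rewrite ler_norml; apply/andP; split.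
  apply: inf_conv_ge => y; have := fM y; rewrite ler_norml => /andP[h _].
  by rewrite (le_trans h)// lerDl mulr_ge0.
by rewrite (le_trans (inf_conv_le n x))// (le_trans (ler_norm _)).
Qed.

Lemma inf_conv_lip n x y : `|inf_conv n x - inf_conv n y| <= n%:R * D x y.
Proof.
have h a b : inf_conv n a <= inf_conv n b + n%:R * D a b.
  rewrite -lerBlDr; apply: inf_conv_ge => c; rewrite lerBlDr.
  rewrite (le_trans (inf_conv_lb n a c))// -addrA lerD2l -mulrDr.
  by rewrite ler_wpM2l// addrC.
have := h x y; have := h y x; rewrite (Dsym y x) => ? ?.
by rewrite ler_norml; apply/andP; split; lra.
Qed.

Lemma inf_conv_nondecreasing x : nondecreasing_seq (fun n => inf_conv n x).
Proof.
move=> n m nm; apply: inf_conv_ge => y; apply: le_trans (inf_conv_lb n x y) _.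
by rewrite lerD2l ler_wpM2r// ler_nat.
Qed.

(** Points at distance at least [d] are penalised by at least the oscillation of
    [f] once [n d >= 2 M]; nearby points are controlled by semicontinuity. *)
Lemma inf_conv_cvg x :
  (forall e, 0 < e -> exists2 d, 0 < d & forall y, D x y < d -> f x - e <= f y) ->
  inf_conv n x @[n --> \oo] --> f x.
Proof.
move=> lsc; apply/cvgrPdist_le => e e0; have [d d0 hd] := lsc e e0.
pose N := (Num.truncn (2 * M / d)).+1; exists N => // n /= Nn.
rewrite ger0_norm ?subr_ge0 ?inf_conv_le// lerBlDl -lerBlDr.
apply: inf_conv_ge => y; have [xy|xy] := ltP (D x y) d.
  by rewrite (le_trans (hd y xy))// lerDl mulr_ge0.
have Nd : 2 * M <= n%:R * D x y.
  apply: (@le_trans _ _ (n%:R * d)); last by rewrite ler_wpM2l.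
  rewrite -ler_pdivrMr// (le_trans (ltW (truncnS_gt _)))//.
  by rewrite ler_nat.
have := fM x; have := fM y; rewrite !ler_norml => /andP[? ?] /andP[? ?]; lra.
Qed.

End inf_convolution.

(** * The canonical Levy process *)

(** A separate type for paths, to carry the structure of a pointed type. *)
Definition path_space {R : realType} (G : metricZmodType R) : Type := R -> G.

HB.instance Definition _ (R : realType) (G : metricZmodType R) :=
  gen_eqMixin (path_space G).
HB.instance Definition _ (R : realType) (G : metricZmodType R) :=
  gen_choiceMixin (path_space G).
HB.instance Definition _ (R : realType) (G : metricZmodType R) :=
  isPointed.Build (path_space G) (fun=> 0).

(** The sigma-algebra generated by the cylinder functions, by construction; that
    the coordinates are Borel measurable is then seen from distance functions. *)
Definition canonical_space {R : realType} (G : metricZmodType R) :=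
  g_sigma_algebraType (@positivity_sets R (path_space G) (@cylinder R G)).

Section levy.
Context {R : realType} {G : metricZmodType R} {Lambda : Type}
  {S : Lambda -> R -> BUC G -> BUC G}.
Hypotheses (sepG : separable_space G) (complG : complete_space G).
Hypotheses (HS : forall l, markovian_convolution_semigroup (S l))
  (linS : forall l t, 0 <= t -> linear (S l t)).
Variable l0 : Lambda.
Local Notation Om := (canonical_space G).
Let VL := @cylinder_lattice R G.
Let VB := @BUC_lattice R G.
Local Notation up := (@upper R G Lambda S).

Definition control_measures : set (probability Om R) :=
  [set P | exists2 Q, @controlled R G Lambda S Q &
     forall F : Om -> R, cylinder F -> mean P F = Q F].
Local Notation PP := control_measures.
Local Notation E := (sup_mean PP).

Lemma controlled_measure Q : @controlled R G Lambda S Q ->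
  exists2 P, PP P & forall F : Om -> R, cylinder F -> mean P F = Q F.
Proof.
move=> cQ; have [PQ sQ] := controlled_functional sepG complG HS linS cQ.
have [P hP] := @daniell_stone R (path_space G) cylinder Q VL PQ sQ.
by exists P => //; exists Q.
Qed.

Lemma control_measures_nonempty : PP !=set0.
Proof. by have [P PPP _] := controlled_measure (controlled_base (S := S) l0); exists P. Qed.
Let PP0 := control_measures_nonempty.

Lemma bounded_measurable_cylinder (F : Om -> R) : cylinder F -> bounded_measurable F.
Proof. exact: (@bounded_measurable_lattice R (path_space G) cylinder VL). Qed.

Lemma sup_mean_cylinder (F : Om -> R) : cylinder F -> E F = up F.
Proof.
move=> cF; congr sup; apply/seteqP; split=> [_ [P [Q cQ h] <-]|_ [Q cQ ->]].
  by exists Q => //; exact: h.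
by have [P PPP h] := controlled_measure cQ; exists P => //; exact: h.
Qed.

(** Subtracting the value at time 0 makes the process start at 0 on every path. *)
Definition canonical_process (t : R) (w : Om) : G :=
  (w : R -> G) t - (w : R -> G) 0.
Local Notation X := canonical_process.

Lemma increment_process s t (w : Om) : X (s + t) w - X s w =
  (w : R -> G) (s + t) - (w : R -> G) s.
Proof. by rewrite /X opprB addrA subrK. Qed.

Lemma cylinder_lipschitz (F : Om -> R) (sigma : seq R) (K : R) :
  (exists M, forall w, `|F w| <= M) ->
  (forall d w v, 0 < d -> near_on sigma d w v -> `|F w - F v| <= K * d) ->
  cylinder F.
Proof.
move=> bF lF; split=> //; exists sigma => e e0.
have K1 : 0 < `|K| + 1 by rewrite ltr_wpDl.
exists (e / (`|K| + 1)) => [|w v wv]; first by rewrite divr_gt0.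
have d0 : 0 < e / (`|K| + 1) by rewrite divr_gt0.
apply: le_trans (lF _ _ _ d0 wv) _.
apply: (@le_trans _ _ ((`|K| + 1) * (e / (`|K| + 1)))).
  by rewrite ler_pM2r// (le_trans (ler_norm _))// lerDl.
by rewrite mulrC divfK// gt_eqF.
Qed.

Lemma near_on_process (sigma : seq R) d (w v : Om) t : 0 \in sigma -> t \in sigma ->
  near_on sigma d (w : R -> G) v -> gdist (X t w) (X t v) <= 2 * d.
Proof.
move=> s0 st wv; rewrite (le_trans (gdistB _ _ _ _))//.
by have := wv 0 s0; have := wv t st; lra.
Qed.

Lemma BUC_fun_lipschitz (g : G -> R) K : (exists M, forall x, `|g x| <= M) ->
  (forall x y, `|g x - g y| <= K * gdist x y) -> BUC_fun g.
Proof.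
move=> bg lg; apply: BUC_fun_intro => // e e0.
have K1 : 0 < `|K| + 1 by rewrite ltr_wpDl.
exists (e / (`|K| + 1)) => [|x y]; first by rewrite divr_gt0.
rewrite ltr_pdivlMr// => xy; rewrite (le_trans (lg x y))//.
apply: le_trans (ltW xy); rewrite mulrC ler_wpM2l ?gdist_ge0//.
by rewrite (le_trans (ler_norm _))// lerDl.
Qed.

(** Inf-convolution of the indicator of an open set [U] gives a uniformly
    continuous function that is positive exactly on [U]. *)
Lemma measurable_process t : borel_measurable (X t).
Proof.
suff op (U : set G) : open U -> measurable (X t @^-1` U).
  move=> B; pose mX := [set B : set G | measurable (X t @^-1` B)].
  suff : <<s @open G >> `<=` mX by exact.
  apply: smallest_sub => //; split.
  - by rewrite /mX/= preimage_set0; exact: measurable0.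
  - by move=> A mA; rewrite /mX/= setTD preimage_setC; exact: measurableC.
  - by move=> A mA; rewrite /mX/= preimage_bigcup; apply: bigcup_measurable => k _; exact: mA.
move=> oU; pose h : G -> R := inf_conv (fun x y => gdist x y) \1_U 1.
have i1 y : `|\1_U y : R| <= 1 by rewrite indicE ger0_norm// lern1 leq_b1.
have bh : BUC_fun h.
  apply: (@BUC_fun_lipschitz _ 1) => [|x y].
    by exists 1 => x; exact: (inf_conv_bound (@gdistxx _ _) (@gdist_ge0 _ _) i1).
  exact: (inf_conv_lip (@gdist_ge0 _ _) (@gdist_sym _ _)
    (fun x y z => gdist_triangle y x z) i1).
have -> : X t @^-1` U = [set w | 0 < h (0 + ((w : R -> G) t - (w : R -> G) 0))].
  apply/seteqP; split=> w; rewrite /= add0r -/(X t w); set x := X t w.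
    move=> Ux; have /nbhs_gdistP[d d0 hd] : nbhs x U by exact: open_nbhs_nbhs.
    apply: (@lt_le_trans _ _ (Num.min 1 d)); first by rewrite lt_min ltr01.
    apply: (inf_conv_ge (@gdist_ge0 _ _) i1) => y; rewrite mul1r indicE.
    have [/hd Uy|dy] := ltP (gdist x y) d.
      by rewrite mem_set//= ge_min lerDl gdist_ge0.
    by rewrite ge_min (le_trans dy)?orbT// lerDr.
  move=> hx; apply: contrapT => nU; move: hx.
  have := inf_conv_le (@gdistxx _ _) (@gdist_ge0 _ _) i1 1 x.
  by rewrite indicE memNset//= -/h -/(h x) => /le_lt_trans h1 /h1; rewrite ltxx.
apply: (@measurable_positivity R (path_space G) cylinder).
exact: cylinder_increment.
Qed.

Section approximation.
Context {T : Type} (D : T -> T -> R).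
Hypotheses (Dxx : forall x, D x x = 0) (D0 : forall x y, 0 <= D x y)
  (Dsym : forall x y, D x y = D y x)
  (Dtri : forall x y z, D x z <= D x y + D y z).
Context (f : T -> R) (M : R).
Hypotheses (fM : forall x, `|f x| <= M)
  (cf : forall x e, 0 < e -> exists2 d, 0 < d &
     forall y, D x y < d -> f x - e <= f y).
Local Notation f_ := (inf_conv D f).

(** Identities for upper expectations need only be checked on the Lipschitz
    minorants of [f], which increase to [f]. *)
Lemma sup_mean_approximation (Z : Om -> T) :
  (forall n, cylinder (fun w => f_ n (Z w))) ->
  bounded_measurable (f \o Z) /\
  E (fun w => f_ n (Z w)) @[n --> \oo] --> E (f \o Z).
Proof.
move=> cZ; have bZ n := bounded_measurable_cylinder (cZ n).
have fcvg w : f_ n (Z w) @[n --> \oo] --> f (Z w).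
  exact: (inf_conv_cvg Dxx D0 fM (@cf (Z w))).
have bf : bounded_measurable (f \o Z).
  split; last by apply/bounded_funP; exists M => w; exact: fM.
  apply: (measurable_fun_cvg (h := fun n w => f_ n (Z w))) => [n|w _ /=].
    exact: (bZ n).1.
  exact: fcvg.
split=> //; apply: (sup_mean_cvg_below PP0) => // w.
exact: (inf_conv_nondecreasing D0 fM).
Qed.

End approximation.

Lemma Cb_gdist (f : G -> R) : Cb f -> forall x e, 0 < e ->
  exists2 d, 0 < d & forall y, gdist x y < d -> `|f x - f y| <= e.
Proof.
move=> [cf _] x e e0; have /cvgrPdist_le/(_ e e0) := cf x.
by move=> /nbhs_gdistP[d d0 hd]; exists d.
Qed.

Lemma cylinder_shifted_increment (g : G -> R) s t : BUC_fun g ->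
  cylinder (fun w : Om => g (X (s + t) w - X s w)).
Proof.
move=> bg; have [bdg ug] := is_BUCP _ bg; split.
  by have [M gM] := bdg; exists M => w; exact: gM.
exists [:: s + t; s] => e /ug[d d0 hd].
exists (d / 2) => [|w v wv]; first by rewrite divr_gt0.
apply/ltW/hd; rewrite !increment_process (le_lt_trans (gdistB _ _ _ _))//.
have := wv (s + t); have := wv s; rewrite !inE !eqxx orbT => /(_ isT) ? /(_ isT) ?.
lra.
Qed.

(** Conditioning at time [s] leaves a constant: the upper expectation over the
    continuations does not depend on the past. *)
Lemma upper_increment (g : G -> R) s t : 0 <= s -> 0 <= t -> BUC_fun g ->
  up (fun w : Om => g (X (s + t) w - X s w)) = up (fun w : Om => g (X t w)).
Proof.
move=> s0 t0 bg; have cg := cylinder_shifted_increment s t bg.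
rewrite (dynamic_programming sepG complG HS linS l0 s0 cg).
rewrite -[RHS](upper_cst sepG complG HS linS l0); congr up; apply/funext => w.
congr up; apply/funext => v; rewrite increment_process.
rewrite concat_ge ?lerDl// concat_le// (_ : s + t - s = t); last by ring.
by rewrite addrAC subrr add0r.
Qed.

Lemma cylinder_process (g : G -> R) t : BUC_fun g -> cylinder (fun w : Om => g (X t w)).
Proof.
move=> bg; have := cylinder_increment t 0 bg.
by congr cylinder; apply/funext => w; rewrite add0r.
Qed.

Lemma Cb_approximation (f : G -> R) : Cb f ->
  exists f_ : nat -> G -> R, (forall n, BUC_fun (f_ n)) /\
    forall Z : Om -> G, (forall g, BUC_fun g -> cylinder (fun w => g (Z w))) ->
      bounded_measurable (f \o Z) /\
      E (fun w => f_ n (Z w)) @[n --> \oo] --> E (f \o Z).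
Proof.
move=> cbf; have [M fM] := (bounded_funP f).1 cbf.2.
have lsc x e : 0 < e -> exists2 d, 0 < d & forall y, gdist x y < d -> f x - e <= f y.
  move=> e0; have [d d0 hd] := Cb_gdist cbf x e0; exists d => // y /hd.
  by rewrite ler_norml => /andP[_]; lra.
exists (inf_conv (fun x y => gdist x y) f).
have bn n : BUC_fun (inf_conv (fun x y => gdist x y) f n).
  apply: (@BUC_fun_lipschitz _ n%:R) => [|x y].
    by exists M => x; exact: (inf_conv_bound (@gdistxx _ _) (@gdist_ge0 _ _) fM).
  exact: (inf_conv_lip (@gdist_ge0 _ _) (@gdist_sym _ _)
    (fun x y z => gdist_triangle y x z) fM).
split=> // Z cZ.
apply: (sup_mean_approximation (@gdistxx R G) (@gdist_ge0 R G) fM lsc) => n.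
exact: cZ.
Qed.

Lemma levy_stationary s t : 0 <= s -> 0 <= t -> forall f, Cb f ->
  distribution_under E (X (s + t) \- X s) f = distribution_under E (X t) f.
Proof.
move=> s0 t0 f /Cb_approximation[f_ [bn appr]].
have [|_ c1] := appr (X (s + t) \- X s).
  by move=> g; exact: cylinder_shifted_increment.
have [|_ c2] := appr (X t); first by move=> g; exact: cylinder_process.
have c12 : (fun n => E (fun w => f_ n ((X (s + t) \- X s) w))) =
    (fun n => E (fun w => f_ n (X t w))).
  apply/funext => n; rewrite (sup_mean_cylinder (cylinder_process t (bn n))).
  rewrite (sup_mean_cylinder (cylinder_shifted_increment s t (bn n))).
  exact: (upper_increment s0 t0 (bn n)).
rewrite c12 in c1.
exact: (cvg_unique (@Rhausdorff R) c1 c2).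
Qed.

(** The function [f] lies between two functions of [BUC G] that differ from [f 0]
    by [e / 2] at 0; the strong continuity of the semigroup applies to them. *)
Lemma levy_continuous :
  (forall g e, BUC_fun g -> 0 < e -> exists2 d, 0 < d &
     forall h x, 0 <= h -> h < d -> `|@upper_semigroup R G Lambda S h g x - g x| <= e) ->
  forall f, Cb f -> E (f \o X t) @[t --> 0^'+] --> f 0.
Proof.
move=> strong f cbf; have [M fM] := (bounded_funP f).1 cbf.2.
have bfX t : bounded_measurable (f \o X t).
  have [f_ [_ appr]] := Cb_approximation cbf.
  have [g bg|//] := appr (X t).
  exact: (cylinder_process t bg).
apply/cvgrPdist_le => e e0; have e20 : 0 < e / 2 by lra.
have [d d0 hd] := Cb_gdist cbf 0 e20.
have M0 : 0 <= M by apply: le_trans (fM 0).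
pose k (x : G) : R := Num.min 1 (d^-1 * gdist x 0).
have bk : BUC_fun k by apply: (BUC_fun_gdist 0); rewrite invr_ge0 ltW.
have k0 : k 0 = 0 by rewrite /k gdistxx mulr0 min_r.
have kge x : 0 <= k x.
  by rewrite le_min ler01 mulr_ge0 ?invr_ge0 ?(ltW d0) ?gdist_ge0.
have fk x : `|f 0 - f x| <= e / 2 + 2 * M * k x.
  have [xd|xd] := ltP (gdist 0 x) d.
    by rewrite (le_trans (hd x xd))// lerDl !mulr_ge0.
  have -> : k x = 1 by rewrite /k min_l// ler_pdivlMl// mulr1 gdist_sym.
  have := fM 0; have := fM x; rewrite !ler_norml => /andP[? ?] /andP[? ?].
  by apply/andP; split; lra.
pose hi x := 2 * M * k x + (f 0 + e / 2).
pose lo x := - (2 * M) * k x + (f 0 - e / 2).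
have bhi : BUC_fun hi by apply: (lattice_lin VB) => //; exact: (lattice_cst VB).
have blo : BUC_fun lo by apply: (lattice_lin VB) => //; exact: (lattice_cst VB).
have [d1 d10 h1] := strong hi _ bhi e20.
have [d2 d20 h2] := strong lo _ blo e20.
have EU g t : BUC_fun g -> E (fun w => g (X t w)) = @upper_semigroup R G Lambda S t g 0.
  move=> bg; rewrite (sup_mean_cylinder (cylinder_process t bg)) /upper_semigroup.
  by congr up; apply/funext => w; rewrite add0r.
exists (Num.min d1 d2) => /=; first by rewrite lt_min d10.
move=> t; rewrite /ball /= sub0r normrN => + t0.
rewrite gtr0_norm// lt_min => /andP[td1 td2].
have u1 : E (f \o X t) <= E (fun w => hi (X t w)).
  apply: (sup_mean_mono PP0) => // [|w]; first exact: bounded_measurable_cylinder (cylinder_process t bhi).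
  by rewrite /hi /=; have := fk (X t w); rewrite ler_norml => /andP[? ?]; lra.
have u2 : E (fun w => lo (X t w)) <= E (f \o X t).
  apply: (sup_mean_mono PP0) => // [|w]; first exact: bounded_measurable_cylinder (cylinder_process t blo).
  by rewrite /lo /=; have := fk (X t w); rewrite ler_norml => /andP[? ?]; lra.
move: u1 u2; rewrite (EU hi t bhi) (EU lo t blo).
have := h1 t 0 (ltW t0) td1; have := h2 t 0 (ltW t0) td2.
have -> : hi 0 = f 0 + e / 2 by rewrite /hi k0 mulr0 add0r.
have -> : lo 0 = f 0 - e / 2 by rewrite /lo k0 mulr0 add0r.
rewrite !ler_norml => /andP[? ?] /andP[? ?] ? ?.
by apply/andP; split; lra.
Qed.

Section independence.
Variables (n : nat) (tau : 'I_n.+1 -> R) (s t : R).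
Hypotheses (s0 : 0 <= s) (t0 : 0 <= t) (taus : forall i, 0 <= tau i <= s).
Local Notation H := ('rV[G]_n.+1 * G)%type.

Let D (p q : H) : R :=
  \sum_i gdist (p.1 ord0 i) (q.1 ord0 i) + gdist p.2 q.2.

Let Dxx p : D p p = 0.
Proof. by rewrite /D gdistxx addr0 big1// => i _; rewrite gdistxx. Qed.

Let D0 p q : 0 <= D p q.
Proof. by rewrite addr_ge0 ?gdist_ge0// sumr_ge0// => i _; exact: gdist_ge0. Qed.

Let Dsym p q : D p q = D q p.
Proof. by rewrite /D gdist_sym; under eq_bigr do rewrite gdist_sym. Qed.

Let Dtri p q r : D p r <= D p q + D q r.
Proof.
rewrite /D addrACA -big_split/= lerD ?gdist_triangle//.
by apply: ler_sum => i _; exact: gdist_triangle.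
Qed.

Variable f : H -> R.
Hypothesis cbf : Cb f.

Let cf p e : 0 < e -> exists2 d, 0 < d & forall q, D p q < d -> f p - e <= f q.
Proof.
move=> e0; have [ctf _] := cbf; have /cvgrPdist_le/(_ e e0) := ctf p.
move=> /nbhs_ballP[d /= d0 hd]; exists d => // q pq.
suff : `|f p - f q| <= e by rewrite ler_norml => /andP[_]; lra.
have dq2 : gdist p.2 q.2 < d.
  apply: le_lt_trans pq; rewrite lerDr.
  by apply: sumr_ge0 => i _; exact: gdist_ge0.
have dq1 i : gdist (p.1 ord0 i) (q.1 ord0 i) < d.
  apply: le_lt_trans pq; rewrite /D (bigD1 i)//= -addrA lerDl addr_ge0 ?gdist_ge0//.
  by apply: sumr_ge0 => j _; exact: gdist_ge0.
apply: hd; split; last by rewrite ballEmdist.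
split=> // i j; rewrite ballEmdist (ord1 i).
exact: dq1.
Qed.

Let Y (w : Om) : 'rV[G]_n.+1 := \row_i X (tau i) w.
Let Z : Om -> G := X (s + t) \- X s.
Local Notation f_ := (inf_conv D f).

Let Y_concat (w v : R -> G) : Y (concat s w v) = Y w.
Proof.
apply/rowP => i; rewrite !mxE /X; have /andP[_ ts] := taus i.
by rewrite !concat_le.
Qed.

Let Z_concat (w v : R -> G) : Z (concat s w v) = X t v.
Proof.
rewrite /Z /= increment_process concat_ge ?lerDl// concat_le//.
rewrite (_ : s + t - s = t); last by ring.
by rewrite addrAC subrr add0r.
Qed.

Let approx_lip M (fM : forall p, `|f p| <= M) j p q :
  `|f_ j p - f_ j q| <= j%:R * D p q.
Proof. exact: (inf_conv_lip D0 Dsym Dtri fM). Qed.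

Let cylinder_approx M (fM : forall p, `|f p| <= M) j :
  cylinder (fun w : Om => f_ j (Y w, Z w)).
Proof.
pose sigma := [:: 0; s + t; s] ++ [seq tau i | i <- enum 'I_n.+1].
apply: (@cylinder_lipschitz _ sigma (j%:R * (n.+1%:R * 2 + 2))).
  by exists M => w; exact: (inf_conv_bound Dxx D0 fM).
move=> d w v d0 wv; apply: le_trans (approx_lip fM j _ _) _.
rewrite -mulrA ler_wpM2l// mulrDl /D; apply: lerD.
  apply: (@le_trans _ _ (\sum_(i < n.+1) 2 * d)).
    apply: ler_sum => i _; rewrite !mxE.
    have s_0 : 0 \in sigma by rewrite inE eqxx.
    have s_i : tau i \in sigma.
      by rewrite /sigma mem_cat; apply/orP; right; apply: map_f; rewrite mem_enum.
    exact: near_on_process s_0 s_i wv.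
  by rewrite sumr_const card_ord -[X in X <= _]mulr_natl mulrA.
rewrite /Z /= !increment_process (le_trans (gdistB _ _ _ _))//.
have := wv (s + t); have := wv s; rewrite !inE !eqxx !orbT => /(_ isT) ? /(_ isT) ?.
by lra.
Qed.

Let BUC_approx M (fM : forall p, `|f p| <= M) j y : BUC_fun (fun z => f_ j (y, z)).
Proof.
apply: (@BUC_fun_lipschitz _ j%:R) => [|z z'].
  by exists M => z; exact: (inf_conv_bound Dxx D0 fM).
apply: le_trans (approx_lip fM j _ _) _.
by rewrite /D/= big1 ?add0r// => i _; rewrite gdistxx.
Qed.

(** For Lipschitz [f] this is dynamic programming at time [s], since the observed
    values are not affected by the continuation. The general case is a double
    passage to the limit from below. *)
Lemma levy_independent : E (fun w => f (Y w, Z w)) =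
  E (fun w => E (fun v => f (Y w, Z v))).
Proof.
have [M fM] := (bounded_funP f).1 cbf.2.
have cYZ := cylinder_approx fM; have bfz := BUC_approx fM.
have cZ j y : cylinder (fun v : Om => f_ j (y, Z v)).
  exact: (cylinder_shifted_increment s t (bfz j y)).
pose g j w := E (fun v => f_ j (Y w, Z v)).
pose g' w := E (fun v => f (Y w, Z v)).
have gE j w : g j w = up (fun v : Om => f_ j (Y (concat s w v), Z (concat s w v))).
  rewrite /g sup_mean_cylinder// (upper_increment s0 t0 (bfz j (Y w))).
  by congr up; apply/funext => v; rewrite Y_concat Z_concat.
have cg j : cylinder (g j : Om -> R).
  have := cylinder_upper sepG complG HS linS l0 s (cYZ j).
  by congr cylinder; apply/funext => w; rewrite gE.
have step j : E (fun w => f_ j (Y w, Z w)) = E (g j).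
  rewrite !sup_mean_cylinder// (dynamic_programming sepG complG HS linS l0 s0 (cYZ j)).
  by congr up; apply/funext => w; rewrite gE.
have appr := sup_mean_approximation Dxx D0 fM cf.
have [bYZ c1] := appr (fun w => (Y w, Z w)) cYZ.
have apprZ y := appr (fun v => (y, Z v)) (cZ ^~ y).
have gcvg w : g j w @[j --> \oo] --> g' w by have [_ h] := apprZ (Y w); exact: h.
have bg j := bounded_measurable_cylinder (cg j).
have bg' : bounded_measurable g'.
  split.
    apply: (measurable_fun_cvg (h := g)) => [j|w _]; [exact: (bg j).1|exact: gcvg].
  apply/bounded_funP; exists M => w; rewrite ler_norml; have [bfY _] := apprZ (Y w).
  apply/andP; split.
    rewrite -(sup_mean_cst PP0 (- M)); apply: (sup_mean_mono PP0) => //; first exact: bounded_measurable_cst.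
    by move=> v; have := fM (Y w, Z v); rewrite ler_norml => /andP[].
  rewrite -[leRHS](sup_mean_cst PP0 M); apply: (sup_mean_mono PP0) => //; first exact: bounded_measurable_cst.
  by move=> v; have := fM (Y w, Z v); rewrite ler_norml => /andP[].
have c2 : E (g j) @[j --> \oo] --> E g'.
  apply: (sup_mean_cvg_below PP0) => // w i j ij.
  apply: (sup_mean_mono PP0); [exact/bounded_measurable_cylinder/cZ..|move=> v].
  exact: (inf_conv_nondecreasing D0 fM).
rewrite (funext step : (fun j => E (fun w => f_ j (Y w, Z w))) = _) in c1.
exact: (cvg_unique (@Rhausdorff R) c1 c2).
Qed.

End independence.

End levy.

(** * Existence of the nonlinear Levy process *)

Theorem theorem2p5 (R : realType) (G : metricZmodType R)
    (sepG : separable_space G) (complG : complete_space G)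
    (Lambda : Type) (Lambda0 : [set: Lambda] !=set0)
    (DA : Lambda -> set (BUC G)) (A : Lambda -> BUC G -> BUC G)
    (S : Lambda -> R -> BUC G -> BUC G)
    (A1 : forall l, [/\ markovian_convolution_semigroup (S l),
                        forall t, 0 <= t -> linear (S l t)
                      & is_generator (S l) (DA l) (A l)])
    (A2 : dense (common_domain DA A)) :
  exists (d : measure_display) (Omega : measurableType d)
    (E : (Omega -> R) -> R) (X : R -> Omega -> G),
    [/\ sublinear_expectation_space E,
        levy_process E X,
        forall f : BUC G, exists u : R -> BUC G,
          [/\ forall t x, 0 <= t -> u t x = E (fun w => f (x + X t w)),
              viscosity_solution (common_domain DA A) (sup_gen A) u
            & u 0 = f]
      & exists PP : set (probability Omega R), forall Y : Omega -> R,
          bounded_measurable Y ->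
          (E Y)%:E = ereal_sup [set 'E_P[Y]%E | P in PP]].
Proof.
have HS l : markovian_convolution_semigroup (S l) by have [] := A1 l.
have linS l t : 0 <= t -> linear (S l t) by have [_ h _] := A1 l; exact: h.
have genA l : is_generator (S l) (DA l) (A l) by have [] := A1 l.
have [l0 _] := Lambda0.
pose PP := @control_measures R G Lambda S.
have PP0 : PP !=set0 := control_measures_nonempty sepG complG HS linS l0.
exists _, (canonical_space G), (sup_mean PP), canonical_process; split.
- exact: sublinear_sup_mean.
- split.
  + by move=> t _; exact: measurable_process.
  + move=> f cbf.
    have -> : f \o canonical_process 0 = fun=> f 0.
      by apply/funext => w; rewrite /= /canonical_process subrr.
    exact: sup_mean_cst.
  + move=> s t s0 t0 f cbf; exact: (levy_stationary sepG complG HS linS l0).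
  + move=> s t s0 t0 n tau taus _ f cbf.
    exact: (levy_independent sepG complG HS linS l0 s0 t0 taus cbf).
  + move=> f cbf; apply: (levy_continuous sepG complG HS linS l0) => // g e bg e0.
    exact: (upper_semigroup_strong sepG complG HS linS l0 genA A2).
- move=> f; have bf : BUC_fun (f : G -> R) := BUCP f.
  exists (value_function (S := S) f); split.
  + move=> t x t0; rewrite (value_functionE sepG complG HS linS l0)//.
    by rewrite sup_mean_cylinder//; exact: cylinder_increment.
  + split; first exact: (value_function_subsolution sepG complG HS linS l0 genA A2).
    exact: (value_function_supersolution sepG complG HS linS l0 genA A2).
  + apply/BUC_eqP => x; rewrite (value_functionE sepG complG HS linS l0)//.
    exact: (upper_semigroup0 sepG complG HS linS l0).
- by exists PP => Y bY; exact: sup_meanE.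
Qed.
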